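(* Let $\varphi:\mathbb{T}\to\mathbb{R}^+$ be a $C^3$ function with Fourier series $$\varphi(x)=\sum_{m\in\mathbb{Z}}c_m e^{2\pi i m x},$$ whose coefficients satisfy the following three conditions: (H1) there exist nonnegative constants $C_m$ ($m\ge 1$) such that $\sum_{l=2}^\infty |c_{lm}|^2\le C_m|c_m|^2$ for all $m\geq 1$, and $\sum_{m=1}^\infty C_m<\infty$; (H2) there exists $0<K_1<1/4$ such that $\sum_{l=2}^\infty |c_{lm}|<K_1|c_m|$ for all sufficiently large $m$; (H3) there exists $K_2>0$ such that $\sum_{l=2}^\infty |l\,c_{lm}|<K_2|c_m|$ for all sufficiently large $m$. Then for every $\alpha\in\mathbb{R}\setminus\mathbb{Q}$, either (1) the special flow $T^t_{(\alpha,\varphi)}$ is weak mixing, or (2) the special flow $T^t_{(\alpha,\varphi)}$ is $L^2$ conjugate to a suspension flow.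
   Context: $\mathbb{T}=\mathbb{R}/\mathbb{Z}$ with Lebesgue measure; $\mathbb{R}^+$ is the set of strictly positive reals; $R_\alpha(x)=x+\alpha$ is the rotation of $\mathbb{T}$ by $\alpha$. Special flow: $T^t_{(\alpha,\varphi)}$ is the flow over $R_\alpha$ under the roof function $\varphi$. It acts on $\{(x,s): x\in\mathbb{T},\,0\le s\le\varphi(x)\}$ with $(x,\varphi(x))$ identified with $(x+\alpha,0)$, by moving the second coordinate at unit speed, and it preserves the normalized restriction of Lebesgue measure $dx\,ds$. Weak mixing: the flow has continuous spectrum, i.e. the only eigenvalue is $0$ and it is simple (its eigenfunctions are a.e. constant). Here $\lambda\in\mathbb{R}$ is an eigenvalue if there is a nonzero measurable $f$ with $f\circ T^t=e^{2\pi i\lambda t}f$ a.e. for all $t$. Suspension flow: the special flow over $R_\alpha$ under a positive constant roof function. The special flow $T^t_{(\alpha,\varphi)}$ is $L^2$ conjugate to a suspension flow if $\varphi$ is cohomologous over $R_\alpha$ to a constant $c$ with an $L^2$ transfer function, that is, there is $\psi\in L^2(\mathbb{T})$ with $\psi(x+\alpha)-\psi(x)=\varphi(x)-c$ for a.e. $x$ (necessarily $c=\int_{\mathbb{T}}\varphi\,dx$); the flow is then conjugate to the special flow under the constant $c$ via the map induced by $\psi$. *)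

(* Defs.v *)
From HB Require Import structures.
From mathcomp Require Import all_boot all_order all_algebra.
From mathcomp Require Import complex.
From mathcomp Require Import all_classical all_reals all_analysis.

Set Implicit Arguments.
Unset Strict Implicit.
Unset Printing Implicit Defensive.

Import Order.TTheory GRing.Theory Num.Theory.
Import numFieldNormedType.Exports.

Local Open Scope classical_set_scope.
Local Open Scope ring_scope.

(* Functions on the circle R/Z are 1-periodic functions on R; points of the
   circle are represented by their representative in [0, 1[. *)
Definition periodic1 (R : realType) (V : Type) (f : R -> V) : Prop :=
  forall x, f (x + 1) = f x.

Definition circle_proj (R : realType) (x : R) : R := x - (Num.floor x)%:~R.

Definition circle_measure (R : realType) :
    {measure set (measurableTypeR R) -> \bar R} :=
  mrestr (@lebesgue_measure R) (measurable_itv `[0, 1[).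

Definition of_class_C (R : realType) (n : nat) (f : R -> R) : Prop :=
  (forall k x, (k < n)%N -> derivable (derive1n k f) x 1) /\
  continuous (derive1n n f).

(* On R[i] the norm is R[i]-valued; the R-valued modulus is Normc.normc.
   complex.Re and complex.Im are the R-valued projections. *)
Definition expi (R : realType) (t : R) : R[i] := Complex (cos t) (sin t).

(* The integral of f(x) exp(- 2 i pi m x) for real-valued f, split into real
   and imaginary parts. *)
Definition fourier_coef (R : realType) (f : R -> R) (m : int) : R[i] :=
  let e x := expi (- (2 * pi * m%:~R * x)) in
  Complex (\int[circle_measure R]_x (f x * complex.Re (e x)))
          (\int[circle_measure R]_x (f x * complex.Im (e x))).

(* Birkhoff sums along x |-> x + alpha for a time n of either sign:
   S_0 = 0 and S_(n+1) (x) = S_n (x) + phi (x + n alpha) for every integer n. *)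
Definition birkhoff_sum (R : realType) (alpha : R) (phi : R -> R) (n : int)
    (x : R) : R :=
  match n with
  | Posz k => \sum_(0 <= j < k) phi (x + j%:R * alpha)
  | Negz k => - \sum_(1 <= j < k.+2) phi (x - j%:R * alpha)
  end.

(* The phase space: (x, phi x) is identified with (x + alpha, 0), so the points
   with 0 <= s < phi x form a set of representatives. *)
Definition special_space (R : realType) (phi : R -> R) : set (R * R) :=
  [set z | (0 <= z.1 < 1) && (0 <= z.2 < phi z.1)].

(* The point at height s + t above x, after the n identifications that bring it
   back under the graph of phi. For a continuous periodic phi > 0 that integer
   n exists and is unique. *)
Definition special_flow (R : realType) (alpha : R) (phi : R -> R) (t : R)
    (z : R * R) : R * R :=
  let n := xget 0 [set n : int | birkhoff_sum alpha phi n z.1 <= z.2 + t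
                                 < birkhoff_sum alpha phi (n + 1) z.1] in
  (circle_proj (z.1 + n%:~R * alpha), z.2 + t - birkhoff_sum alpha phi n z.1).

(* Normalized Lebesgue measure dx ds of the phase space, as a measure on the
   whole plane giving no mass to the complement. *)
Definition special_measure (R : realType) (phi : R -> R) (A : set (R * R)) :
    \bar R :=
  let mu := (@lebesgue_measure R \x @lebesgue_measure R)%E in
  (((fine (mu (special_space phi)))^-1)%:E * mu (A `&` special_space phi))%E.

(* Measurability is Borel; a Lebesgue measurable f is a.e. equal to a Borel
   one. *)
Definition eigenfunction (R : realType) (d : measure_display)
    (X : measurableType d) (nu : set X -> \bar R) (T : R -> X -> X)
    (lambda : R) (f : X -> R[i]) : Prop :=
  [/\ measurable_fun setT (fun z => complex.Re (f z)),
      measurable_fun setT (fun z => complex.Im (f z)),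
      ~ {ae nu, forall z, f z = 0} &
      forall t, {ae nu, forall z, f (T t z) = expi (2 * pi * lambda * t) * f z}].

Definition weak_mixing (R : realType) (d : measure_display)
    (X : measurableType d) (nu : set X -> \bar R) (T : R -> X -> X) : Prop :=
  (forall lambda, (exists f, eigenfunction nu T lambda f) <-> lambda = 0) /\
  (forall f, eigenfunction nu T 0 f -> exists a, {ae nu, forall z, f z = a}).

Definition special_flow_weak_mixing (R : realType) (alpha : R) (phi : R -> R) :
    Prop :=
  weak_mixing (X := (measurableTypeR R * measurableTypeR R)%type)
    (special_measure phi) (special_flow alpha phi).

(* phi is cohomologous to the constant roof c of a suspension flow, with a
   transfer function psi in L^2; integrating forces c = \int phi. *)
Definition L2_conjugate_to_suspension (R : realType) (alpha : R)
    (phi : R -> R) : Prop :=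
  exists (c : R) (psi : R -> R),
    [/\ 0 < c, periodic1 psi, psi \in Lfun (circle_measure R) 2%:E &
        {ae circle_measure R, forall x, psi (x + alpha) - psi x = phi x - c}].

(* Main.v *)
(* Write phi = c + sum_k rho_k cos(2 pi k x + om_k) with rho_k = 2|c_k| = O(k^-3).
   Formally phi - c is the coboundary of the series with coefficients
   rho_k / (2 sin(pi k alpha)).  If these are square summable, Riesz-Fischer gives
   an L^2 transfer function and hence a suspension flow.

   Otherwise only the resonances matter: k is resonant if 16 k ||k alpha|| < 1, and
   then k = l q with q primitive (alpha is close to p/q in lowest terms).  By (H2)
   the block of multiples of q is controlled by its first term, so the sum of
   a_q^2 = (rho_q / |sin(pi q alpha)|)^2 over primitive q diverges.  Primitive
   denominators are lacunary (ratio at least 15), so one can choose t with t alpha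
   close to an integer such that, over a window M <= q < N, the amplitude of the
   q-th wave in the Birkhoff sum S_t is comparable to z_q = min(a_q / 2, kappa),
   with sum z_q^2 of order kappa^2, while the waves outside the window are
   negligible.  Second and fourth moments of this lacunary sum show that the mean of
   cos(mu S_t) stays below 1 - e.  But an eigenfunction of the flow with eigenvalue
   lambda <> 0 restricts to a unitary cocycle g(x + alpha) = exp(2 pi i lambda phi(x))
   g(x), so exp(2 pi i lambda S_t) = g(x + t alpha) / g(x) has mean close to 1 as soon
   as t alpha is close to an integer.  Hence 0 is the only eigenvalue, and it is
   simple because the rotation is ergodic. *)
Require Import Defs.
From HB Require Import structures.
From mathcomp Require Import all_boot all_order all_algebra.
From mathcomp Require Import complex ring lra.
From mathcomp Require Import all_classical all_reals all_analysis.
From mathcomp Require Import measurable_realfun.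

Set Implicit Arguments.
Unset Strict Implicit.
Unset Printing Implicit Defensive.

Import Order.TTheory GRing.Theory Num.Theory.
Import numFieldNormedType.Exports.

Local Open Scope classical_set_scope.
Local Open Scope ring_scope.

Implicit Types R : realType.

Local Notation leb R := (@lebesgue_measure R).

(** * Bounded measurable functions on the circle and their means *)

(** The obstacle is that an eigenfunction is only measurable: all that can be used is continuity of
    translation in mean, so the contradiction must come from times t with t alpha close to an
    integer. At such times every fixed wave of S_t is small, and growth has to come from far
    resonances. The fractional part of q t alpha is therefore placed between y_q / 2 and y_q, with
    y_q = min(1/2, kappa / a_q), for one primitive q after the other, in nested intervals for t
    alpha of which the first has length 3 / M; lacunarity leaves room for the next condition.
    Truncating at kappa keeps the variance of order kappa^2, so that it beats the fourth moment, of
    order kappa^4, in the Taylor expansion of the cosine once kappa is small against 1 / mu. The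
    threshold 16 for resonance yields the ratio 15, which puts each frequency above three times all
    frequencies of earlier blocks. A non-resonant k has |sin(pi k alpha)| >= 1 / (32 k), so its wave
    has amplitude O(k^-2) in S_t uniformly in t; the decay k^-3 of the coefficients makes this
    summable. *)

Definition bmeas R (f : R -> R) : Prop :=
  measurable_fun [set: R] f /\ exists M, forall x, `|f x| <= M.

Definition mean R (f : R -> R) : R := \int[circle_measure R]_x f x.

Lemma circle_measure_setT R : circle_measure R setT = 1%E.
Proof. by rewrite /circle_measure/= /mrestr/= setTI lebesgue_measure_itv/= lte01 sube0. Qed.

Lemma bmeas_integrable R (f : R -> R) (A : set R) : measurable A ->
  bmeas f -> (circle_measure R).-integrable A (EFin \o f).
Proof.
move=> mA [mf [M fM]]; apply: measurable_bounded_integrable => //.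
- apply: (@le_lt_trans _ _ (circle_measure R setT)).
    by apply: le_measure; rewrite ?inE.
  by rewrite circle_measure_setT ltry.
- exact: measurable_funTS.
- exists M; split; first exact: num_real.
  by move=> y My x _ /=; rewrite (le_trans (fM x))// ltW.
Qed.

Lemma bmeas_cst R (c : R) : bmeas (fun=> c).
Proof. by split=> //; exists `|c|. Qed.

Lemma bmeasD R (f g : R -> R) : bmeas f -> bmeas g -> bmeas (fun x => f x + g x).
Proof.
move=> [mf [M fM]] [mg [N gN]]; split; first exact: measurable_funD.
by exists (M + N) => x; rewrite (le_trans (ler_normD _ _))// lerD.
Qed.

Lemma bmeasM R (f g : R -> R) : bmeas f -> bmeas g -> bmeas (fun x => f x * g x).
Proof.
move=> [mf [M fM]] [mg [N gN]]; split; first exact: measurable_funM.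
by exists (M * N) => x; rewrite normrM ler_pM.
Qed.

Lemma bmeasZ R (c : R) (f : R -> R) : bmeas f -> bmeas (fun x => c * f x).
Proof. by apply: bmeasM; exact: bmeas_cst. Qed.

Lemma bmeasN R (f : R -> R) : bmeas f -> bmeas (fun x => - f x).
Proof. by move=> [mf [M fM]]; split; [exact: measurableT_comp | exists M => x; rewrite normrN]. Qed.

Lemma bmeasB R (f g : R -> R) : bmeas f -> bmeas g -> bmeas (fun x => f x - g x).
Proof. by move=> ? ?; apply: bmeasD => //; exact: bmeasN. Qed.

Lemma bmeasX R (f : R -> R) n : bmeas f -> bmeas (fun x => f x ^+ n).
Proof.
move=> bf; elim: n => [|n ih]; first exact: bmeas_cst.
by under eq_fun do rewrite exprS; exact: bmeasM.
Qed.

Lemma bmeas_norm R (f : R -> R) : bmeas f -> bmeas (fun x => `|f x|).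
Proof. by move=> [mf [M fM]]; split; [exact: measurableT_comp | exists M => x; rewrite normr_id]. Qed.

Lemma bmeas_sum R (I : Type) (r : seq I) (P : pred I) (f : I -> R -> R) :
  (forall i, bmeas (f i)) -> bmeas (fun x => \sum_(i <- r | P i) f i x).
Proof.
move=> bf; elim: r => [|i r ih].
  by under eq_fun do rewrite big_nil; exact: bmeas_cst.
by under eq_fun do rewrite big_cons; case: (P i) => //; exact: bmeasD.
Qed.

Lemma bmeas_shift R (f : R -> R) t : bmeas f -> bmeas (fun x => f (x + t)).
Proof.
move=> [mf [M fM]]; split; last by exists M.
by apply: measurableT_comp => //; exact: measurable_funD.
Qed.

Lemma continuous_bmeas R (f : R -> R) M :
  continuous f -> (forall x, `|f x| <= M) -> bmeas f.
Proof. by move=> cf fM; split; [exact: continuous_measurable_fun|exists M]. Qed.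

Lemma bmeas_comp R (f g : R -> R) M :
  continuous g -> (forall x, `|g x| <= M) -> measurable_fun setT f -> bmeas (fun x => g (f x)).
Proof.
move=> cg gM mf; split; last by exists M.
by apply: measurableT_comp => //; exact: continuous_measurable_fun.
Qed.

Lemma mean_cst R (c : R) : mean (fun=> c) = c.
Proof. by rewrite /mean Rintegral_cst// circle_measure_setT mulr1. Qed.

Lemma meanD R (f g : R -> R) : bmeas f -> bmeas g ->
  mean (fun x => f x + g x) = mean f + mean g.
Proof. by move=> bf bg; rewrite /mean RintegralD//; exact: bmeas_integrable. Qed.

Lemma meanB R (f g : R -> R) : bmeas f -> bmeas g ->
  mean (fun x => f x - g x) = mean f - mean g.
Proof. by move=> bf bg; rewrite /mean RintegralB//; exact: bmeas_integrable. Qed.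

Lemma meanZ R (c : R) (f : R -> R) : bmeas f ->
  mean (fun x => c * f x) = c * mean f.
Proof. by move=> bf; rewrite /mean RintegralZl//; exact: bmeas_integrable. Qed.

Lemma meanN R (f : R -> R) : bmeas f -> mean (fun x => - f x) = - mean f.
Proof.
move=> bf; rewrite -mulN1r -meanZ//.
by congr mean; apply/funext => x; rewrite mulN1r.
Qed.

Lemma le_mean R (f g : R -> R) : bmeas f -> bmeas g ->
  (forall x, f x <= g x) -> mean f <= mean g.
Proof. by move=> bf bg fg; rewrite /mean le_Rintegral//; exact: bmeas_integrable. Qed.

Lemma mean_ge0 R (f : R -> R) : (forall x, 0 <= f x) -> 0 <= mean f.
Proof. by move=> f0; exact: Rintegral_ge0. Qed.

Lemma le_norm_mean R (f : R -> R) : bmeas f ->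
  `|mean f| <= mean (fun x => `|f x|).
Proof. by move=> bf; rewrite /mean le_normr_Rintegral//; exact: bmeas_integrable. Qed.

Lemma norm_mean_le R (f : R -> R) M : bmeas f ->
  (forall x, `|f x| <= M) -> `|mean f| <= M.
Proof.
move=> bf fM; rewrite (le_trans (le_norm_mean bf))// -[leRHS]mean_cst.
by apply: le_mean => //; [exact: bmeas_norm|exact: bmeas_cst].
Qed.

Lemma mean_sum R (I : Type) (r : seq I) (P : pred I) (f : I -> R -> R) :
  (forall i, bmeas (f i)) ->
  mean (fun x => \sum_(i <- r | P i) f i x) = \sum_(i <- r | P i) mean (f i).
Proof.
move=> bf; elim: r => [|i r ih].
  by rewrite big_nil; under eq_fun do rewrite big_nil; exact: mean_cst.
rewrite big_cons; under eq_fun do rewrite big_cons.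
by case: (P i) => //; rewrite meanD ?ih//; exact: bmeas_sum.
Qed.

(** * Almost everywhere statements on the circle *)

Lemma circle_aeS R (P Q : R -> Prop) : (forall x, P x -> Q x) ->
  {ae circle_measure R, forall x, P x} -> {ae circle_measure R, forall x, Q x}.
Proof. by move=> PQ; apply: negligibleS => x /= nQ Px; apply: nQ; exact: PQ. Qed.

Lemma circle_ae_and R (P Q : R -> Prop) :
  {ae circle_measure R, forall x, P x} -> {ae circle_measure R, forall x, Q x} ->
  {ae circle_measure R, forall x, P x /\ Q x}.
Proof.
move=> aP aQ; apply: negligibleS (negligibleU aP aQ) => x /= nPQ.
by apply: contrapT => /not_orP[/contrapT Px /contrapT Qx]; exact: nPQ.
Qed.

Lemma circle_ae_interval R (P : R -> Prop) :
  (forall x, 0 <= x < 1 -> P x) -> {ae circle_measure R, forall x, P x}.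
Proof.
move=> aP; exists (~` `[0, 1[%classic); split.
- exact: measurableC.
- by rewrite /circle_measure/= /mrestr/= setICl measure0.
- by move=> x /= nPx; rewrite in_itv/= => /aP.
Qed.

Lemma circle_ae_ex R (P : R -> Prop) :
  {ae circle_measure R, forall x, P x} -> exists x, P x.
Proof.
move=> [A [mA A0 PA]]; apply: contrapT => nP.
have AT : A = setT by apply/seteqP; split => // x _; apply: PA => Px; apply: nP; exists x.
by have := circle_measure_setT R; rewrite -AT A0 => /esym/eqP; rewrite onee_eq0.
Qed.

Lemma mean_ae_eq R (f g : R -> R) :
  measurable_fun setT f -> measurable_fun setT g ->
  {ae circle_measure R, forall x, f x = g x} -> mean f = mean g.
Proof.
move=> mf mg fg; rewrite /mean /Rintegral; congr fine; apply: ae_eq_integral => //.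
- exact/measurable_EFinP.
- exact/measurable_EFinP.
- by apply: circle_aeS fg => x + _ /=; move=> ->.
Qed.

Lemma mean_eq0_ae R (f : R -> R) : bmeas f -> (forall x, 0 <= f x) ->
  mean f = 0 -> {ae circle_measure R, forall x, f x = 0}.
Proof.
move=> bf f0 mf0.
have mf : measurable_fun setT (EFin \o f) by apply/measurable_EFinP; case: bf.
have : (\int[circle_measure R]_x `|(EFin \o f) x| = 0)%E.
  have /= := bmeas_integrable measurableT bf.
  move=> /integrableP[_ fi].
  have fin : (\int[circle_measure R]_x `|(EFin \o f) x|)%E \is a fin_num.
    by rewrite ge0_fin_numE// integral_ge0.
  rewrite -(fineK fin); congr EFin; rewrite -[RHS]mf0 /mean /Rintegral; congr fine.
  by apply: eq_integral => x _ /=; rewrite ger0_norm.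
move=> /(ae_eq_integral_abs (circle_measure R) measurableT mf).
by apply: filterS => x /(_ Logic.I) /= [].
Qed.

(** * Invariance of the circle measure under translation *)

Definition translate R (t : R) : measurableTypeR R -> measurableTypeR R :=
  fun x => (x : R) + t.

Lemma measurable_translate R (t : R) : measurable_fun setT (translate t).
Proof. exact: measurable_funD. Qed.

Lemma lebesgue_measure_translate R (t : R) (A : set (measurableTypeR R)) :
  measurable A ->
  leb R A = pushforward (leb R) (translate t) A.
Proof.
move=> mA; have mt := @measurable_translate R t.
pose m : {measure set (measurableTypeR R) -> \bar R} :=
  pushforward (leb R) (translate t).
apply: (@lebesgue_measure_unique R (m mt)) => // _ [[a b] _ <-] /=.
rewrite /m/= /pushforward (_ : _ @^-1` _ = `]a - t, b - t]%classic); last first.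
  by apply/seteqP; split => x /=; rewrite /translate !in_itv/= ltrBlDr lerBrDr.
rewrite !lebesgue_measure_itv/= !lte_fin ltrD2r; case: ifPn => // _.
by rewrite -!EFinD; congr EFin; ring.
Qed.

Lemma lebesgue_integral_shift R (t : R) (f : R -> \bar R) (D : set R) :
  measurable D -> measurable_fun D f -> (forall y, (0 <= f y)%E) ->
  (\int[leb R]_(y in D) f y =
   \int[leb R]_(x in [set x | D (x + t)%R]) f (x + t)%R)%E.
Proof.
move=> mD mf f0; have mt := @measurable_translate R t.
pose m : {measure set (measurableTypeR R) -> \bar R} :=
  pushforward (leb R) (translate t).
transitivity (\int[m mt]_(y in D) f y)%E.
  by apply: eq_measure_integral => A mA _; exact: lebesgue_measure_translate.
by rewrite ge0_integral_pushforward.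
Qed.

Lemma ge0_circle_integral R (f : R -> \bar R) : measurable_fun setT f ->
  (forall x, (0 <= f x)%E) ->
  (\int[circle_measure R]_x f x = \int[leb R]_(x in `[0%R, 1%R[) f x)%E.
Proof.
move=> mf f0.
transitivity (\int[circle_measure R]_(x in setT `\` ~` (`[0%R, 1%R[%classic : set R)) f x)%E.
  apply: ge0_negligible_integral => //; first exact: measurableC.
  by rewrite /circle_measure/= /mrestr/= setICl measure0.
rewrite setTD setCK; apply: eq_measure_integral => A mA A01.
by rewrite /circle_measure/= /mrestr/= setIidl.
Qed.

(** Cut [t, 1 + t[ at 1 and translate the upper piece back by 1. *)
Lemma ge0_integral_period R (t : R) (f : R -> \bar R) : measurable_fun setT f ->
  (forall x, (0 <= f x)%E) -> periodic1 f -> 0 <= t < 1 ->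
  (\int[leb R]_(x in `[0%R, 1%R[) f (x + t)%R =
   \int[leb R]_(x in `[0%R, 1%R[) f x)%E.
Proof.
move=> mf f0 pf /andP[t0 t1].
have shiftset (a b s : R) : [set x | `[a + s, b + s[%classic (x + s)] = `[a, b[%classic.
  by apply/seteqP; split => x /=; rewrite !in_itv/= lerD2r ltrD2r.
have mfD (D : set R) : measurable D -> measurable_fun D f by move=> mD; exact: measurable_funTS.
transitivity (\int[leb R]_(x in `[(0 + t)%R, (1 + t)%R[) f x)%E.
  rewrite (lebesgue_integral_shift (f := f) t)//; last exact: mfD.
  by congr (integral _ _ _); apply/esym; exact: shiftset.
have -> : `[0 + t, 1 + t[%classic = `[0 + t, 1[%classic `|` `[0 + 1, t + 1[%classic :> set R.
  apply/seteqP; split => x /=; rewrite !in_itv/= !add0r.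
    by move=> /andP[tx x1]; case: (ltP x 1) => x1'; [left; rewrite tx|right; rewrite addrC].
  by move=> [] /andP[? ?]; apply/andP; split; lra.
have -> : `[0%R, 1%R[%classic = `[0, t[%classic `|` `[0 + t, 1[%classic :> set R.
  apply/seteqP; split => x /=; rewrite !in_itv/= !add0r.
    by move=> /andP[tx x1]; case: (ltP x t) => x1'; [left; rewrite tx|right].
  by move=> [] /andP[? ?]; apply/andP; split; lra.
rewrite !ge0_integral_setU//; first last.
- by apply/disj_set2P; apply/seteqP; split => x //=; rewrite !in_itv/= => -[/andP[? ?] /andP[? ?]]; lra.
- by apply: mfD; exact: measurableU.
- by apply/disj_set2P; apply/seteqP; split => x //=; rewrite !in_itv/= => -[/andP[? ?] /andP[? ?]]; lra.
- by apply: mfD; exact: measurableU.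
rewrite addeC; congr (_ + _)%E.
rewrite (lebesgue_integral_shift (f := f) (D := `[0 + 1, t + 1[%classic) 1)//; last exact: mfD.
transitivity (\int[leb R]_(x in `[0%R, t[) f (x + 1)%R)%E.
  by congr (integral _ _ _); exact: shiftset.
by apply: eq_integral => x _; rewrite pf.
Qed.

Lemma periodic1_int R (V : Type) (f : R -> V) (n : int) x : periodic1 f -> f (x + n%:~R) = f x.
Proof.
move=> pf; have pn m y : f (y + m%:R) = f y.
  by elim: m y => [|m ih] y; rewrite ?addr0// -natr1 addrA pf ih.
case: n => n; first exact: pn.
by rewrite NegzE mulrNz -(pn n.+1 (x - _)) subrK.
Qed.

Lemma circle_projE R (V : Type) (f : R -> V) x : periodic1 f -> f (circle_proj x) = f x.
Proof. by move=> pf; rewrite /circle_proj -mulrNz periodic1_int. Qed.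

Lemma circle_proj_itv R (x : R) : 0 <= circle_proj x < 1.
Proof. by have /andP[h1 h2] := floor_itv x; rewrite /circle_proj subr_ge0 h1/= ltrBlDr addrC -intrD1.
Qed.

Lemma ge0_circle_integral_shift R (t : R) (f : R -> \bar R) : measurable_fun setT f ->
  (forall x, (0 <= f x)%E) -> periodic1 f ->
  (\int[circle_measure R]_x f (x + t)%R = \int[circle_measure R]_x f x)%E.
Proof.
move=> mf f0 pf.
have mft : measurable_fun setT (fun x : R => f (x + t)).
  by apply: measurableT_comp => //; exact: measurable_funD.
rewrite !ge0_circle_integral// -(ge0_integral_period mf f0 pf (circle_proj_itv t)).
by apply: eq_integral => x _; rewrite /circle_proj addrA -mulrNz periodic1_int.
Qed.

(** Adding the bound M makes f nonnegative, where the invariance of the extended integral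
    applies. *)
Lemma mean_shift R (t : R) (f : R -> R) : bmeas f -> periodic1 f ->
  mean (fun x => f (x + t)) = mean f.
Proof.
move=> bf pf; have [_ [M fM]] := bf.
have bg : bmeas (fun x => f x + M) by apply: bmeasD => //; exact: bmeas_cst.
have g0 x : 0 <= f x + M by have := fM x; rewrite ler_norml => /andP[]; lra.
have : mean (fun x => f (x + t) + M) = mean (fun x => f x + M).
  rewrite /mean /Rintegral; congr fine.
  apply: (@ge0_circle_integral_shift R t (fun x => (f x + M)%:E)).
  - by apply/measurable_EFinP; case: bg.
  - by move=> x; rewrite lee_fin.
  - by move=> x; rewrite pf.
rewrite !meanD ?mean_cst//; [exact: addIr|exact: bmeas_cst|exact: bmeas_shift|exact: bmeas_cst].
Qed.

(** A null set of [circle_measure] is arbitrary outside [0, 1[, so only its trace there is used. A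
    bad x + t differs from a point of this trace by an integer, hence countably many translates of
    one null set cover the bad x. *)
Lemma circle_ae_shift R (t : R) (P : R -> Prop) : periodic1 P ->
  {ae circle_measure R, forall x, P x} -> {ae circle_measure R, forall x, P (x + t)}.
Proof.
move=> pP [A [mA A0 PA]].
have null s : (circle_measure R).-negligible [set x : R | (A `&` `[0, 1[%classic) (x + s)].
  have mA' : measurable (A `&` `[0, 1[%classic : set (measurableTypeR R)) by exact: measurableI.
  have mB : measurable (translate s @^-1` (A `&` `[0, 1[%classic)).
    by rewrite -[X in measurable X]setTI; exact: measurable_translate.
  exists (translate s @^-1` (A `&` `[0, 1[%classic)); split=> //.
  apply/eqP; rewrite eq_le measure_ge0 andbT -A0.
  apply: (@le_trans _ _ (leb R (translate s @^-1` (A `&` `[0, 1[%classic)))).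
    by apply: le_measure; rewrite ?inE//; exact: measurableI.
  by have := lebesgue_measure_translate s mA'; rewrite /pushforward => <-.
pose F n : set (measurableTypeR R) := [set x : R | (A `&` `[0, 1[%classic) (x + (t + n%:R))] `|`
  [set x : R | (A `&` `[0, 1[%classic) (x + (t - n%:R))].
have : (circle_measure R).-negligible (\bigcup_n F n).
  by apply: negligible_bigcup => n; exact: negligibleU.
apply: negligibleS => x /= nP.

have Ax : (A `&` `[0, 1[%classic) (circle_proj (x + t)).
  split; last by rewrite /= in_itv/=; exact: circle_proj_itv.
  by apply: PA => /=; rewrite circle_projE.
move: Ax; rewrite /circle_proj; case: (Num.floor (x + t)) => n Ax.
- by exists n => //; right; rewrite /= addrA.
- by exists n.+1 => //; left; rewrite /= addrA; move: Ax; rewrite NegzE mulrNz opprK.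
Qed.
Lemma measurable_circle_proj R : measurable_fun setT (@circle_proj R).
Proof.
apply: measurable_funB => //; apply: nondecreasing_measurable => // x y xy.
by rewrite ler_int; exact: le_floor.
Qed.

Lemma EFin_mean R (f : R -> R) : bmeas f -> (forall x, 0 <= f x) ->
  (mean f)%:E = (\int[leb R]_(x in `[0%R, 1%R[) (f x)%:E)%E.
Proof.
move=> bf f0; rewrite -ge0_circle_integral//; last by apply/measurable_EFinP; case: bf.
rewrite /mean /Rintegral fineK//.
exact: integrable_fin_num (bmeas_integrable measurableT bf).
Qed.

(** * Continuity of translation in mean *)

Lemma translate_uniform R (h : R -> R) (a b e : R) : continuous h -> 0 < e ->
  exists2 d, 0 < d & forall t x, `|t| < d -> a <= x <= b -> `|h (x + t) - h x| < e.
Proof.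
move=> ch e0.
(* The near-covering form of compactness gives one neighbourhood of t = 0 that serves all x of the
   segment. *)
have /compact_near_coveringP cK := @segment_compact R a b.
have : \forall t \near (0 : R), `[a, b] `<=` [set x | `|h (x + t) - h x| < e].
  apply: (cK R (nbhs 0) (fun t x => `|h (x + t) - h x| < e)) => x _.
  have c1 : (fun p : R * R => h (p.1 + p.2) - h p.1) @ (x, 0) --> h (x + 0) - h x.
    apply: cvgB.
      apply: continuous_cvg; first exact: ch.
      by apply: cvgD; [exact: cvg_fst|exact: cvg_snd].
    by apply: continuous_cvg; [exact: ch|exact: cvg_fst].
  rewrite addr0 subrr in c1.
  have /cvgr0_norm_lt := c1; move=> /(_ e e0).
  by apply: filterS => -[y t].
move=> /nbhs_ballP[d /= d0 dP]; exists d => // t x td xab.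
by apply: (dP t); rewrite /= ?in_itv//= /ball/= sub0r normrN.
Qed.

(** An L^1 approximation of g by a continuous h reduces the claim to uniform continuity of h. It is
    taken on [-1, 2], which contains [0, 1[ and its translates by |t| < 1. Each of the three errors
    costs at most e / 4. *)
Lemma mean_translate_cont R (g : R -> R) (e : R) : bmeas g -> periodic1 g -> 0 < e ->
  exists2 d, 0 < d & forall t, `|t| < d -> mean (fun x => `|g (x + t) - g x|) < e.
Proof.
move=> bg pg e0.
have [mg [M gM]] := bg.
pose E : set R := `[(-1), 2]%classic.
have mE : measurable E by exact: measurable_itv.
have Eoo : (leb R E < +oo)%E.
  by rewrite /E lebesgue_measure_itv/= lte_fin; case: ifPn => _; rewrite ?ltry.
have ig : (leb R).-integrable E (EFin \o g).
  apply: measurable_bounded_integrable => //; first exact: measurable_funTS.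
  exists M; split; first exact: num_real.
  by move=> y My x _ /=; rewrite (le_trans (gM x))// ltW.
have [h_ [ch_ _ /fine_cvgP[fin cvh]]] := approximation_continuous_integrable mE Eoo ig.
have e4 : 0 < e / 4 by rewrite divr_gt0.
have /cvgr0_norm_lt/(_ _ e4)[N1 _ hN1] := cvh.
have [N2 _ hN2] := fin.
pose n := maxn N1 N2; pose h := h_ n.
have ch : continuous h := ch_ n.
have mh : measurable_fun setT h by exact: continuous_measurable_fun.
have mgh : measurable_fun setT (fun x => `|g x - h x|%:E).
  by apply/measurable_EFinP; apply: measurableT_comp => //; exact: measurable_funB.
have hE : (\int[leb R]_(x in E) `|g x - h x|%:E < (e / 4)%:E)%E.
  have := hN1 n (leq_maxl _ _); rewrite /= => /ltr_normlW hlt.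
  have fin' := hN2 n (leq_maxr _ _).
  have : ((fine (\int[leb R]_(z in E) `|(g z - h_ n z)%:E|))%:E < (e / 4)%:E)%E by rewrite lte_fin.
  by rewrite fineK.
have [d d0 hd] := translate_uniform (-1) 2 ch e4.
exists (Num.min d 1); first by rewrite lt_min d0/=.
move=> t; rewrite lt_min => /andP[td]; rewrite ltr_norml => /andP[t1 t2].
have bgt := bmeas_shift t bg.
have mt : measurable_fun setT (fun x : R => x + t : R) by exact: measurable_funD.
rewrite -lte_fin EFin_mean//; last exact/bmeas_norm/bmeasB.
have mht : measurable_fun setT (fun x : R => h (x + t)) by exact: measurableT_comp.
apply: (@le_lt_trans _ _ (\int[leb R]_(x in `[0%R, 1%R[)
    (`|g (x + t)%R - h (x + t)%R|%:E + (`|g x - h x|%:E + (e / 4)%:E)))%E).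
  apply: ge0_le_integral => //.
  - apply: measurable_funTS; apply/measurable_EFinP; apply: measurableT_comp => //.
    by apply: measurable_funB => //; case: bgt.
  - apply: measurable_funTS; apply: emeasurable_funD.
      apply/measurable_EFinP; apply: measurableT_comp => //.
      by apply: measurable_funB => //; case: bgt.
    by apply: emeasurable_funD.
  - move=> x; rewrite /= in_itv/= => /andP[x0 x1]; rewrite -!EFinD lee_fin.
    have xE : -1 <= x <= 2 by apply/andP; split; lra.
    have := hd t x td xE.
    have -> : g (x + t) - g x = (g (x + t) - h (x + t)) + ((h x - g x) + (h (x + t) - h x)) by ring.
    move=> hlt.
    by rewrite (le_trans (ler_normD _ _))// lerD2l (le_trans (ler_normD _ _))// distrC lerD// ltW.
rewrite ge0_integralD//; first last.
- by apply: measurable_funTS; exact: emeasurable_funD.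
- by move=> x _; rewrite -!EFinD lee_fin !addr_ge0// ltW.
- apply: measurable_funTS; apply/measurable_EFinP; apply: measurableT_comp => //.
  by apply: measurable_funB => //; case: bgt.
rewrite ge0_integralD//; [|exact: measurable_funTS|by move=> x _; rewrite lee_fin ltW].
rewrite integral_cst//= lebesgue_measure_itv/= lte01 sube0 mule1.
have h1 : (\int[leb R]_(x in `[0%R, 1%R[) `|g x - h x|%:E < (e / 4)%:E)%E.
  apply: le_lt_trans hE; apply: ge0_subset_integral => //; first exact: measurable_funTS.
  by move=> x /=; rewrite /E/= !in_itv/= => /andP[? ?]; apply/andP; split; lra.
have h2 : (\int[leb R]_(x in `[0%R, 1%R[) `|g (x + t)%R - h (x + t)%R|%:E < (e / 4)%:E)%E.
  apply: le_lt_trans hE.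
  apply: (@le_trans _ _ (\int[leb R]_(x in `[(0 + t)%R, (1 + t)%R[) `|g x - h x|%:E)%E).
    rewrite (lebesgue_integral_shift (f := fun x => `|g x - h x|%:E) (D := `[0 + t, 1 + t[%classic) t)//; last exact: measurable_funTS.
    rewrite le_eqVlt; apply/orP; left; apply/eqP; congr (integral _ _ _).
    by apply/seteqP; split => x /=; rewrite !in_itv/= lerD2r ltrD2r.
  apply: ge0_subset_integral => //; first exact: measurable_funTS.
  by move=> x /=; rewrite /E/= !in_itv/= => /andP[? ?]; apply/andP; split; lra.
have e40 : ((e / 4)%:E < (e / 2)%:E)%E by rewrite lte_fin; lra.
have -> : e%:E = ((e / 4)%:E + ((e / 4)%:E + (e / 2)%:E))%E by rewrite -!EFinD; congr EFin; lra.
by apply: lteD => //; apply: lteD.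
Qed.

(** * Resonant denominators *)

(** The nearest integer, halves being rounded up. The distance [dist_int] x is written ||x|| in the
    comments below. *)
Definition near_int R (x : R) : int := Num.floor (x + 2^-1).

Definition dist_int R (x : R) : R := `|x - (near_int x)%:~R|.

Lemma dist_int_le2 R (x : R) : dist_int x <= 2^-1.
Proof.
rewrite /dist_int /near_int; have /andP[] := floor_itv (x + 2^-1).
by rewrite intrD1 ler_norml => h1 h2; apply/andP; split; lra.
Qed.

Lemma near_int_unique R (x : R) (p : int) : `|x - p%:~R| < 2^-1 -> near_int x = p.
Proof.
rewrite ltr_norml => /andP[h1 h2]; apply: floor_def.
by rewrite intrD1; apply/andP; split; lra.
Qed.

Lemma dist_int_small R (x : R) (p : int) : `|x - p%:~R| < 2^-1 -> dist_int x = `|x - p%:~R|.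
Proof. by move=> h; rewrite /dist_int (near_int_unique h). Qed.

Definition resonant R (al : R) (k : nat) : bool :=
  (0 < k)%N && (dist_int (k%:R * al) * (16 * k%:R) < 1).

(* The denominator q of the lowest-terms fraction near al when k is resonant, so that k is
   a multiple of q; 0 when k is not resonant. *)
Definition den R (al : R) (k : nat) : nat :=
  if resonant al k then (k %/ gcdn k `|near_int (k%:R * al)|)%N else 0%N.

(** Fixed points of [den], that is, resonant q whose nearby fraction is already in lowest terms; q >
    0 excludes the default value 0 of [den]. *)
Definition prim R (al : R) (q : nat) : bool := (0 < q)%N && (den al q == q).

Lemma prim_resonant R (al : R) q : prim al q -> resonant al q.
Proof. by move=> /andP[q0]; rewrite /den; case: ifP => // _ /eqP q_0; rewrite -q_0 in q0. Qed.

Lemma prim_coprime R (al : R) q : prim al q -> coprime q `|near_int (q%:R * al)|.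
Proof.
move=> pq; have rq := prim_resonant pq; move: pq => /andP[q0]; rewrite /den rq => /eqP e.
rewrite /coprime; set g := gcdn _ _ in e *.
have : (g * q = q)%N by rewrite -{1}e mulnC divnK// dvdn_gcdl.
by move=> /eqP; rewrite -{2}(mul1n q) eqn_pmul2r.
Qed.

(** Let p be the nearest integer to k alpha and g = gcd(k, p). Then k alpha - p is g times q alpha -
    p / g, so k and ||k alpha|| both shrink by the factor g. Hence q is resonant with nearest
    integer p / g, which is coprime to q. *)
Lemma den_spec R (al : R) k : (0 < den al k)%N ->
  prim al (den al k) /\ exists l, [/\ (0 < l)%N, k = (l * den al k)%N &
    dist_int (k%:R * al) = l%:R * dist_int ((den al k)%:R * al)].
Proof.
rewrite /den; case: ifPn => // rk.
have k0 : (0 < k)%N by case/andP: rk.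
set p := near_int (k%:R * al); set g := gcdn k `|p|.
have g0 : (0 < g)%N by rewrite gcdn_gt0 k0.
have gk : (g %| k)%N by exact: dvdn_gcdl.
set q := (k %/ g)%N => q0.
have kE : k = (g * q)%N by rewrite mulnC divnK.
have [p' pE] : exists p' : int, p = g%:Z * p'.
  have : (g%:Z %| p)%Z by rewrite dvdzE/= dvdn_gcdr.
  by move=> /dvdzP[p' ->]; exists p'; rewrite mulrC.
have gR0 : 0 < g%:R :> R by rewrite ltr0n.
have kalE : k%:R * al - p%:~R = g%:R * (q%:R * al - p'%:~R).
  by rewrite kE pE natrM intrM -pmulrn; ring.
have distE : dist_int (k%:R * al) = g%:R * `|q%:R * al - p'%:~R|.
  by rewrite /dist_int -/p kalE normrM gtr0_norm.
have g1 : 1 <= g%:R :> R by rewrite ler1n.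
have q1 : 1 <= q%:R :> R by rewrite ler1n.
have rk' : g%:R * `|q%:R * al - p'%:~R| * (16 * (g%:R * q%:R)) < 1.
  by rewrite -distE -natrM -kE; case/andP: rk.
have n0 : 0 <= `|q%:R * al - p'%:~R| by [].
have small16 : `|q%:R * al - p'%:~R| * (16 * q%:R) < 1.
  apply: le_lt_trans rk'; rewrite -!mulrA; set e := `|_| in n0 *.
  rewrite (_ : g%:R * _ = e * (16 * q%:R) * (g%:R * g%:R)); last by ring.
  by rewrite mulrA ler_peMr ?mulr_ege1// !mulr_ge0// ltW// ltr0n.
have small : `|q%:R * al - p'%:~R| < 2^-1 by nra.
have qp : near_int (q%:R * al) = p' by exact: near_int_unique.
have dq := dist_int_small small.
have rq : resonant al q by rewrite /resonant q0 dq.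
have cop : gcdn q `|p'| = 1%N.
  have : gcdn (g * q) `|g%:Z * p'| = g by rewrite -kE -pE.
  move=> e; have : (g * gcdn q `|p'| = g * 1)%N by rewrite muln1 -{2}e abszM -muln_gcdr.
  by move=> /eqP; rewrite eqn_pmul2l// => /eqP.
split; last by exists g; split => //; rewrite distE dq.
by rewrite /prim q0/= /den rq qp cop divn1.
Qed.

(** Fractions p / q and p' / q' in lowest terms with different denominators satisfy |p q' - p' q| >=
    1, hence q' ||q alpha|| + q ||q' alpha|| >= 1. The second term is below 1/16 because q < q' and
    q' is resonant. *)
Lemma prim_gap R (al : R) q q' : prim al q -> prim al q' -> (q < q')%N ->
  15 / 16 <= q'%:R * dist_int (q%:R * al).
Proof.
move=> pq pq' qq'.
have cq := prim_coprime pq; have cq' := prim_coprime pq'.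
have /andP[q0 _] := prim_resonant pq.
have /andP[q'0 rq'] := prim_resonant pq'.
set p := near_int (q%:R * al) in cq; set p' := near_int (q'%:R * al) in cq'.
have ne : p * q'%:Z - p' * q%:Z != 0.
  apply/negP => /eqP/eqP; rewrite subr_eq0 => /eqP e.
  have e' : (`|p| * q' = `|p'| * q)%N by have := congr1 absz e; rewrite !abszM.
  have : (q' %| q)%N.
    have : (q' %| `|p'| * q)%N by rewrite -e' dvdn_mull.
    by rewrite Gauss_dvdr.
  by move=> /(dvdn_leq q0); rewrite leqNgt qq'.
have one : 1 <= `|(p * q'%:Z - p' * q%:Z)%:~R| :> R.
  by rewrite -intr_norm -[1]/(1%:~R) ler_int -gtz0_ge1 normr_gt0.
have eR : (p * q'%:Z - p' * q%:Z)%:~R = q'%:R * (p%:~R - q%:R * al) + q%:R * (q'%:R * al - p'%:~R) :> R.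
  by rewrite intrB !intrM -!pmulrn; ring.
have le1 : 1 <= q'%:R * dist_int (q%:R * al) + q%:R * dist_int (q'%:R * al).
  apply: (le_trans one); rewrite eR (le_trans (ler_normD _ _))// !normrM !normr_nat.
  by rewrite (distrC _ (q%:R * al)).
have qltR : q%:R <= q'%:R :> R by rewrite ler_nat ltnW.
have d'0 : 0 <= dist_int (q'%:R * al) by exact: normr_ge0.
nra.
Qed.

Lemma prim_lacunary R (al : R) q q' : prim al q -> prim al q' -> (q < q')%N ->
  (15 * q <= q')%N.
Proof.
move=> pq pq' qq'; have := prim_gap pq pq' qq'.
have /andP[q0 rq] := prim_resonant pq.
have d0 : 0 <= dist_int (q%:R * al) by exact: normr_ge0.
have q'0 : 1 <= q'%:R :> R by rewrite ler1n (leq_trans _ qq').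
have q1 : 1 <= q%:R :> R by rewrite ler1n.
by rewrite -(ler_nat R) natrM; nra.
Qed.

(** With k = l q, resonance of k reads 16 l^2 q ||q alpha|| < 1; multiply by q. *)
Lemma den_sqr_le R (al : R) k : (0 < den al k)%N ->
  k%:R ^+ 2 * (16 * dist_int ((den al k)%:R * al)) <= (den al k)%:R.
Proof.
move=> d0; have [pq [l [l0 kE dE]]] := den_spec d0.
have /andP[_] : resonant al k by move: d0; rewrite /den; case: ifP.
rewrite dE; set q := den al k in kE *; set e := dist_int _.
have q1 : 0 < q%:R :> R by rewrite ltr0n.
rewrite kE natrM => h.
rewrite (_ : _ ^+ 2 * _ = l%:R * e * (16 * (l%:R * q%:R)) * q%:R); last by ring.
by rewrite ger_pMl// ltW.
Qed.

(** Lacunarity extends from primitive denominators to whole blocks: with q = [den] k, the gap and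
    [den_sqr_le] give 15 k^2 <= q q', and 15 q <= q'. *)
Lemma den_lt_prim R (al : R) k q' : (0 < den al k)%N -> prim al q' ->
  (den al k < q')%N -> (15 * k <= q')%N.
Proof.
move=> d0 pq' dq'; have h1 := den_sqr_le d0.
have [pq [l [l0 kE dE]]] := den_spec d0.
have h2 := prim_gap pq pq' dq'.
have h3 := prim_lacunary pq pq' dq'.
move: h1 h2 h3; rewrite -(ler_nat R) natrM -[(15 * k <= q')%N](ler_nat R) natrM.
set q := (den al k)%:R; set e := dist_int _ => h1 h2 h3.
have e0 : 0 <= e by exact: normr_ge0.
have q'0 : 0 <= q'%:R :> R by [].
have k0 : 0 <= k%:R :> R by [].
have : k%:R ^+ 2 * 15 <= q * q'%:R by nra.
move=> h4; rewrite -ler_sqr ?nnegrE ?mulr_ge0//; nra.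
Qed.

Lemma dist_int_gt0 R (al : R) k : irrational al -> (0 < k)%N -> 0 < dist_int (k%:R * al).
Proof.
move=> ial k0; rewrite lt_neqAle normr_ge0 andbT eq_sym normr_eq0 subr_eq0.
apply/negP => /eqP e; apply: ial; rewrite /rational/=.
have kR : k%:R != 0 :> R by rewrite pnatr_eq0 -lt0n.
have -> : al = (near_int (k%:R * al))%:~R / k%:R by rewrite -e mulrC mulKf.
exists ((near_int (k%:R * al))%:~R / k%:R) => //.
by rewrite fmorph_div/= ratr_int ratr_nat.
Qed.

(** For 0 <= t < q the points t alpha lie within 1 / q of t p / q, and these run through all
    multiples of 1 / q modulo 1 because p is coprime to q. *)
Lemma orbit_dense R (al : R) q a b : prim al q -> a + 3 / q%:R <= b ->
  exists2 t : nat, (t < q)%N & exists j : int, a <= t%:R * al - j%:~R <= b.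
Proof.
move=> pq ab; have cq := prim_coprime pq.
have /andP[q0 rq] := prim_resonant pq.
set p := near_int (q%:R * al) in cq *.
have qR0 : 0 < q%:R :> R by rewrite ltr0n.
have qR1 : 1 <= q%:R :> R by rewrite ler1n.
(* m / q lies between a + 1 / q and a + 2 / q, which leaves 1 / q on either side for the error. *)
pose m : int := Num.floor (a * q%:R) + 2.
(* The time u is the residue of m / p modulo q, the inverse of p being read off a Bezout
   relation. *)
have [u [j [uq tE]]] : exists u : nat, exists j : int, (u < q)%N /\ u%:Z * p = m + j * q%:Z.
  have : coprimez p q%:Z by rewrite coprimezE/= coprime_sym.
  case/coprimezP => -[u v]/= uv.
  have qz : q%:Z != 0 by rewrite eqz_nat -lt0n.
  have r0 := modz_ge0 (m * u) qz; have := ltz_mod (m * u) qz.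
  have e := divz_eq (m * u) q%:Z.
  move: (modz _ _) (divz _ _) e r0 => [r|//] d e r0 rlt.
  exists r, (- (m * v) - d * p); split; first by move: rlt; rewrite -abszE ltz_nat.
  have -> : r%:Z = m * u - d * q%:Z by rewrite e addrC addKr.
  have -> : m + (- (m * v) - d * p) * q%:Z = m * (u * p + v * q%:Z) + (- (m * v) - d * p) * q%:Z.
    by rewrite uv mulr1.
  by ring.
exists u => //; exists j.
have uE : u%:R * al - j%:~R = (m%:~R + u%:R * (q%:R * al - p%:~R)) / q%:R.
  have : (u%:Z * p)%:~R = (m + j * q%:Z)%:~R :> R by rewrite tE.
  rewrite intrM intrD intrM -!pmulrn => e.
  have -> : m%:~R = u%:R * p%:~R - j%:~R * q%:R :> R by rewrite e; ring.
  by field; rewrite gt_eqF.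
have uqR : u%:R + 1 <= q%:R :> R by rewrite natr1 ler_nat.
have u0 : 0 <= u%:R :> R by [].
have err : `|u%:R * (q%:R * al - p%:~R)| <= 1.
  rewrite normrM normr_nat -/(dist_int (q%:R * al)).
  have d0 : 0 <= dist_int (q%:R * al) by exact: normr_ge0.
  nra.
move: err; rewrite ler_norml => /andP[err1 err2].
have /andP[m1 m2] : a * q%:R + 1 <= m%:~R <= a * q%:R + 2.
  have /andP[f1 f2] := floor_itv (a * q%:R); rewrite /m intrD.
  by move: f2; rewrite intrD1 => f2; apply/andP; split; lra.
rewrite uE ler_pdivlMr// ler_pdivrMr//.
have : (a + 3 / q%:R) * q%:R <= b * q%:R by rewrite ler_wpM2r// ltW.
rewrite mulrDl divfK ?gt_eqF// => abq.
by apply/andP; split; lra.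
Qed.

(** An interval of length at least 3 / N contains, for a suitable integer m, all x with N x - m
    between y_N / 2 and y_N. These x form an interval of length y_N / (2 N), and 6 N <= y_N q'
    restores the invariant [3 <= l * q'] for later q'. A non-primitive N leaves the interval
    unchanged. *)
Lemma nested_intervals R (al : R) (y : nat -> R) M :
  (0 < M)%N ->
  (forall q, prim al q -> (M <= q)%N -> 0 < y q <= 2^-1) ->
  (forall q q', prim al q -> prim al q' -> (M <= q)%N -> (q < q')%N -> 6 * q%:R <= y q * q'%:R) ->
  forall n, exists a l, [/\ 0 <= a, 0 < l, a + l <= 3 / M%:R,
    (forall q x, prim al q -> (M <= q < M + n)%N -> a <= x <= a + l ->
      exists m : int, y q / 2 <= q%:R * x - m%:~R <= y q) &
    forall q', prim al q' -> (M + n <= q')%N -> 3 <= l * q'%:R].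
Proof.
move=> M0 hy hg; elim=> [|n [a [l [a0 l0 al3 hq hq']]]].
  have MR : 0 < M%:R :> R by rewrite ltr0n.
  exists 0, (3 / M%:R); split=> //; rewrite ?add0r ?divr_gt0//.
  - by move=> q x _; rewrite addn0 => /andP[/leq_ltn_trans h /h]; rewrite ltnn.
  - move=> q' _; rewrite addn0 -(ler_nat R) => Mq'.
    by rewrite mulrAC ler_pdivlMr// ler_pM2l.
case: (boolP (prim al (M + n))) => pN; last first.
  exists a, l; split => //.
    move=> q x pq /andP[Mq qn] xal; apply: hq => //; rewrite Mq/= ltn_neqAle.
    move: qn; rewrite addnS ltnS => ->; rewrite andbT.
    by apply/negP => /eqP e; rewrite -e pq in pN.
  by move=> q' pq' h; apply: hq' => //; rewrite (leq_trans _ h)// addnS.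
set N := (M + n)%N in pN hq hq'.
have NR0 : 0 < N%:R :> R by rewrite ltr0n addn_gt0 M0.
have /andP[y0 y2] := hy N pN (leq_addr _ _).
have lN : 3 <= l * N%:R by apply: hq' => //; exact: leqnn.
pose m : int := Num.floor (a * N%:R) + 1.
have /andP[m1 m2] : a * N%:R <= m%:~R <= a * N%:R + 1.
  have /andP[f1 f2] := floor_itv (a * N%:R); rewrite /m.
  by move: f2; rewrite intrD1 => f2; apply/andP; split; lra.
have sub x : (m%:~R + y N / 2) / N%:R <= x <= (m%:~R + y N) / N%:R -> a <= x <= a + l.
  rewrite ler_pdivrMr// ler_pdivlMr// => /andP[x1 x2].
  by apply/andP; split; rewrite -(ler_pM2r NR0) ?mulrDl; lra.
have len : (m%:~R + y N / 2) / N%:R + y N / 2 / N%:R = (m%:~R + y N) / N%:R.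
  by rewrite -mulrDl -addrA -splitr.
have l'0 : 0 < y N / 2 / N%:R by rewrite !divr_gt0.
exists ((m%:~R + y N / 2) / N%:R), (y N / 2 / N%:R); split => //.
- have /andP[+ _] : a <= (m%:~R + y N / 2) / N%:R <= a + l.
    by apply: sub; rewrite lexx/= -len lerDl ltW.
  exact: le_trans.
- have /andP[_] : a <= (m%:~R + y N) / N%:R <= a + l.
    by apply: sub; rewrite lexx andbT -len lerDl ltW.
  by rewrite len => /le_trans; apply.
- move=> q x pq /andP[Mq]; rewrite addnS ltnS leq_eqVlt => /orP[/eqP ->|qN]; rewrite len.
    rewrite ler_pdivrMr// ler_pdivlMr// -/N => /andP[x1 x2]; exists m; apply/andP; split; lra.
  by move=> /sub xal; apply: hq => //; rewrite Mq.
- move=> q' pq' Nq'; have := hg N q' pN pq' (leq_addr _ _); rewrite addnS in Nq'; move=> /(_ Nq').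
  rewrite mulrAC ler_pdivlMr//; lra.
Qed.

(** * Trigonometric estimates and waves *)

(** Tool for the Taylor bounds of sine and cosine below, each of which follows from the previous one
    because it has it as derivative. *)
Lemma nonneg_of_derive R (F f : R -> R) : F 0 = 0 ->
  (forall x : R, is_derive x 1 F (f x)) -> (forall x, 0 <= x -> 0 <= f x) ->
  forall x, 0 <= x -> 0 <= F x.
Proof.
move=> F0 dF f0 x; rewrite le_eqVlt => /orP[/eqP <-|x0]; first by rewrite F0.
have [|c] := @MVT R F f 0 x x0 (fun y _ => dF y).
  by apply: derivable_within_continuous => y _; have [] := dF y.
rewrite in_itv/= => /andP[c0 _]; rewrite F0 !subr0 => ->.
by rewrite mulr_ge0// ?f0// ltW.
Qed.

Lemma sin_le_id R (x : R) : 0 <= x -> sin x <= x.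
Proof.
rewrite -[sin x <= x]subr_ge0; move: x; apply: (@nonneg_of_derive R (fun x => x - sin x) (fun x => 1 - cos x)) => [|y _].
- by rewrite sin0 subr0.
- by rewrite subr_ge0 cos_le1.
Qed.

Lemma cos_ge_sqr R (x : R) : 1 - x ^+ 2 / 2 <= cos x.
Proof.
wlog x0 : x / 0 <= x.
  by move=> h; case: (leP 0 x) => [/h//|x0]; rewrite -(sqrrN x) -(cosN x) h// oppr_ge0 ltW.
rewrite -subr_ge0; move: x x0.
apply: (@nonneg_of_derive R (fun x => cos x - (1 - x ^+ 2 / 2)) (fun x => x - sin x)) => [|y|y y0].
- by rewrite cos0 expr0n/=; lra.
- by apply: is_derive_eq; rewrite /GRing.scale/=; field.
- by rewrite subr_ge0 sin_le_id.
Qed.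

Lemma sin_ge_cube R (x : R) : 0 <= x -> x - x ^+ 3 / 6 <= sin x.
Proof.
rewrite -[_ <= sin x]subr_ge0; move: x.
apply: (@nonneg_of_derive R (fun x => sin x - (x - x ^+ 3 / 6)) (fun x => cos x - (1 - x ^+ 2 / 2))) => [|y|y y0].
- by rewrite sin0 expr0n/=; lra.
- by apply: is_derive_eq; rewrite /GRing.scale/=; field.
- by rewrite subr_ge0 cos_ge_sqr.
Qed.

Lemma cos_le_quartic R (x : R) : cos x <= 1 - x ^+ 2 / 2 + x ^+ 4 / 24.
Proof.
wlog x0 : x / 0 <= x.
  move=> h; case: (leP 0 x) => [/h//|x0].
  have := h (- x); rewrite cosN sqrrN (_ : (- x) ^+ 4 = x ^+ 4); last by ring.
  by apply; rewrite oppr_ge0 ltW.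
rewrite -subr_ge0; move: x x0.
apply: (@nonneg_of_derive R (fun x => (1 - x ^+ 2 / 2 + x ^+ 4 / 24) - cos x)
  (fun x => sin x - (x - x ^+ 3 / 6))) => [|y|y y0].
- by rewrite cos0 !expr0n/=; lra.
- by apply: is_derive_eq; rewrite /GRing.scale/=; field.
- by rewrite subr_ge0 sin_ge_cube.
Qed.

Lemma sin_sub_le_cube R (x : R) : `|sin x - x| <= `|x| ^+ 3 / 6.
Proof.
wlog x0 : x / 0 <= x.
  move=> h; case: (leP 0 x) => [/h//|x0].
  have := h (- x); rewrite sinN normrN -opprD normrN; apply.
  by rewrite oppr_ge0 ltW.
rewrite (ger0_norm x0) ler_norml; apply/andP; split.
  by have := sin_ge_cube x0; lra.
have := sin_le_id x0; have : 0 <= x ^+ 3 by rewrite exprn_ge0.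
lra.
Qed.

Lemma abs_sin_le R (x : R) : `|sin x| <= `|x|.
Proof.
wlog x0 : x / 0 <= x.
  move=> h; case: (leP 0 x) => [/h//|x0].
  by have := h (- x); rewrite sinN !normrN; apply; rewrite oppr_ge0 ltW.
rewrite (ger0_norm x0) ler_norml sin_le_id// andbT.
case: (leP x 1) => [x1|/ltW x1]; last by rewrite (le_trans _ (sin_geN1 x))// lerN2.
by have := sin_ge_cube x0; nra.
Qed.

Lemma abs_sinD_int R (x : R) (j : int) : `|sin (pi * (x + j%:~R))| = `|sin (pi * x)|.
Proof.
have nat_case n y : `|sin (pi * (y + n%:R))| = `|sin (pi * y)| :> R.
  elim: n y => [|n ih] y; first by rewrite addr0.
  by rewrite -natr1 addrA mulrDr mulr1 (sinDpi (pi * (y + n%:R))) normrN ih.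
case: j => n; first exact: nat_case.
by rewrite NegzE mulrNz -(nat_case n.+1 (x - _)) subrK.
Qed.

Lemma pi_le4 R : pi <= 4 :> R.
Proof. by have /andP[_] := pihalf_02 R; lra. Qed.

(** For 0 <= u = pi y <= 2 the cubic bound gives sin u >= u - u^3 / 6 >= u / 3, and pi >= 2. *)
Lemma abs_sin_pi_ge R (y : R) : `|y| <= 2^-1 -> `|y| / 2 <= `|sin (pi * y)|.
Proof.
wlog y0 : y / 0 <= y.
  move=> h; case: (leP 0 y) => [/h//|y0].
  by have := h (- y); rewrite mulrN sinN !normrN; apply; rewrite oppr_ge0 ltW.
rewrite (ger0_norm y0) => y2; apply: le_trans (ler_norm _).
have p2 := pi_ge2 R; have p4 := pi_le4 R.
have u0 : 0 <= pi * y by rewrite mulr_ge0// pi_ge0.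
apply: le_trans (sin_ge_cube u0).
have u2 : pi * y <= 2 by nra.
have : pi * y - (pi * y) ^+ 3 / 6 >= pi * y / 3.
  set u := pi * y in u0 u2 *.
  have : u ^+ 2 <= 4 by nra.
  by rewrite exprSr; nra.
nra.
Qed.

Lemma abs_sin_pi_le R (y : R) : `|sin (pi * y)| <= 4 * `|y|.
Proof.
by rewrite (le_trans (abs_sin_le _))// normrM ger0_norm ?pi_ge0// ler_wpM2r// pi_le4.
Qed.

Lemma abs_sinM_nat R (n : nat) (x : R) : `|sin (n%:R * x)| <= n%:R * `|sin x|.
Proof.
elim: n => [|n ih]; first by rewrite !mul0r sin0 normr0.
rewrite -natr1 mulrDl mul1r sinD (le_trans (ler_normD _ _))// !normrM mulrDl mul1r lerD//.
  by rewrite (le_trans _ ih)// ler_piMr// cos_max.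
by rewrite ler_piMl// cos_max.
Qed.

(** * Waves: phases, products and means *)

Definition wave R (k : nat) (w x : R) : R := cos (2 * pi * k%:R * x + w).

Lemma continuous_wave R k (w : R) : continuous (wave k w).
Proof.
move=> x; apply: continuous_comp; last exact: continuous_cos.
by apply: cvgD; [apply: cvgM; [exact: cvg_cst|exact: cvg_id]|exact: cvg_cst].
Qed.

Lemma wave_bound R k (w x : R) : `|wave k w x| <= 1.
Proof. exact: cos_max. Qed.

Lemma bmeas_wave R k (w : R) : bmeas (wave k w).
Proof. by apply: continuous_bmeas; [exact: continuous_wave|exact: wave_bound]. Qed.

Lemma cosD_nat R (x : R) n : cos (x + 2 * pi * n%:R) = cos x.
Proof.
rewrite (_ : 2 * pi * n%:R = (pi *+ 2) *+ n); first exact: (periodicn (@cosD2pi R)).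
by rewrite -mulr_natr -[pi *+ 2]mulr_natr; ring.
Qed.

Lemma wave_periodic R k (w : R) : periodic1 (wave k w).
Proof.
move=> x; rewrite /wave -[RHS](cosD_nat _ k); congr cos; ring.
Qed.

Lemma wave_shift R k (w x t : R) : wave k w (x + t) = wave k (w + 2 * pi * k%:R * t) x.
Proof. by rewrite /wave; congr cos; ring. Qed.

Lemma wave0 R (w x : R) : wave 0 w x = cos w.
Proof. by rewrite /wave mulr0 mul0r add0r. Qed.

Lemma waveM R j k (w v x : R) : (k <= j)%N ->
  wave j w x * wave k v x = (wave (j - k) (w - v) x + wave (j + k) (w + v) x) / 2.
Proof.
move=> kj; rewrite /wave natrB// natrD.
set a := 2 * pi * j%:R * x + w; set b := 2 * pi * k%:R * x + v.
rewrite (_ : 2 * pi * (j%:R - k%:R) * x + (w - v) = a - b); last by rewrite /a /b; ring.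
rewrite (_ : 2 * pi * (j%:R + k%:R) * x + (w + v) = a + b); last by rewrite /a /b; ring.
by clearbody a b; rewrite cosB cosD; field.
Qed.

(** Translation by half a period, 1 / (2 k), changes the sign of the wave. *)
Lemma mean_wave R k (w : R) : (0 < k)%N -> mean (wave k w) = 0.
Proof.
move=> k0; have kR : k%:R != 0 :> R by rewrite pnatr_eq0 -lt0n.
have : mean (fun x => wave k w (x + (2 * k%:R)^-1)) = mean (wave k w).
  by apply: mean_shift; [exact: bmeas_wave|exact: wave_periodic].
have -> : (fun x => wave k w (x + (2 * k%:R)^-1)) = (fun x => - wave k w x).
  apply/funext => x; rewrite /wave -[RHS](cosDpi (2 * pi * k%:R * x + w)); congr cos.
  by field.
rewrite meanN; last exact: bmeas_wave.
lra.
Qed.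

Lemma periodic_bounded R (f : R -> R) : continuous f -> periodic1 f ->
  exists M, forall x, `|f x| <= M.
Proof.
move=> cf pf.
have [|M [_ hM]] := @compact_bounded R _ (f @` `[0, 1]).
  apply: continuous_compact; last exact: segment_compact.
  exact: continuous_subspaceT.
exists (M + 1) => x; apply: (hM (M + 1)); first by rewrite ltrDl.
have /andP[h0 h1] := circle_proj_itv x.
exists (circle_proj x); last by rewrite circle_projE.
by rewrite /= in_itv/= h0 ltW.
Qed.

Lemma periodic_bmeas R (f : R -> R) : continuous f -> periodic1 f -> bmeas f.
Proof. by move=> cf pf; have [M fM] := periodic_bounded cf pf; exact: continuous_bmeas fM. Qed.

Lemma meanE R (f : R -> R) : bmeas f ->
  mean f = \int[leb R]_(x in `[0%R, 1%R]) f x.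
Proof.
move=> bf; have [mf [M fM]] := bf.
have i01 : (leb R).-integrable `[0, 1[%classic (EFin \o f).
  apply: measurable_bounded_integrable => //.
  - have : (leb R `[0%R, 1%R[%classic < +oo)%E.
      by rewrite lebesgue_measure_itv/= lte01 sube0 ltry.
    exact.
  - exact: measurable_funTS.
  - exists M; split; first exact: num_real.
    by move=> y My x _ /=; rewrite (le_trans (fM x))// ltW.
rewrite -Rintegral_itv_bndo_bndc// /mean /Rintegral; congr fine.
transitivity (\int[circle_measure R]_(x in setT `\` ~` (`[0%R, 1%R[%classic : set R)) (f x)%:E)%E.
  apply: negligible_integral => //; first exact: measurableC.
    exact: bmeas_integrable.
  by rewrite /circle_measure/= /mrestr/= setICl measure0.
rewrite setTD setCK; apply: eq_measure_integral => A mA A01.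
by rewrite /circle_measure/= /mrestr/= setIidl.
Qed.

Lemma mean_derive R (G g : R -> R) : periodic1 G -> periodic1 g -> continuous g ->
  (forall x : R, is_derive x 1 G (g x)) -> mean g = 0.
Proof.
move=> pG pg cg dG.
have cG : continuous G.
  by move=> x; apply: differentiable_continuous; apply/derivable1_diffP; have [] := dG x.
have bg := periodic_bmeas cg pg.
rewrite meanE//.
rewrite /Rintegral (@continuous_FTC2 R g G 0 1 ltr01).
- by rewrite -[X in G X]add0r pG subee.
- exact: continuous_subspaceT.
- split; [by move=> x _; have [] := dG x|exact/cvg_at_right_filter/cG|exact/cvg_at_left_filter/cG].
- by move=> x _; rewrite derive1E; have [] := dG x.
Qed.

(** * Decay and uniqueness of Fourier coefficients *)

Definition orth R (f : R -> R) : Prop := forall k w, mean (fun x => f x * wave k w x) = 0.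

Lemma orth_wave R (f : R -> R) k w : bmeas f -> orth f ->
  orth (fun x => f x * wave k w x).
Proof.
move=> bf orf j v.
have h i u : bmeas (fun x => f x * wave i u x) by apply: bmeasM => //; exact: bmeas_wave.
have key (a b : nat) (u1 u2 : R) : (b <= a)%N -> mean (fun x => f x * (wave a u1 x * wave b u2 x)) = 0.
  move=> ba.
  have -> : (fun x => f x * (wave a u1 x * wave b u2 x)) = (fun x =>
      2^-1 * (f x * wave (a - b) (u1 - u2) x) + 2^-1 * (f x * wave (a + b) (u1 + u2) x)).
    by apply/funext => x; rewrite waveM//; field.
  by rewrite meanD ?meanZ ?orf ?mulr0 ?addr0//; exact: bmeasZ.
case: (leqP k j) => kj.
  by rewrite -[RHS](key _ _ v w kj); congr mean; apply/funext => x; ring.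
by rewrite -[RHS](key _ _ w v (ltnW kj)); congr mean; apply/funext => x; ring.
Qed.

Lemma derive1_periodic R (f : R -> R) : periodic1 f -> periodic1 f^`()%classic.
Proof.
by move=> pf x; rewrite /derive1; under eq_fun do rewrite addrA !pf.
Qed.

Lemma derive1n_periodic R n (f : R -> R) : periodic1 f -> periodic1 (derive1n n f).
Proof. by move=> pf; elim: n => [//|n ih]; rewrite derive1nS; exact: derive1_periodic. Qed.

Lemma is_derive_wave R k (w x : R) :
  is_derive x 1 (wave k w) (2 * pi * k%:R * wave k (w + pi / 2) x).
Proof.
rewrite /wave addrA cosDpihalf.
have h : is_derive x 1 (fun x : R => 2 * pi * k%:R * x + w) (2 * pi * k%:R).
  by apply: is_derive_eq; rewrite /GRing.scale/= mulr1 addr0.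
have := @is_derive1_comp R cos _ x _ _ (is_derive_cos _) h.
by move/is_derive_eq; apply; rewrite mulrC.
Qed.

(** Integration by parts with the wave of phase w - pi / 2 as primitive; the minus sign is absorbed
    by adding pi to that phase. *)
Lemma mean_wave_parts R (f g : R -> R) k (w : R) : (0 < k)%N ->
  periodic1 f -> periodic1 g -> continuous f -> continuous g ->
  (forall x : R, is_derive x 1 f (g x)) ->
  mean (fun x => f x * wave k w x) = (2 * pi * k%:R)^-1 * mean (fun x => g x * wave k (w + pi / 2) x).
Proof.
move=> k0 pf pg cf cg dfg.
have c0 : 2 * pi * k%:R != 0 :> R by rewrite !mulf_neq0 ?pnatr_eq0 -?lt0n// gt_eqF// pi_gt0.
have bf := periodic_bmeas cf pf; have bg := periodic_bmeas cg pg.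
set w' := w - pi / 2.
have bw i u : bmeas (@wave R i u) by exact: bmeas_wave.
have : mean (fun x => g x * wave k w' x + 2 * pi * k%:R * (f x * wave k w x)) = 0.
  apply: (@mean_derive R (fun x => f x * wave k w' x)).
  - by move=> x; rewrite pf wave_periodic.
  - by move=> x; rewrite pf pg !wave_periodic.
  - move=> x; apply: cvgD; first by apply: cvgM; [exact: cg|exact: continuous_wave].
    by apply: cvgM; [exact: cvg_cst|apply: cvgM; [exact: cf|exact: continuous_wave]].
  - move=> x; have h1 := dfg x; have h2 := is_derive_wave k w' x.
    apply: is_derive_eq; rewrite /GRing.scale/= /w' subrK; ring.
rewrite meanD ?meanZ; [|exact: bmeasM|exact: bmeasM|exact/bmeasZ/bmeasM].
have -> : (fun x => g x * wave k w' x) = (fun x => - (g x * wave k (w + pi / 2) x)).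
  apply/funext => x; rewrite /wave (_ : 2 * pi * k%:R * x + (w + pi / 2) = (2 * pi * k%:R * x + w') + pi); last by rewrite /w'; field.
  by rewrite cosDpi mulrN opprK.
rewrite meanN; last exact: bmeasM.
move=> h; apply: (mulfI c0); rewrite mulrA divff// mul1r; lra.
Qed.

Lemma fourier_decay R (f : R -> R) : periodic1 f -> of_class_C 3 f ->
  exists2 C, 0 <= C & forall k w, (0 < k)%N -> `|mean (fun x => f x * wave k w x)| <= C / k%:R ^+ 3.
Proof.
move=> pf [df c3].
have cn n : (n < 4)%N -> continuous (derive1n n f).
  rewrite ltnS leq_eqVlt => /orP[/eqP ->//|n3] x.
  by apply: differentiable_continuous; apply/derivable1_diffP; exact: df.
have dn n : (n < 3)%N -> forall x : R, is_derive x 1 (derive1n n f) (derive1n n.+1 f x).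
  by move=> n3 x; rewrite derive1nS derive1E; exact/derivableP/df.
have pn n := @derive1n_periodic R n f pf.
have [M hM] := periodic_bounded c3 (pn 3).
have M0 : 0 <= M by rewrite (le_trans _ (hM 0)).
exists M => // k w k0.
have kR : 0 < k%:R :> R by rewrite ltr0n.
rewrite (@mean_wave_parts R (derive1n 0 f) (derive1n 1 f) k w k0 (pn 0%N) (pn 1%N) (cn 0%N isT) (cn 1%N isT) (dn 0%N isT)).
rewrite (@mean_wave_parts R (derive1n 1 f) (derive1n 2 f) k (w + pi / 2) k0 (pn 1%N) (pn 2%N) (cn 1%N isT) (cn 2%N isT) (dn 1%N isT)).
rewrite (@mean_wave_parts R (derive1n 2 f) (derive1n 3 f) k (w + pi / 2 + pi / 2) k0 (pn 2%N) (pn 3%N) (cn 2%N isT) (cn 3%N isT) (dn 2%N isT)).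
set m := mean _; set c := (_ * _)^-1.
have cE : `|c| <= k%:R^-1.
  rewrite ger0_norm ?invr_ge0 ?mulr_ge0 ?pi_ge0// lef_pV2 ?posrE ?mulr_gt0 ?pi_gt0//.
  have := pi_ge2 R; nra.
have mM : `|m| <= M.
  apply: norm_mean_le; first by apply: bmeasM; [exact: periodic_bmeas|exact: bmeas_wave].
  move=> x; rewrite normrM -[leRHS]mulr1 ler_pM//; exact: wave_bound.
rewrite !normrM mulrC.
have -> : M / k%:R ^+ 3 = M * k%:R^-1 * k%:R^-1 * k%:R^-1 by field; rewrite gt_eqF.
rewrite (_ : _ * _ = `|m| * `|c| * `|c| * `|c|); last by ring.
by rewrite !ler_pM// ?mulr_ge0.
Qed.

(** Powers of c + cos(2 pi (x - x0)) are trigonometric polynomials, so orthogonality to all waves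
    survives multiplication by them. *)
Lemma orthM_sum R (f : R -> R) n : bmeas f -> orth f -> forall x0 c,
  orth (fun x => f x * (c + cos (2 * pi * (x - x0))) ^+ n).
Proof.
move=> bf orf x0 c; elim: n => [|n ih]; first by under eq_fun do rewrite expr0 mulr1.
pose g x := f x * (c + cos (2 * pi * (x - x0))) ^+ n.
have wE x : cos (2 * pi * (x - x0)) = wave 1 (- (2 * pi * x0)) x by rewrite /wave; congr cos; ring.
have bg : bmeas g.
  apply: bmeasM => //; apply: bmeasX; apply: bmeasD; first exact: bmeas_cst.
  by under eq_fun do rewrite wE; exact: bmeas_wave.
move=> j v.
have bw i u : bmeas (@wave R i u) by exact: bmeas_wave.
have -> : (fun x => f x * (c + cos (2 * pi * (x - x0))) ^+ n.+1 * wave j v x) =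
   (fun x => c * (g x * wave j v x) + g x * wave 1 (- (2 * pi * x0)) x * wave j v x).
  by apply/funext => x; rewrite exprS /g wE; ring.
rewrite meanD ?meanZ; [|exact: bmeasM|exact/bmeasZ/bmeasM|by apply: bmeasM => //; exact: bmeasM].
by rewrite ih mulr0 add0r; exact: orth_wave.
Qed.

Lemma mean_indic R (a b : R) : 0 <= a -> a <= b -> b < 1 ->
  bmeas (\1_(`[a, b]%classic : set R) : R -> R) /\ mean (\1_(`[a, b]%classic : set R) : R -> R) = b - a.
Proof.
move=> a0 ab b1.
have bi : bmeas (\1_(`[a, b]%classic : set R) : R -> R).
  split; first exact: measurable_indic.
  by exists 1 => x; rewrite indicE; case: (_ \in _); rewrite ?normr1 ?normr0.
split => //; apply: EFin_inj; rewrite EFin_mean//.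
rewrite integral_indic//= setIidl.
  by rewrite lebesgue_measure_itv/= lte_fin; move: ab; rewrite le_eqVlt => /predU1P[->|ab]; rewrite ?ltxx ?ab ?subrr ?EFinB.
by move=> x /=; rewrite !in_itv/= => /andP[xa xb]; apply/andP; split; lra.
Qed.

(* Integrate against (1 - cos(2 pi e) + cos(2 pi (y - 1/2)))^n, which grows with n near
   y = 1/2 and stays bounded by 1 for |y - 1/2| > e. *)
Lemma orth_continuous_eq0 R (f : R -> R) : continuous f -> periodic1 f -> orth f ->
  forall x, f x = 0.
Proof.
move=> cf pf orf.
suff nonpos (g : R -> R) x : continuous g -> periodic1 g -> orth g -> g x <= 0.
  move=> x; apply/eqP; rewrite eq_le nonpos//=.
  have := nonpos (fun x => - f x) x; rewrite oppr_le0; apply.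
  - by move=> y; apply: cvgN; exact: cf.
  - by move=> y; rewrite pf.
  - move=> k w; under eq_fun do rewrite mulNr.
    by rewrite meanN ?orf ?oppr0//; apply: bmeasM; [exact: periodic_bmeas|exact: bmeas_wave].
move=> {orf pf cf f} cg0 pg0 org0; rewrite leNgt; apply/negP => gx0.
(* Recentre at 1/2, so that a neighbourhood of the peak lies inside the fundamental domain [0,
   1[. *)
pose h y := g (y + (x - 2^-1)).
have ch : continuous h.
  by move=> y; apply: continuous_comp; [apply: cvgD; [exact: cvg_id|exact: cvg_cst]|exact: cg0].
have ph : periodic1 h by move=> y; rewrite /h addrAC pg0.
have bg0 := periodic_bmeas cg0 pg0; have bh := periodic_bmeas ch ph.
have bw i u : bmeas (@wave R i u) by exact: bmeas_wave.
have orh : orth h.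
  move=> k w; rewrite -[RHS](org0 k (w - 2 * pi * k%:R * (x - 2^-1))).
  rewrite -[RHS](@mean_shift R (x - 2^-1)); [|exact: bmeasM|by move=> y; rewrite pg0 wave_periodic].
  congr mean; apply/funext => y; rewrite /h wave_shift; congr (_ * wave _ _ _); ring.
have h12 : 0 < h 2^-1 by rewrite /h addrC subrK.
set c := h 2^-1 in h12.
have [d d0 hd] : exists2 d, 0 < d & forall y, `|y - 2^-1| < d -> c / 2 < h y.
  have /cvgrPdist_lt/(_ (c / 2)) := ch 2^-1; rewrite divr_gt0// => /(_ isT).
  move=> /nbhs_ballP[d /= d0 dP]; exists d => // y yd.
  have := dP y; rewrite /ball/= distrC => /(_ yd); rewrite -/c ltr_norml => /andP[_]; lra.
pose e := Num.min (d / 2) 4^-1.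
have e0 : 0 < e by rewrite lt_min divr_gt0//= invr_gt0.
have ed : e < d by rewrite gt_min; apply/orP; left; lra.
have e4 : e <= 4^-1 by rewrite ge_min lexx orbT.
clearbody c e.
pose Q y := (1 - cos (2 * pi * e)) + cos (2 * pi * (y - 2^-1)).
have p2 := pi_ge2 R.
have cos_mono (u v : R) : 0 <= u -> u < v -> v <= 2^-1 -> cos (2 * pi * v) < cos (2 * pi * u).
  move=> u0 uv v2; rewrite ltr_cos ?in_itv/=; first by rewrite ltr_pM2l// mulr_gt0// pi_gt0.
    have := mulr_ge0 (pi_ge0 R) u0.
    have : pi * u <= pi * 2^-1 by rewrite ler_wpM2l ?pi_ge0//; lra.
    by move=> ? ?; apply/andP; split; lra.
  have v0 : 0 <= v by lra.
  have := mulr_ge0 (pi_ge0 R) v0.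
  have : pi * v <= pi * 2^-1 by rewrite ler_wpM2l ?pi_ge0//; lra.
  by move=> ? ?; apply/andP; split; lra.
have cos_abs (y : R) : cos (2 * pi * y) = cos (2 * pi * `|y|).
  by case: (leP 0 y) => y0; [rewrite ger0_norm|rewrite ltr0_norm// mulrN cosN].
pose eta := cos (2 * pi * (e / 2)) - cos (2 * pi * e).
have eta0 : 0 < eta by rewrite subr_gt0; apply: cos_mono; lra.
have cose : 0 <= cos (2 * pi * e).
  apply: cos_ge0_pihalf; apply/andP; split; nra.
have [M hM] := periodic_bounded ch ph.
have M0 : 0 <= M by rewrite (le_trans _ (hM 0)).
have ind := @mean_indic R (2^-1 - e / 2) (2^-1 + e / 2).
have [||| bi mi] := ind; [by move: e0 e4; clear; lra..|].
(* Lower bound for the mean of h Q^n, which is 0 by orthogonality. Within e / 2 of 1/2, Q >= 1 + eta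
   and Bernoulli's inequality give at least c / 2 * (1 + n eta); between e / 2 and e the product is
   nonnegative; beyond e it is at least -M since |Q| <= 1. Large n is then absurd. *)
have key n : c / 2 * (1 + n%:R * eta) * e - M <= 0.
  have := orthM_sum n bh orh 2^-1 (1 - cos (2 * pi * e)) 0 0.
  have bQ : bmeas (fun y => h y * Q y ^+ n).
    apply: bmeasM => //; apply: bmeasX; apply: bmeasD; first exact: bmeas_cst.
    have -> : (fun x : R => cos (2 * pi * (x - 2^-1))) = wave 1 (- pi).
      by apply/funext => y; rewrite /wave; congr cos; field.
    exact: bw.
  have -> : (fun y => h y * (1 - cos (2 * pi * e) + cos (2 * pi * (y - 2^-1))) ^+ n * wave 0 0 y)
     = (fun y => h y * Q y ^+ n) by apply/funext => y; rewrite wave0 cos0 mulr1.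
  move=> <-.
  have -> : c / 2 * (1 + n%:R * eta) * e - M =
     mean (fun y => c / 2 * (1 + n%:R * eta) * (\1_(`[2^-1 - e / 2, 2^-1 + e / 2]%classic : set R) y) - M).
    rewrite meanB ?mean_cst ?meanZ ?mi//; [by congr (_ * _ - _); field|exact: bmeasZ|exact: bmeas_cst].
  have bI : bmeas (fun y => c / 2 * (1 + n%:R * eta) * (\1_(`[2^-1 - e / 2, 2^-1 + e / 2]%classic : set R) y) - M).
    by apply: bmeasB; [exact: bmeasZ|exact: bmeas_cst].
  apply: le_mean => //.
  have c1 : 0 <= c / 2 * (1 + n%:R * eta).
    by rewrite mulr_ge0 ?divr_ge0 ?addr_ge0 ?mulr_ge0// ltW.
  have core (y : R) : 0 <= y < 1 ->
      c / 2 * (1 + n%:R * eta) * (\1_(`[2^-1 - e / 2, 2^-1 + e / 2]%classic : set R) y) - M <= h y * Q y ^+ n /\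
      - M <= h y * Q y ^+ n.
    move=> /andP[y0 y1].
    have ya : `|y - 2^-1| <= 2^-1 by rewrite ler_norml; move: y0 y1; clear => ? ?; apply/andP; split; lra.
    have bern (u : R) : 0 <= u -> 1 + n%:R * u <= (1 + u) ^+ n.
      move=> u0; elim: n {bQ bI c1} => [|n ih]; first by rewrite mul0r addr0 expr0.
      rewrite exprS -natr1; have : 0 <= n%:R :> R by []. nra.
    case: (leP `|y - 2^-1| (e / 2)) => yJ.
      have inJ : y \in (`[2^-1 - e / 2, 2^-1 + e / 2]%classic : set R).
        rewrite inE/= in_itv/=; move: yJ; rewrite ler_norml => /andP[].
        by clear => ? ?; apply/andP; split; lra.
      rewrite indicE inJ mulr1.
      have hy : c / 2 < h y by apply: hd; lra.
      have Qy : 1 + eta <= Q y.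
        rewrite /Q /eta (cos_abs (y - 2^-1)); have := normr_ge0 (y - 2^-1); set u := `|_| in yJ * => u0.
        have : cos (2 * pi * (e / 2)) <= cos (2 * pi * u).
          move: yJ; rewrite le_eqVlt => /predU1P[->//|yJ].
          by apply/ltW/cos_mono => //; lra.
        lra.
      have : c / 2 * (1 + n%:R * eta) <= h y * Q y ^+ n.
        apply: ler_pM => //; [by rewrite divr_ge0// ltW|by rewrite addr_ge0// mulr_ge0// ltW|exact: ltW|].
        apply: (le_trans (bern eta (ltW eta0))); rewrite lerXn2r ?nnegrE//; last by lra.
        by rewrite addr_ge0// ltW.
      by lra.
    have notJ : (y \in (`[2^-1 - e / 2, 2^-1 + e / 2]%classic : set R)) = false.
      apply/negP; rewrite inE/= in_itv/= => /andP[u1 u2].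
      move: yJ; apply/negP; rewrite -leNgt ler_norml.
      by move: u1 u2; clear => ? ?; apply/andP; split; lra.
    rewrite indicE notJ mulr0 sub0r.
    suff : - M <= h y * Q y ^+ n by [].
    case: (leP `|y - 2^-1| e) => ye.
      apply: (@le_trans _ _ 0); first by rewrite oppr_le0.
      have hy : c / 2 < h y by apply: hd; lra.
      have Qy : 1 <= Q y.
        rewrite /Q (cos_abs (y - 2^-1)); have := normr_ge0 (y - 2^-1); set u := `|_| in ye * => u0.
        have : cos (2 * pi * e) <= cos (2 * pi * u).
          move: ye; rewrite le_eqVlt => /predU1P[->//|ye].
          by apply/ltW/cos_mono => //; lra.
        lra.
      by rewrite mulr_ge0 ?exprn_ge0//; move: hy Qy h12; clear; lra.
    have Qy : `|Q y| <= 1.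
      have c1e : cos (2 * pi * (y - 2^-1)) < cos (2 * pi * e).
        by rewrite (cos_abs (y - 2^-1)); apply: cos_mono => //; lra.
      have := cos_geN1 (2 * pi * (y - 2^-1)); have := cos_le1 (2 * pi * e).
      by move: c1e; rewrite /Q ler_norml; clear => ? ? ?; apply/andP; split; lra.
    have : `|h y * Q y ^+ n| <= M.
      rewrite normrM normrX -[leRHS]mulr1 ler_pM ?exprn_ge0//.
      by rewrite exprn_ile1.
    by rewrite ler_norml => /andP[].
  move=> y; case: (boolP (0 <= y < 1)) => [/core[]//|ny].
  have notJ : (y \in (`[2^-1 - e / 2, 2^-1 + e / 2]%classic : set R)) = false.
    by apply/negP; rewrite inE/= in_itv/= => /andP[u1 u2]; move: ny; apply/negP/negPn;
      move: u1 u2 e4; clear => ? ? ?; apply/andP; split; lra.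
  rewrite indicE notJ mulr0 sub0r.
  have pQ : periodic1 (fun y => h y * Q y ^+ n).
    move=> z; rewrite ph /Q; congr (_ * (_ + _) ^+ _).
    by rewrite -[RHS](cosD_nat _ 1); congr cos; ring.
  by have [_] := core _ (circle_proj_itv y); rewrite (circle_projE y pQ).
pose K := M / (c / 2 * eta * e).
have [n nK] : exists n : nat, K < n%:R by exists (Num.bound K); apply: le_lt_trans (archi_boundP _); rewrite ?ler_norm// divr_ge0// !mulr_ge0// ltW.
have := key n; move: nK; rewrite /K ltr_pdivrMr ?mulr_gt0 ?divr_gt0//.
set a := c / 2 * eta * e => h1.
rewrite (_ : _ * e = c / 2 * e + n%:R * a); last by rewrite /a; ring.
have : 0 < c / 2 * e by rewrite mulr_gt0 ?divr_gt0.
lra.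
Qed.

(** * Fourier series of a C^3 function *)

Lemma polar R (a b : R) : exists w, a = Num.sqrt (a ^+ 2 + b ^+ 2) * cos w /\
  b = Num.sqrt (a ^+ 2 + b ^+ 2) * sin w.
Proof.
set r := Num.sqrt _.
have r2 : r ^+ 2 = a ^+ 2 + b ^+ 2 by rewrite sqr_sqrtr// addr_ge0// sqr_ge0.
have r0 : 0 <= r by exact: sqrtr_ge0.
have := r0; rewrite le_eqVlt => /predU1P[r00|rp].
  have e : a ^+ 2 + b ^+ 2 = 0 by rewrite -r2 -r00 expr0n.
  have := sqr_ge0 a; have := sqr_ge0 b => b2 a2.
  have : a ^+ 2 = 0 by lra.
  have : b ^+ 2 = 0 by lra.
  move=> /eqP; rewrite sqrf_eq0 => /eqP -> /eqP; rewrite sqrf_eq0 => /eqP ->.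
  by exists 0; rewrite -r00 !mul0r.
have c1 : (a / r) ^+ 2 + (b / r) ^+ 2 = 1.
  by rewrite !expr_div_n -mulrDl -r2 divff// expf_neq0// gt_eqF.
have cb : -1 <= a / r <= 1.
  by rewrite -ler_norml -(@expr_le1 _ 2)// -normrX ger0_norm ?sqr_ge0//; have := sqr_ge0 (b / r); lra.
have sq : Num.sqrt (1 - (a / r) ^+ 2) = `|b / r| by rewrite -c1 addrC addKr sqrtr_sqr.
have rn : r != 0 by rewrite gt_eqF.
case: (lerP 0 b) => b0.
  exists (acos (a / r)); rewrite acosK ?in_itv//= sin_acos// sq ger0_norm ?divr_ge0//.
  by split; field.
exists (- acos (a / r)); rewrite cosN sinN acosK ?in_itv//= sin_acos// sq ltr0_norm ?pmulr_llt0 ?invr_gt0//.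
by split; field.
Qed.

(** For k > 0, the amplitude of the real wave formed by the terms of index k and -k in the Fourier
    series. *)
Definition rho R (f : R -> R) (k : nat) : R := 2 * Normc.normc (fourier_coef f k).

Lemma rho_ge0 R (f : R -> R) k : 0 <= rho f k.
Proof. by rewrite /rho mulr_ge0//; case: (fourier_coef f k) => a b; rewrite /= sqrtr_ge0. Qed.

(** The phase om is the polar angle of the pair of correlations with the waves of phase 0 and pi /
    2; every other phase is a linear combination of these two. *)
Lemma mean_fourier R (f : R -> R) k : bmeas f ->
  exists om, forall w, mean (fun x => f x * wave k w x) = rho f k / 2 * cos (w - om).
Proof.
move=> bf; rewrite /rho /fourier_coef.
set a := \int[_]_x _; set b := \int[_]_x _.
have aE : a = mean (fun x => f x * wave k 0 x).
  by rewrite /a /mean; apply: eq_Rintegral => x _; rewrite /= cosN /wave addr0 pmulrn.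
have bE : b = mean (fun x => f x * wave k (pi / 2) x).
  by rewrite /b /mean; apply: eq_Rintegral => x _; rewrite /= sinN /wave cosDpihalf pmulrn.
have bw i u : bmeas (fun x => f x * wave i u x) by apply: bmeasM => //; exact: bmeas_wave.
have [om [ca cb]] := polar a b; exists om => w.
have -> : (fun x => f x * wave k w x) =
   (fun x => cos w * (f x * wave k 0 x) + sin w * (f x * wave k (pi / 2) x)).
  apply/funext => x; rewrite /wave addr0 cosDpihalf cosD; ring.
rewrite meanD ?meanZ ?bw//; [|exact: bmeasZ|exact: bmeasZ].
rewrite -aE -bE /= cosB; move: (Num.sqrt _) ca cb => r ca cb; rewrite ca cb; field => //.
Qed.

Lemma sum_inv_sqr R n m : (0 < n)%N ->
  \sum_(n <= k < m) (k%:R ^+ 2)^-1 <= 2 / n%:R :> R.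
Proof.
move=> n0; have nR : 0 < n%:R :> R by rewrite ltr0n.
case: (leqP m n) => [mn|nm]; first by rewrite big_geq// divr_ge0.
case: m nm => // m; rewrite ltnS => nm.
(* Telescoping form of the bound: 1 / (m + 1)^2 <= 1 / m - 1 / (m + 1), and the first term is
   absorbed by 1 / n^2 <= 1 / n. *)
suff : \sum_(n <= k < m.+1) (k%:R ^+ 2)^-1 <= 2 / n%:R - m%:R^-1 :> R.
  by move=> /le_trans; apply; rewrite gerBl invr_ge0.
elim: m nm => [|m ih]; first by rewrite leqn0 => /eqP n00; rewrite n00 in n0.
rewrite leq_eqVlt => /predU1P[<-|nm].
  rewrite big_nat1 expr2 invfM; have : n%:R^-1 <= 1 :> R by rewrite invf_le1// ler1n.
  have : 0 <= n%:R^-1 :> R by rewrite invr_ge0.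
  nra.
rewrite big_nat_recr/=; last exact: ltnW.
have mR : 0 < m%:R :> R by rewrite ltr0n (leq_trans n0).
have m1 : 0 < m%:R + 1 :> R by rewrite addr_gt0.
apply: (le_trans (lerD (ih nm) (lexx _))); rewrite -natr1 -addrA lerD2l.
rewrite -subr_ge0 (_ : _ - _ = (m%:R * (m%:R + 1) ^+ 2)^-1); first by rewrite invr_ge0 mulr_ge0// ltW.
by field; rewrite !gt_eqF.
Qed.

Lemma mean_waveM R j k (w v : R) : (0 < k)%N ->
  mean (fun x => wave k v x * wave j w x) = if j == k then cos (w - v) / 2 else 0.
Proof.
move=> k0.
have bw i u : bmeas (@wave R i u) by exact: bmeas_wave.
have key (a b : nat) (u1 u2 : R) : (b <= a)%N -> (0 < a)%N ->
    mean (fun x => wave a u1 x * wave b u2 x) = if a == b then cos (u1 - u2) / 2 else 0.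
  move=> ba a0.
  have -> : (fun x => wave a u1 x * wave b u2 x) = (fun x =>
      2^-1 * wave (a - b) (u1 - u2) x + 2^-1 * wave (a + b) (u1 + u2) x).
    by apply/funext => x; rewrite waveM//; field.
  rewrite meanD ?meanZ//; [|exact: bmeasZ|exact: bmeasZ].
  rewrite (@mean_wave R (a + b)) ?addn_gt0 ?a0// mulr0 addr0.
  case: eqP => [->|/eqP ab].
    by rewrite subnn (_ : wave 0 _ = fun=> cos (u1 - u2)) ?mean_cst 1?mulrC//; apply/funext => x; rewrite wave0.
  by rewrite mean_wave ?mulr0// subn_gt0 ltn_neqAle eq_sym ab.
case: (leqP j k) => jk; first by rewrite key// eq_sym -cosN opprB.
rewrite -[RHS](_ : mean (fun x => wave j w x * wave k v x) = _).
  by congr mean; apply/funext => x; rewrite mulrC.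
by rewrite key ?(ltnW jk)// (leq_trans _ jk).
Qed.

Lemma exists_div_lt R (C e : R) (N : nat) : 0 < e ->
  exists2 n : nat, (N < n)%N & C / n%:R < e.
Proof.
move=> e0; have [n nC] : exists n : nat, C / e < n%:R.
  by exists (Num.bound `|C / e|); exact: le_lt_trans (ler_norm _) (archi_boundP (normr_ge0 _)).
exists (N + n).+1; first by rewrite ltnS leq_addr.
rewrite ltr_pdivrMr// -ltr_pdivrMl// mulrC (lt_le_trans nC)// ler_nat.
by rewrite -addnS (leq_trans (leqnSn n))// leq_addl.
Qed.

Lemma small_div_eq0 R (m C : R) (N : nat) :
  (forall n, (N < n)%N -> `|m| <= C / n%:R) -> m = 0.
Proof.
move=> h; apply: contrapT => /eqP m0; rewrite -normr_gt0 in m0.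
by have [n /h nN /(le_lt_trans nN)] := exists_div_lt C N m0; rewrite ltxx.
Qed.

Lemma uniform_limit_cont R (u : nat -> R -> R) (v : R -> R) (C : R) :
  (forall n, continuous (u n)) -> (forall n x, (0 < n)%N -> `|v x - u n x| <= C / n%:R) -> continuous v.
Proof.
move=> cu huv x; apply/cvgrPdist_lt => e e0.
have e3 : 0 < e / 3 by rewrite divr_gt0.
have [n n0 nC] := exists_div_lt C 0 e3.
have := cu n x => /cvgrPdist_lt/(_ _ e3).
apply: filterS => y hy.
have h1 := huv n x n0; have h2 := huv n y n0.
rewrite (_ : v x - v y = (v x - u n x) + ((u n x - u n y) + - (v y - u n y))); last by ring.
apply: (le_lt_trans (ler_normD _ _)); apply: (le_lt_trans (lerD (lexx _) (ler_normD _ _))).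
rewrite normrN; move: h1 h2 hy nC; set a := C / _; lra.
Qed.

(** The limit is given explicitly, as the supremum of the lower bounds s n - C / n, and comes with
    the rate C / n. *)
Lemma tail_limit R (s : nat -> R) (C : R) :
  (forall n m, (0 < n)%N -> (n <= m)%N -> `|s m - s n| <= C / n%:R) ->
  forall n, (0 < n)%N -> `|sup [set s n - C / n%:R | n in [set n | (0 < n)%N]] - s n| <= C / n%:R.
Proof.
move=> h; set E := [set _ | _ in _].
have bnd n m : (0 < n)%N -> (0 < m)%N -> s n - C / n%:R <= s m + C / m%:R.
  move=> n0 m0; case: (leqP n m) => [nm|/ltnW mn].
    have := h n m n0 nm; have := le_trans (normr_ge0 _) (h m m m0 (leqnn _)).
    by rewrite ler_norml => ? /andP[? ?]; lra.
  have := h m n m0 mn; have := le_trans (normr_ge0 _) (h n n n0 (leqnn _)).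
  by rewrite ler_norml => ? /andP[? ?]; lra.
move=> n n0; rewrite ler_norml lerBlDl lerBrDl; apply/andP; split.
  by apply: ub_le_sup; [exists (s n + C / n%:R) => _ [m /= m0 <-]; exact: bnd|exists n].
by apply: ge_sup; [exists (s n - C / n%:R), n|move=> _ [m /= m0 <-]; exact: bnd].
Qed.

Lemma continuous_sum R (I : Type) (r : seq I) (f : I -> R -> R) :
  (forall i, continuous (f i)) -> continuous (fun x => \sum_(i <- r) f i x).
Proof.
move=> cf; elim: r => [|i r ih].
  by under eq_fun do rewrite big_nil; move=> x; exact: cvg_cst.
by under eq_fun do rewrite big_cons; move=> x; apply: cvgD; [exact: cf|exact: ih].
Qed.

Lemma fourier_series R (f : R -> R) : periodic1 f -> of_class_C 3 f ->
  exists om C, [/\ 0 <= C, forall k, (0 < k)%N -> rho f k <= C / k%:R ^+ 3 &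
    forall n x, (0 < n)%N -> `|f x - mean f - \sum_(1 <= k < n) rho f k * wave k (om k) x| <= C / n%:R].
Proof.
move=> pf c3.
have cf : continuous f.
  by move=> x; case: c3 => d _; apply: differentiable_continuous; apply/derivable1_diffP; exact: (d 0%N).
have bf := periodic_bmeas cf pf.
have bw i u : bmeas (@wave R i u) by exact: bmeas_wave.
have [C C0 hC] := fourier_decay pf c3.
pose om k := projT1 (cid (mean_fourier k bf)).
have omE k w : mean (fun x => f x * wave k w x) = rho f k / 2 * cos (w - om k).
  by rewrite /om; case: cid.
have rhoC k : (0 < k)%N -> rho f k <= 2 * C / k%:R ^+ 3.
  move=> k0; have := hC k (om k) k0; rewrite omE subrr cos0 mulr1 ger0_norm.
    by set u := _ ^+ 3; rewrite (_ : 2 * C / u = C / u * 2) ?ler_pdivrMr//; ring.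
  by rewrite divr_ge0// rho_ge0.
pose s n x := \sum_(1 <= k < n) rho f k * wave k (om k) x.
have tail n m x : (0 < n)%N -> (n <= m)%N -> `|s m x - s n x| <= 4 * C / n%:R.
  move=> n0 nm; rewrite /s (big_cat_nat (n := n) (F := fun k => rho f k * wave k (om k) x))//= addrAC subrr add0r.
  apply: (le_trans (ler_norm_sum _ _ _)).
  apply: (@le_trans _ _ (\sum_(n <= k < m) 2 * C * (k%:R ^+ 2)^-1)).
    apply: ler_sum_nat => k /andP[nk _]; have k0 : (0 < k)%N by exact: leq_trans nk.
    rewrite normrM ger0_norm ?rho_ge0//.
    apply: (@le_trans _ _ (rho f k)); first by rewrite ler_piMr ?rho_ge0// wave_bound.
    apply: (le_trans (rhoC k k0)); rewrite ler_wpM2l ?mulr_ge0// lef_pV2 ?posrE ?exprn_gt0 ?ltr0n//.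
    by rewrite ler_weXn2l// ler1n.
  rewrite -mulr_sumr (_ : 4 * C / n%:R = 2 * C * (2 / n%:R)); last by ring.
  by rewrite ler_wpM2l ?mulr_ge0// sum_inv_sqr.
(* Z is the uniform sum of the series. Being continuous, it can be compared with f through Fourier
   coefficients. *)
pose Z x := sup [set s n x - 4 * C / n%:R | n in [set n | (0 < n)%N]].
have Zs n x : (0 < n)%N -> `|Z x - s n x| <= 4 * C / n%:R.
  exact: (@tail_limit R (s ^~ x) (4 * C) (fun n m => tail n m x)).
have cs n : continuous (s n).
  apply: continuous_sum => k x; apply: cvgM; [exact: cvg_cst|exact: continuous_wave].
have cZ : continuous Z by exact: uniform_limit_cont Zs.
have ps n : periodic1 (s n).
  by move=> x; rewrite /s; apply: eq_bigr => k _; rewrite wave_periodic.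
have pZ : periodic1 Z.
  by move=> x; rewrite /Z; congr (sup _); apply: eq_imagel => n _; rewrite ps.
have bs n : bmeas (s n).
  by apply: bmeas_sum => k; exact: bmeasZ.
have bZ : bmeas Z by exact: periodic_bmeas.
pose g x := f x - mean f - Z x.
have bg : bmeas g by apply: bmeasB => //; apply: bmeasB => //; exact: bmeas_cst.
have og : orth g.
  move=> j w.
  (* For n > j the partial sum s n already carries the whole j-th coefficient of f - mean f, so only
     the uniform tail Z - s n contributes. *)
  have small n : (j < n)%N -> `|mean (fun x => g x * wave j w x)| <= 4 * C / n%:R.
    move=> jn; have n0 : (0 < n)%N by exact: leq_ltn_trans jn.
    have e0 : mean (fun x => (f x - mean f - s n x) * wave j w x) = 0.
      have -> : (fun x => (f x - mean f - s n x) * wave j w x) = (fun x =>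
          (f x * wave j w x - mean f * wave j w x) -
          \sum_(1 <= k < n) rho f k * (wave k (om k) x * wave j w x)).
        apply/funext => x; rewrite !mulrBl mulr_suml; congr (_ - _).
        by apply: eq_bigr => k _; rewrite mulrA.
      rewrite meanB; [|by apply: bmeasB; [exact: bmeasM|exact: bmeasZ]|by apply: bmeas_sum => k; apply: bmeasZ; exact: bmeasM].
      rewrite meanB; [|exact: bmeasM|exact: bmeasZ].
      rewrite mean_sum; last by move=> k; apply: bmeasZ; exact: bmeasM.
      have -> : \sum_(1 <= k < n) mean (fun x => rho f k * (wave k (om k) x * wave j w x)) =
          \sum_(1 <= k < n) (if k == j then rho f k / 2 * cos (w - om k) else 0).
        apply: eq_big_nat => k /andP[k0 _].
        rewrite meanZ ?mean_waveM//; last exact: bmeasM.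
        by rewrite (eq_sym j k); case: ifP => _; ring.
      rewrite meanZ//.
      case: (posnP j) => [j0|j0].
        rewrite j0 big1_seq ?subr0; last first.
          by move=> k; rewrite mem_index_iota => /andP[_ /andP[k0 _]]; rewrite gtn_eqF.
        have w0 : wave 0 w = fun=> cos w by apply/funext => x; rewrite wave0.
        rewrite w0 mean_cst; under eq_fun do rewrite mulrC.
        by rewrite meanZ// mulrC subrr.
      rewrite mean_wave// mulr0 subr0 omE (bigD1_seq j)/= ?iota_uniq ?mem_index_iota ?j0//.
      by rewrite eqxx big1 ?addr0 ?subrr// => k /negbTE ->.
    rewrite -[mean _]subr0 -e0 -meanB; last 2 first.
    - exact: bmeasM.
    - by apply: bmeasM => //; apply: bmeasB => //; apply: bmeasB => //; exact: bmeas_cst.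
    apply: norm_mean_le.
      apply: bmeasB; first exact: bmeasM.
      by apply: bmeasM => //; apply: bmeasB => //; apply: bmeasB => //; exact: bmeas_cst.
    move=> x; rewrite -mulrBl normrM -[leRHS]mulr1 ler_pM ?wave_bound//.
    rewrite /g (_ : _ - _ = - (Z x - s n x)); last by ring.
    by rewrite normrN Zs.
  by apply: (@small_div_eq0 _ _ (4 * C) j) => n /small.
have g0 := orth_continuous_eq0 _ _ og.
exists om, (4 * C); split; first by rewrite mulr_ge0.
  move=> k k0; apply: (le_trans (rhoC k k0)); rewrite ler_wpM2r ?invr_ge0 ?exprn_ge0//; lra.
move=> n x n0; rewrite -/(s n x) -[X in `|X - _|](subrK (Z x)).
rewrite -/(g x) g0 ?add0r ?Zs//.
  by move=> y; apply: cvgB; [apply: cvgB; [exact: cf|exact: cvg_cst]|exact: cZ].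
by move=> y; rewrite /g pf pZ.
Qed.

(** * Growth of Birkhoff sums along lacunary denominators *)

Lemma cos_lipschitz R (x y : R) : `|cos x - cos y| <= `|x - y|.
Proof.
pose a := (x + y) / 2; pose b := (x - y) / 2.
have -> : cos x - cos y = - (2 * (sin a * sin b)).
  rewrite (_ : x = a + b); last by rewrite /a /b; field.
  rewrite (_ : y = a - b); last by rewrite /a /b; field.
  by clearbody a b; rewrite cosB cosD; ring.
rewrite normrN normrM normrM ger0_norm//.
have -> : `|x - y| = 2 * `|b| by rewrite /b normrM (ger0_norm (_ : 0 <= 2^-1))//; field.
rewrite ler_pM2l// (le_trans _ (abs_sin_le b))//.
by rewrite ler_piMl// sin_max.
Qed.

(** Let V and G be the second and fourth moments of s. The mean of cos s is at most 1 - V / 2 + G /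
    24. As s has mean 0, that of sin s is the mean of sin s - s, at most (V + G) / 12 through |s|^3
    <= (s^2 + s^4) / 2. Adding up gives 5/12 and 1/8. The condition V <= 1 keeps the mean of cos s
    nonnegative, so that cos tau <= 1 can be used. *)
Lemma mean_cos_le R (s : R -> R) (tau v F : R) : bmeas s -> mean s = 0 ->
  v <= mean (fun x => s x ^+ 2) -> mean (fun x => s x ^+ 2) <= 1 ->
  mean (fun x => s x ^+ 4) <= F ->
  mean (fun x => cos (tau + s x)) <= 1 - 5 / 12 * v + F / 8.
Proof.
move=> bs s0; set V := mean (fun x => s x ^+ 2) => vV V1; set G := mean (fun x => s x ^+ 4) => GF.
have [ms _] := bs.
have bc : bmeas (fun x => cos (s x)) by apply: (@bmeas_comp R _ _ 1) => //; [exact: continuous_cos|exact: cos_max].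
have bsn : bmeas (fun x => sin (s x)) by apply: (@bmeas_comp R _ _ 1) => //; [exact: continuous_sin|exact: sin_max].
have b2 := bmeasX 2 bs; have b4 := bmeasX 4 bs.
have A1 : 1 - V / 2 <= mean (fun x => cos (s x)).
  have -> : 1 - V / 2 = mean (fun x => 1 - 2^-1 * s x ^+ 2).
    by rewrite meanB ?mean_cst ?meanZ//; [rewrite mulrC|exact: bmeas_cst|exact: bmeasZ].
  apply: le_mean => //; first by apply: bmeasB; [exact: bmeas_cst|exact: bmeasZ].
  by move=> x; have := cos_ge_sqr (s x); lra.
have A2 : mean (fun x => cos (s x)) <= 1 - V / 2 + G / 24.
  have -> : 1 - V / 2 + G / 24 = mean (fun x => (1 - 2^-1 * s x ^+ 2) + 24^-1 * s x ^+ 4).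
    rewrite meanD ?meanB ?mean_cst ?meanZ//; [by rewrite mulrC [G / _]mulrC|exact: bmeas_cst|exact: bmeasZ| |exact: bmeasZ].
    by apply: bmeasB; [exact: bmeas_cst|exact: bmeasZ].
  apply: le_mean => //.
    by apply: bmeasD; [apply: bmeasB; [exact: bmeas_cst|exact: bmeasZ]|exact: bmeasZ].
  by move=> x; have := cos_le_quartic (s x); lra.
have B1 : `|mean (fun x => sin (s x))| <= (V + G) / 12.
  have -> : mean (fun x => sin (s x)) = mean (fun x => sin (s x) - s x).
    by rewrite meanB// s0 subr0.
  apply: (le_trans (le_norm_mean (bmeasB bsn bs))).
  have -> : (V + G) / 12 = mean (fun x => 12^-1 * s x ^+ 2 + 12^-1 * s x ^+ 4).
    by rewrite meanD ?meanZ//; [rewrite -/V -/G; field|exact: bmeasZ|exact: bmeasZ].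
  apply: le_mean; [exact/bmeas_norm/bmeasB|by apply: bmeasD; exact: bmeasZ|move=> x].
  apply: (le_trans (sin_sub_le_cube (s x))).
  have e2 : s x ^+ 2 = `|s x| ^+ 2 by rewrite -normrX ger0_norm ?sqr_ge0.
  have e4 : s x ^+ 4 = `|s x| ^+ 4 by rewrite -normrX ger0_norm// -[4%N]/(2 * 2)%N exprM sqr_ge0.
  rewrite e2 e4; set u := `|s x|.
  have : 0 <= (u * (u - 1)) ^+ 2 by exact: sqr_ge0.
  by rewrite (_ : _ ^+ 2 = u ^+ 4 - 2 * u ^+ 3 + u ^+ 2); [lra|ring].
have -> : (fun x => cos (tau + s x)) = (fun x => cos tau * cos (s x) - sin tau * sin (s x)).
  by apply/funext => x; rewrite cosD.
rewrite meanB ?meanZ//; [|exact: bmeasZ|exact: bmeasZ].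
set A := mean _ in A1 A2 *; set B := mean _ in B1 *.
have A0 : 0 <= A by lra.
have c1 : cos tau * A <= A by rewrite ler_piMl// cos_le1.
have c2 : - (sin tau * B) <= `|B|.
  rewrite (le_trans (ler_norm _))// normrN normrM ler_piMl// sin_max//.
lra.
Qed.

(** Absence of frequencies above D, recorded by vanishing correlations only. Products with waves of
    frequency at most D' raise the bound to D + D', which handles powers of a sum of waves without
    expanding them. *)
Definition lowfreq R (D : nat) (f : R -> R) : Prop :=
  bmeas f /\ forall j w, (D < j)%N -> mean (fun x => f x * wave j w x) = 0.

Lemma lowfreq_sum R D D' (f : R -> R) (r : seq nat) (P : pred nat) (b om : nat -> R) :
  lowfreq D f -> (forall k, P k -> (k <= D')%N) ->
  lowfreq (D + D') (fun x => f x * \sum_(k <- r | P k) b k * wave k (om k) x).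
Proof.
move=> [bf lf] PD; have bw i u : bmeas (@wave R i u) by exact: bmeas_wave.
split; first by apply: bmeasM => //; apply: bmeas_sum => k; exact: bmeasZ.
move=> j w Dj.
have -> : (fun x => f x * (\sum_(k <- r | P k) b k * wave k (om k) x) * wave j w x) =
   (fun x => \sum_(k <- r | P k) b k * (f x * (wave j w x * wave k (om k) x))).
  apply/funext => x; rewrite mulr_sumr mulr_suml; apply: eq_bigr => k _; ring.
rewrite mean_sum; last by move=> k; apply: bmeasZ; apply: bmeasM => //; exact: bmeasM.
rewrite big1// => k /PD kD.
rewrite meanZ; last by apply: bmeasM => //; exact: bmeasM.
have kj : (k <= j)%N by rewrite ltnW// (leq_ltn_trans _ Dj)// (leq_trans kD)// leq_addl.
have -> : (fun x => f x * (wave j w x * wave k (om k) x)) = (fun x =>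
   2^-1 * (f x * wave (j - k) (w - om k) x) + 2^-1 * (f x * wave (j + k) (w + om k) x)).
  by apply/funext => x; rewrite waveM//; field.
rewrite meanD ?meanZ ?lf ?mulr0 ?addr0 ?mulr0//.
- by rewrite (leq_trans _ (leq_addr _ _))// (leq_ltn_trans (leq_addr D' D)).
- by rewrite ltn_subRL addnC (leq_ltn_trans _ Dj)// leq_add2l.
- exact: bmeasM.
- exact: bmeasM.
- by apply: bmeasZ; exact: bmeasM.
- by apply: bmeasZ; exact: bmeasM.
Qed.

Lemma lowfreq_cst1 R : @lowfreq R 0 (fun=> 1).
Proof.
split; first exact: bmeas_cst.
by move=> j w j0; under eq_fun do rewrite mul1r; exact: mean_wave.
Qed.

Lemma lowfreq_orth R D (f : R -> R) (r : seq nat) (P : pred nat) (b om : nat -> R) :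
  lowfreq D f -> (forall k, P k -> (D < k)%N) ->
  mean (fun x => f x * \sum_(k <- r | P k) b k * wave k (om k) x) = 0.
Proof.
move=> [bf lf] PD; have bw i u : bmeas (@wave R i u) by exact: bmeas_wave.
have -> : (fun x => f x * (\sum_(k <- r | P k) b k * wave k (om k) x)) =
   (fun x => \sum_(k <- r | P k) b k * (f x * wave k (om k) x)).
  by apply/funext => x; rewrite mulr_sumr; apply: eq_bigr => k _; ring.
rewrite mean_sum; last by move=> k; apply: bmeasZ; exact: bmeasM.
by rewrite big1// => k /PD Dk; rewrite meanZ ?lf ?mulr0//; exact: bmeasM.
Qed.

Lemma waves_bound R (r : seq nat) (P : pred nat) (b om : nat -> R) x :
  `|\sum_(k <- r | P k) b k * wave k (om k) x| <= \sum_(k <- r | P k) `|b k|.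
Proof.
rewrite (le_trans (ler_norm_sum _ _ _))// ler_sum// => k _.
by rewrite normrM ler_piMr// wave_bound.
Qed.

Lemma sum_split1 R (r : seq nat) (P : pred nat) (F : nat -> R) q :
  uniq r -> q \in r -> P q ->
  \sum_(k <- r | P k) F k = F q + \sum_(k <- r | P k && (k != q)) F k.
Proof.
move=> ur qr Pq; rewrite big_mkcond (bigD1_seq q)//= Pq; congr (_ + _).
by rewrite -big_mkcondr; apply: eq_bigl => k; rewrite andbC.
Qed.

Lemma mean_sqr_waves_ge R (r : seq nat) (P : pred nat) (b om : nat -> R) q :
  uniq r -> q \in r -> P q -> (0 < q)%N ->
  b q ^+ 2 / 2 <= mean (fun x => (\sum_(k <- r | P k) b k * wave k (om k) x) ^+ 2).
Proof.
move=> ur qr Pq q0; have bw i u : bmeas (@wave R i u) by exact: bmeas_wave.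
pose S x := \sum_(k <- r | P k && (k != q)) b k * wave k (om k) x.
have bS : bmeas S by apply: bmeas_sum => k; exact: bmeasZ.
have -> : (fun x => (\sum_(k <- r | P k) b k * wave k (om k) x) ^+ 2) =
   (fun x => b q ^+ 2 * (wave q (om q) x * wave q (om q) x) +
     (2 * b q * (wave q (om q) x * S x) + S x ^+ 2)).
  by apply/funext => x; rewrite (sum_split1 _ ur qr Pq) -/(S x); ring.
have S0 : mean (fun x => wave q (om q) x * S x) = 0.
  have -> : (fun x => wave q (om q) x * S x) =
    (fun x => \sum_(k <- r | P k && (k != q)) b k * (wave q (om q) x * wave k (om k) x)).
    by apply/funext => x; rewrite /S mulr_sumr; apply: eq_bigr => k _; ring.
  rewrite mean_sum; last by move=> k; apply: bmeasZ; exact: bmeasM.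
  rewrite big1// => k /andP[_ /negbTE kq].
  by rewrite meanZ ?mean_waveM// ?kq ?mulr0//; exact: bmeasM.
rewrite meanD; [|by apply: bmeasZ; exact: bmeasM|by apply: bmeasD; [apply: bmeasZ; exact: bmeasM|exact: bmeasX]].
rewrite meanD; [|by apply: bmeasZ; exact: bmeasM|exact: bmeasX].
rewrite !meanZ; [|exact: bmeasM|exact: bmeasM].
rewrite S0 mean_waveM// eqxx subrr cos0 mulr0 add0r mul1r lerDl.
by apply: mean_ge0 => x; exact: sqr_ge0.
Qed.

(** The Dirichlet kernel, multiplied by its denominator so that the identity also holds where the
    sine vanishes. *)
Lemma birkhoff_wave R (al : R) k (w x : R) t :
  sin (pi * (k%:R * al)) * \sum_(0 <= j < t) wave k w (x + j%:R * al) =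
  sin (t%:R * (pi * (k%:R * al))) * wave k (w + (t%:R - 1) * (pi * (k%:R * al))) x.
Proof.
set be := pi * (k%:R * al).
elim: t => [|t ih]; first by rewrite big_nil mulr0 mul0r sin0 mul0r.
rewrite big_nat_recr//= mulrDr ih -natr1 addrK /wave (_ : (t%:R + 1) * be = t%:R * be + be); last by ring.
pose y := 2 * pi * k%:R * x + w + t%:R * be; pose a := t%:R * be.
have -> : 2 * pi * k%:R * x + (w + (t%:R - 1) * be) = y - be by rewrite /y; ring.
have -> : 2 * pi * k%:R * (x + t%:R * al) + w = y + a by rewrite /y /a /be; ring.
have -> : 2 * pi * k%:R * x + (w + t%:R * be) = y by rewrite /y; ring.
rewrite -/a; clearbody y a be; rewrite cosB cosD sinD; ring.
Qed.

(* Amplitude and phase of the k-th wave in the Birkhoff sum at time t. *)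
Definition amp R (r : nat -> R) (al : R) (t k : nat) : R :=
  r k * (sin (t%:R * (pi * (k%:R * al))) / sin (pi * (k%:R * al))).

Definition phase R (om : nat -> R) (al : R) (t k : nat) : R :=
  om k + (t%:R - 1) * (pi * (k%:R * al)).

Lemma abs_sin_ge_dist R (x : R) : dist_int x / 2 <= `|sin (pi * x)|.
Proof.
have := @abs_sin_pi_ge R (x - (near_int x)%:~R) (dist_int_le2 x).
by rewrite -[X in sin (pi * (x + X))]mulrNz abs_sinD_int.
Qed.

Lemma sin_int_neq0 R (al : R) k : irrational al -> (0 < k)%N -> sin (pi * (k%:R * al)) != 0.
Proof.
move=> ial k0; rewrite -normr_gt0 (lt_le_trans _ (abs_sin_ge_dist _))//.
by rewrite divr_gt0// dist_int_gt0.
Qed.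

Lemma birkhoff_fourier R (f : R -> R) (r om : nat -> R) (c C al : R) : irrational al ->
  (forall n x, (0 < n)%N -> `|f x - c - \sum_(1 <= k < n) r k * wave k (om k) x| <= C / n%:R) ->
  forall n t x, (0 < n)%N ->
  `|birkhoff_sum al f (Posz t) x - t%:R * c -
    \sum_(1 <= k < n) amp r al t k * wave k (phase om al t k) x| <= t%:R * C / n%:R.
Proof.
move=> ial hf n t x n0 /=.
have -> : \sum_(1 <= k < n) amp r al t k * wave k (phase om al t k) x =
    \sum_(0 <= j < t) \sum_(1 <= k < n) r k * wave k (om k) (x + j%:R * al).
  rewrite exchange_big/=; apply: eq_big_nat => k /andP[k0 _].
  rewrite -mulr_sumr /amp /phase -mulrA; congr (_ * _).
  have s0 := sin_int_neq0 ial k0.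
  by apply: (mulfI s0); rewrite birkhoff_wave; field.
have -> : t%:R * c = \sum_(0 <= j < t) c by rewrite sumr_const_nat subn0 mulr_natl.
rewrite -!sumrB (le_trans (ler_norm_sum _ _ _))//.
have -> : t%:R * C / n%:R = \sum_(0 <= j < t) C / n%:R by rewrite sumr_const_nat subn0 -mulrA mulr_natl.
by apply: ler_sum => j _; exact: hf.
Qed.

(** For fixed t the truncation index n is free, so the truncation error t C / n can be made smaller
    than any excess over e. W selects the waves that are kept. *)
Lemma birkhoff_error R (f : R -> R) (r om : nat -> R) (c C al e : R) (W : pred nat) X t :
  irrational al ->
  (forall n x, (0 < n)%N -> `|f x - c - \sum_(1 <= k < n) r k * wave k (om k) x| <= C / n%:R) ->
  (forall k, W k -> (k < X)%N) ->
  (forall n, \sum_(1 <= k < n | ~~ W k) `|amp r al t k| <= e) ->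
  forall x, `|birkhoff_sum al f (Posz t) x - t%:R * c -
    \sum_(1 <= k < X | W k) amp r al t k * wave k (phase om al t k) x| <= e.
Proof.
move=> ial hf WX he x.
rewrite leNgt; apply/negP; rewrite -subr_gt0 => h.
have [n Xn] := exists_div_lt (t%:R * C) X h; rewrite ltNge => /negP; apply.
rewrite lerBlDr.
have n0 : (0 < n)%N by exact: leq_ltn_trans Xn.
have h1 := birkhoff_fourier ial hf t x n0.
set A := birkhoff_sum _ _ _ _ - _ in h1 *; set S := \sum_(1 <= k < X | _) _.
have SE : \sum_(1 <= k < n) amp r al t k * wave k (phase om al t k) x = S +
    \sum_(1 <= k < n | ~~ W k) amp r al t k * wave k (phase om al t k) x.
  rewrite (bigID W)/=; congr (_ + _); rewrite /S.
  rewrite (big_cat_nat (n := maxn 1 X))/= ?leq_max//; last by rewrite geq_max n0 ltnW.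
  rewrite [X in _ + X]big_nat_cond [X in _ + X]big1 ?addr0; last first.
    move=> k /andP[/andP[Xk _] /WX]; rewrite ltnNge; move: Xk; rewrite geq_max => /andP[_ ->//].
  case: (posnP X) => [X0|X0].
    by rewrite X0 maxn0 !big_geq.
  by rewrite (maxn_idPr X0).
move: h1; rewrite SE => h1.
rewrite (_ : A - S = (A - (S + \sum_(1 <= k < n | ~~ W k) amp r al t k * wave k (phase om al t k) x)) +
  \sum_(1 <= k < n | ~~ W k) amp r al t k * wave k (phase om al t k) x); last by ring.
apply: (le_trans (ler_normD _ _)); rewrite lerD//.
by apply: le_trans (he n); exact: waves_bound.
Qed.

Lemma amp_le_time R (r : nat -> R) (al : R) t k : irrational al -> (0 < k)%N -> 0 <= r k ->
  `|amp r al t k| <= r k * t%:R.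
Proof.
move=> ial k0 r0; rewrite /amp normrM (ger0_norm r0) ler_wpM2l// normf_div.
by rewrite ler_pdivrMr ?normr_gt0 ?sin_int_neq0// abs_sinM_nat.
Qed.

Lemma abs_sin_theta R (al : R) (t k : nat) (j : int) :
  `|sin (t%:R * (pi * (k%:R * al)))| = `|sin (pi * (k%:R * (t%:R * al - j%:~R)))|.
Proof.
rewrite -(abs_sinD_int (k%:R * (t%:R * al - j%:~R)) (k%:Z * j)) intrM -pmulrn.
by congr (`|sin _|); ring.
Qed.

Lemma amp_le_theta R (r : nat -> R) (al : R) t k (j : int) : irrational al -> (0 < k)%N -> 0 <= r k ->
  `|amp r al t k| <= r k * (4 * k%:R * `|t%:R * al - j%:~R| / `|sin (pi * (k%:R * al))|).
Proof.
move=> ial k0 r0; rewrite /amp normrM (ger0_norm r0) ler_wpM2l// normf_div.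
rewrite ler_pM2r ?invr_gt0 ?normr_gt0 ?sin_int_neq0// (abs_sin_theta al t k j).
by rewrite (le_trans (abs_sin_pi_le _))// normrM normr_nat mulrA.
Qed.

(** Three mechanisms bound the amplitude by 32 k r_k. If k is not resonant, |sin(pi k alpha)| >= 1 /
    (32 k). If [den] k >= q', the time is short: t < q' <= k. If q = [den] k < M, the distance th of
    t alpha to j is small enough to compensate the denominator: th <= 3 / M <= 16/5 ||q alpha|| by
    the gap between q and M. *)
Lemma amp_outside_window R (r : nat -> R) (C al : R) (t k M q' : nat) (j : int) : irrational al ->
  (0 < k)%N -> 0 <= r k -> r k <= C / k%:R ^+ 3 ->
  prim al M -> `|t%:R * al - j%:~R| <= 3 / M%:R ->
  (t < q')%N -> ((den al k < M)%N \/ (q' <= den al k)%N) ->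
  `|amp r al t k| <= 32 * C / k%:R ^+ 2.
Proof.
move=> ial k0 r0 rC pM thM tq' hk.
have kR : 0 < k%:R :> R by rewrite ltr0n.
have sk0 : 0 < `|sin (pi * (k%:R * al))| by rewrite normr_gt0 sin_int_neq0.
have dk := abs_sin_ge_dist (k%:R * al).
have C0 : 0 <= C by rewrite -(pmulr_lge0 C (_ : 0 < (k%:R ^+ 3)^-1)) ?invr_gt0 ?exprn_gt0// (le_trans r0).
suff : `|amp r al t k| <= r k * (32 * k%:R).
  move=> /le_trans; apply; apply: (@le_trans _ _ (C / k%:R ^+ 3 * (32 * k%:R))).
    by rewrite ler_wpM2r// mulr_ge0.
  by rewrite le_eqVlt; apply/orP; left; apply/eqP; field; rewrite gt_eqF.
have lt_case u : `|amp r al t k| <= r k * u -> u <= 32 * k%:R -> `|amp r al t k| <= r k * (32 * k%:R).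
  by move=> /le_trans h1 h2; apply: h1; rewrite ler_wpM2l.
case: (posnP (den al k)) => [d0|d0].
  apply: (lt_case (`|sin (pi * (k%:R * al))|^-1)).
    rewrite /amp normrM (ger0_norm r0) ler_wpM2l// normf_div ler_piMl ?invr_ge0//.
    exact: sin_max.
  have : ~~ resonant al k.
    apply/negP => rk; move: d0; rewrite /den rk => /eqP; rewrite eqn0Ngt => /negP; apply.
    by rewrite divn_gt0 ?gcdn_gt0 ?k0// dvdn_leq ?dvdn_gcdl.
  rewrite /resonant k0/= -leNgt => h.
  rewrite -[32 * _]invrK lef_pV2 ?posrE ?invr_gt0 ?mulr_gt0//.
  by rewrite (le_trans _ dk)// -[_^-1]div1r ler_pdivrMr ?mulr_gt0//; nra.
have [pq [l [l0 kE dE]]] := den_spec d0.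
case: hk => hk; last first.
  apply: (lt_case t%:R); first exact: amp_le_time.
  apply: (@le_trans _ _ k%:R); last by lra.
  rewrite ler_nat (leq_trans (ltnW tq'))// (leq_trans hk)//.
  by rewrite [leqRHS]kE leq_pmull.
apply: (lt_case _ (amp_le_theta t j ial k0 r0)).
have gap := prim_gap pq pM hk.
have MR : 0 < M%:R :> R by rewrite ltr0n; case/andP: pM.
have lR : 0 < l%:R :> R by rewrite ltr0n.
have qR : 1 <= (den al k)%:R :> R by rewrite ler1n.
rewrite ler_pdivrMr//; set th := `|_ - _| in thM *.
set q := (den al k)%:R in gap dE qR *; set e := dist_int (q * al) in gap dE *.
have th0 : 0 <= th by exact: normr_ge0.
have kq : k%:R = l%:R * q by rewrite [in LHS]kE natrM.
have e0 : 0 <= e by exact: normr_ge0.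
have th_e : th <= 16 / 5 * e.
  apply: (le_trans thM); rewrite ler_pdivrMr//; lra.
apply: (@le_trans _ _ (32 * k%:R * (l%:R * e / 2))); last first.
  by rewrite ler_wpM2l ?mulr_ge0// -dE.
rewrite (_ : 32 * k%:R * (l%:R * e / 2) = 4 * k%:R * (4 * (l%:R * e))); last by field.
have : e <= l%:R * e by rewrite ler_peMl// ler1n.
by move=> el; rewrite ler_wpM2l ?mulr_ge0//; lra.
Qed.

(** Beyond K the amplitudes sum to at most 64 C / K whatever t is, and the finitely many waves below
    K are bounded by a constant G times the distance of t alpha to j. The threshold d is fixed
    before M and t, so the window can be chosen afterwards. *)
Lemma error_small R (r : nat -> R) (C al e : R) : irrational al -> 0 < e ->
  (forall k, 0 <= r k) -> (forall k, (0 < k)%N -> r k <= C / k%:R ^+ 3) ->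
  exists2 d, 0 < d & forall (t M q' : nat) (j : int) n (W : pred nat),
    prim al M -> `|t%:R * al - j%:~R| <= 3 / M%:R -> `|t%:R * al - j%:~R| <= d -> (t < q')%N ->
    (forall k, ~~ W k -> (den al k < M)%N \/ (q' <= den al k)%N) ->
    \sum_(1 <= k < n | ~~ W k) `|amp r al t k| <= e.
Proof.
move=> ial e0 r0 rC.
have C0 : 0 <= C by have := le_trans (r0 1%N) (rC 1%N isT); rewrite expr1n divr1.
have e2 : 0 < e / 2 by rewrite divr_gt0.
have [K K0 hK] := exists_div_lt (64 * C) 0 e2.
pose G := \sum_(1 <= k < K) r k * (4 * k%:R / `|sin (pi * (k%:R * al))|).
have G0 : 0 <= G by apply: sumr_ge0 => k _; rewrite mulr_ge0 ?divr_ge0 ?mulr_ge0.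
exists (e / 2 / (G + 1)); first by rewrite divr_gt0// ltr_wpDl.
move=> t M q' j n W pM thM thd tq' hW.
have abs0 k : 0 <= `|amp r al t k| by [].
apply: (@le_trans _ _ (\sum_(1 <= k < maxn K n | ~~ W k) `|amp r al t k|)).
  case: (leqP n 1) => [n1|n1]; first by rewrite big_geq// sumr_ge0.
  rewrite [leRHS](big_cat_nat (n := n))/= ?leq_maxr//; last exact: ltnW.
  by rewrite lerDl sumr_ge0.
rewrite (big_cat_nat (n := K))/= ?leq_maxl//.
have -> : e = e / 2 + e / 2 by field.
apply: lerD.
  apply: (@le_trans _ _ (\sum_(1 <= k < K | ~~ W k) (r k * (4 * k%:R / `|sin (pi * (k%:R * al))|)) * `|t%:R * al - j%:~R|)).
    rewrite big_nat_cond [leRHS]big_nat_cond; apply: ler_sum => k /andP[/andP[k0 _] _].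
    apply: (le_trans (amp_le_theta t j ial k0 (r0 k))).
    by rewrite le_eqVlt; apply/orP; left; apply/eqP; ring.
  rewrite -mulr_suml.
  apply: (@le_trans _ _ (G * `|t%:R * al - j%:~R|)).
    rewrite ler_wpM2r// /G big_mkcond; apply: ler_sum => k _.
    by case: ifP => // _; rewrite mulr_ge0 ?divr_ge0 ?mulr_ge0.
  apply: (@le_trans _ _ (G * (e / 2 / (G + 1)))); first by rewrite ler_wpM2l.
  by rewrite mulrA ler_pdivrMr ?ltr_wpDl//; nra.
apply: (@le_trans _ _ (\sum_(K <= k < maxn K n) 32 * C * (k%:R ^+ 2)^-1)).
  rewrite big_mkcond big_nat_cond [leRHS]big_nat_cond; apply: ler_sum => k /andP[/andP[Kk _] _].
  have k0 : (0 < k)%N by exact: leq_trans Kk.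
  case: ifP => [nW|_]; last by rewrite mulr_ge0 ?mulr_ge0 ?invr_ge0 ?exprn_ge0.
  exact: amp_outside_window ial k0 (r0 k) (rC k k0) pM thM tq' (hW k nW).
rewrite -mulr_sumr; apply: (@le_trans _ _ (32 * C * (2 / K%:R))).
  by rewrite ler_wpM2l ?mulr_ge0// sum_inv_sqr.
by rewrite (_ : _ * _ = 64 * C / K%:R); [exact: ltW|ring].
Qed.

(** * Blocks of multiples of a primitive denominator *)

Lemma sum_multiples R (r : nat -> R) (P : pred nat) q X : (0 < q)%N -> (forall k, 0 <= r k) ->
  (forall k, P k -> exists2 l, (2 <= l)%N & k = (l * q)%N) ->
  \sum_(1 <= k < X | P k) r k <= \sum_(2 <= l < X) r (l * q)%N.
Proof.
move=> q0 r0 hP.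
have ge_one (a : nat -> R) m n j : (forall i, 0 <= a i) -> (m <= j < n)%N -> a j <= \sum_(m <= i < n) a i.
  move=> a0 jmn; rewrite (bigD1_seq j)/= ?mem_index_iota ?iota_uniq// lerDl sumr_ge0//.
apply: (@le_trans _ _ (\sum_(1 <= k < X) \sum_(2 <= l < X) (if k == (l * q)%N then r k else 0))).
  rewrite big_mkcond big_nat_cond [leRHS]big_nat_cond; apply: ler_sum => k /andP[/andP[k0 kX] _].
  case: ifPn => [/hP[l l2 kE]|_]; last by apply: sumr_ge0 => l _; case: ifP.
  have := ge_one (fun l => if k == (l * q)%N then r k else 0) 2 X l.
  rewrite -kE eqxx; apply; first by move=> i; case: ifP.
  by rewrite l2 (leq_ltn_trans _ kX)// kE leq_pmulr.
rewrite exchange_big/=; apply: ler_sum => l _.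
rewrite -big_mkcond/=.
case: (boolP (l * q \in index_iota 1 X)%N) => lX.
  rewrite (sum_split1 _ (iota_uniq _ _) lX)// big1 ?addr0// => k /andP[/eqP ->].
  by rewrite eqxx.
by rewrite big1_seq// => k /andP[/eqP -> ]; rewrite (negbTE lX).
Qed.

Lemma abs_sin_le_dist R (x : R) : `|sin (pi * x)| <= 4 * dist_int x.
Proof.
rewrite -(abs_sinD_int x (- near_int x)) mulrNz.
exact: abs_sin_pi_le.
Qed.

(** Common frame of the block estimates for amplitudes and for the quotients r_k / |sin(pi k
    alpha)|: the block consists of q and of proper multiples k = l q with ||k alpha|| = l ||q
    alpha||, whose r_k sum to at most r_q / 4. *)
Lemma block_sum_le R (r a : nat -> R) (al c : R) (q X : nat) :
  prim al q -> (forall k, 0 <= r k) -> (forall k, 0 <= a k) -> 0 <= c ->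
  (forall n, \sum_(2 <= l < n) r (l * q)%N <= r q / 4) ->
  (forall k l, (2 <= l)%N -> k = (l * q)%N ->
    dist_int (k%:R * al) = l%:R * dist_int (q%:R * al) -> a k <= r k * c) ->
  \sum_(1 <= k < X | den al k == q) a k <= a q + r q / 4 * c.
Proof.
move=> pq r0 a0 c0 hr ha; have /andP[q0 dq] := pq.
have mult k : den al k == q -> k != q -> exists2 l, (2 <= l)%N &
    k = (l * q)%N /\ dist_int (k%:R * al) = l%:R * dist_int (q%:R * al).
  move=> /eqP dk kq; have d0 : (0 < den al k)%N by rewrite dk.
  have [_ [l [l0 kE dE]]] := den_spec d0; rewrite dk in kE dE; exists l => //.
  rewrite ltn_neqAle l0 andbT eq_sym; apply/negP => /eqP l1.
  by rewrite l1 mul1n in kE; rewrite kE eqxx in kq.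
have h1 : \sum_(1 <= k < X | (den al k == q) && (k != q)) a k <= r q / 4 * c.
  apply: (@le_trans _ _ (\sum_(1 <= k < X | (den al k == q) && (k != q)) r k * c)).
    by apply: ler_sum => k /andP[dk kq]; have [l l2 [kE dE]] := mult k dk kq; exact: ha l2 kE dE.
  rewrite -mulr_suml ler_wpM2r//; apply: le_trans (hr X); apply: sum_multiples => // k /andP[dk kq].
  by have [l l2 [kE _]] := mult k dk kq; exists l.
case: (boolP (q \in index_iota 1 X)) => qin.
  by rewrite (sum_split1 (P := fun k => den al k == q) _ (iota_uniq _ _) qin dq) lerD2l.
apply: ler_wpDl => //; apply: le_trans h1.
rewrite big_seq_cond [leRHS]big_seq_cond le_eqVlt; apply/orP; left; apply/eqP.
apply: eq_bigl => k; case: (boolP (k \in _)) => //= kin.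
by rewrite (_ : k != q) ?andbT//; apply: contraNneq qin => <-.
Qed.

(** For k = l q the factor l cancels between |sin(t pi k alpha)| <= l S and |sin(pi k alpha)| >= l
    ||q alpha|| / 2. The proper multiples thus add at most r_q S / (2 ||q alpha||), which is at most
    twice the amplitude at q because |sin(pi q alpha)| <= 4 ||q alpha||. *)
Lemma block_bound R (r : nat -> R) (al : R) (t q X : nat) : irrational al ->
  (forall k, 0 <= r k) -> prim al q ->
  (forall n, \sum_(2 <= l < n) r (l * q)%N <= r q / 4) ->
  \sum_(1 <= k < X | den al k == q) `|amp r al t k| <= 3 * `|amp r al t q|.
Proof.
move=> ial r0 pq hr.
have q0 : (0 < q)%N by case/andP: pq.
have e0 := dist_int_gt0 ial q0; have sq := abs_sin_le_dist (q%:R * al); set e := dist_int _ in e0 sq.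
have sq0 : 0 < `|sin (pi * (q%:R * al))| by rewrite normr_gt0 sin_int_neq0.
pose S := `|sin (t%:R * (pi * (q%:R * al)))|.
have S0 : 0 <= S by exact: normr_ge0.
have ampq : r q * (S / (4 * e)) <= `|amp r al t q|.
  rewrite /amp normrM (ger0_norm (r0 q)) ler_wpM2l// normf_div -/S ler_wpM2l//.
  by rewrite lef_pV2 ?posrE// mulr_gt0.
apply: le_trans (@block_sum_le R r (fun k => `|amp r al t k|) al (2 * S / e) q X _ _ _ _ _ _) _ => //.
- by rewrite divr_ge0 ?mulr_ge0// ltW.
- move=> k l l2 kE dE.
  rewrite /amp normrM (ger0_norm (r0 k)) ler_wpM2l// normf_div.
  have k0 : (0 < k)%N by rewrite kE muln_gt0 q0 (leq_trans _ l2).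
  have sk0 : 0 < `|sin (pi * (k%:R * al))| by rewrite normr_gt0 sin_int_neq0.
  have sk : l%:R * e / 2 <= `|sin (pi * (k%:R * al))| by rewrite /e -dE abs_sin_ge_dist.
  have St : `|sin (t%:R * (pi * (k%:R * al)))| <= l%:R * S.
    by rewrite kE natrM (_ : _ * _ = l%:R * (t%:R * (pi * (q%:R * al)))) ?abs_sinM_nat//; ring.
  rewrite ler_pdivrMr//; apply: (le_trans St).
  apply: (@le_trans _ _ (2 * S / e * (l%:R * e / 2))); last by rewrite ler_wpM2l// divr_ge0// ?mulr_ge0// ltW.
  by rewrite le_eqVlt; apply/orP; left; apply/eqP; field; rewrite gt_eqF.
rewrite (_ : r q / 4 * (2 * S / e) = 2 * (r q * (S / (4 * e)))); last by field; rewrite gt_eqF.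
lra.
Qed.

(* Adding the block of the next primitive N to s: all its frequencies exceed three times
   those of s by lacunarity, so s B and s^3 B have mean 0. *)
Lemma window_moments R (al : R) (b om z : nat -> R) (M X : nat) : (0 < M)%N ->
  (forall q, prim al q -> (M <= q < X)%N ->
     \sum_(1 <= k < X | den al k == q) `|b k| <= z q) ->
  forall n, (M + n <= X)%N ->
  let s := fun x => \sum_(1 <= k < X | (M <= den al k < M + n)%N) b k * wave k (om k) x in
  let V := \sum_(M <= q < M + n | prim al q) z q ^+ 2 in
  [/\ mean s = 0, \sum_(M <= q < M + n | prim al q) b q ^+ 2 / 2 <= mean (fun x => s x ^+ 2),
     mean (fun x => s x ^+ 2) <= V & mean (fun x => s x ^+ 4) <= 4 * V ^+ 2].
Proof.
move=> M0 hB.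
have bw i u : bmeas (@wave R i u) by exact: bmeas_wave.
elim=> [_ /=|n ih MX s' V'].
  have e x : \sum_(1 <= k < X | (M <= den al k < M + 0)%N) b k * wave k (om k) x = 0.
    rewrite big1// => k; rewrite addn0 => /andP[h1 h2].
    by move: (leq_ltn_trans h1 h2); rewrite ltnn.
  have ep p : (fun x => (\sum_(1 <= k < X | (M <= den al k < M + 0)%N) b k * wave k (om k) x) ^+ p.+1) = fun=> 0.
    by apply/funext => x; rewrite e expr0n.
  have g F : \sum_(M <= q < M | prim al q) F q = 0 :> R by rewrite big_geq.
  rewrite (ep 1%N) (ep 3%N) !mean_cst addn0 !g; split; [|by rewrite ?expr0n ?mulr0..].
  by rewrite -[RHS](mean_cst 0); congr mean; apply/funext => x; have := e x; rewrite addn0.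
have MX' : (M + n <= X)%N by rewrite ltnW// -addnS.
pose s x := \sum_(1 <= k < X | (M <= den al k < M + n)%N) b k * wave k (om k) x.
pose V := \sum_(M <= q < M + n | prim al q) z q ^+ 2.
pose L := \sum_(M <= q < M + n | prim al q) b q ^+ 2 / 2.
have [s0 sL sV s4] : [/\ mean s = 0, L <= mean (fun x => s x ^+ 2),
  mean (fun x => s x ^+ 2) <= V & mean (fun x => s x ^+ 4) <= 4 * V ^+ 2] := ih MX'.
have V0 : 0 <= V by apply: sumr_ge0 => q _; exact: sqr_ge0.
pose N := (M + n)%N.
have splitP (F : nat -> R) : \sum_(M <= q < M + n.+1 | prim al q) F q =
    \sum_(M <= q < M + n | prim al q) F q + (if prim al N then F N else 0).
  rewrite big_mkcond addnS big_nat_recr/= ?leq_addr//; congr (_ + _).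
  by rewrite [RHS]big_mkcond.
rewrite /V' !splitP -/V -/L.
pose B x := \sum_(1 <= k < X | den al k == N) b k * wave k (om k) x.
have s'E x : s' x = s x + B x.
  rewrite /s' (bigID (fun k => (den al k < M + n)%N))/=; congr (_ + _).
    apply: eq_bigl => k; rewrite addnS ltnS -andbA; congr (_ && _).
    by case: ltngtP.
  apply: eq_bigl => k; rewrite addnS ltnS -leqNgt -andbA -eqn_leq.
  by apply/idP/idP => [/andP[_]//|/eqP e]; rewrite e eqxx leq_addr.
have bs : bmeas s by apply: bmeas_sum => k; exact: bmeasZ.
have bB : bmeas B by apply: bmeas_sum => k; exact: bmeasZ.
have den0 k : (M <= den al k)%N -> (0 < den al k)%N by exact: leq_trans.
case: (boolP (prim al N)) => pN; last first.
  have s's : s' = s.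
    apply/funext => x; rewrite s'E /B big1 ?addr0// => k /eqP dk.
    have d0 : (0 < den al k)%N by rewrite dk addn_gt0 M0.
    by move: pN; rewrite -dk (den_spec d0).1.
  by rewrite s's !addr0.
have N0 : (0 < N)%N by rewrite addn_gt0 M0.
have NX : (N < X)%N by rewrite /N -addnS.
have hBN := hB N pN; rewrite leq_addr NX in hBN; have {}hBN := hBN isT.
set zN := z N in hBN *.
have Bz x : `|B x| <= zN by apply: le_trans hBN; exact: waves_bound.
have zN0 : 0 <= zN by exact: le_trans (normr_ge0 _) (Bz 0).
have B2 x : B x ^+ 2 <= zN ^+ 2.
  by rewrite -[B x ^+ 2]ger0_norm ?sqr_ge0// normrX lerXn2r ?nnegrE.
(* All frequencies of s are at most D, so those of s^3 stay below N, the lowest frequency of B. *)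
pose D := (N %/ 15)%N.
have D3 : (D + D + D < N)%N.
  have : (D * 15 <= N)%N by exact: leq_trunc_div.
  case: (posnP D) => [->//|D0]; apply: leq_trans.
  by rewrite -{1 2 3}[D]muln1 -!mulnDr ltn_mul2l D0.
have PD k : (M <= den al k < M + n)%N -> (k <= D)%N.
  move=> /andP[Mk kN]; rewrite leq_divRL// mulnC.
  exact: den_lt_prim (den0 _ Mk) pN kN.
have PB k : den al k == N -> (N <= k)%N.
  move=> /eqP dk; have d0 : (0 < den al k)%N by rewrite dk.
  have [_ [l [l0 kE _]]] := den_spec d0.
  by rewrite kE dk leq_pmull.
have lf1 : lowfreq D s.
  have := lowfreq_sum (D' := D) (index_iota 1 X) b om (lowfreq_cst1 R) PD.
  by under eq_fun do rewrite mul1r.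
have lf2 := lowfreq_sum (D' := D) (index_iota 1 X) b om lf1 PD.
have lf3 := lowfreq_sum (D' := D) (index_iota 1 X) b om lf2 PD.
have PB' k : den al k == N -> (D + D + D < k)%N by move=> /PB; exact: leq_trans.
have PB1 k : den al k == N -> (D < k)%N.
  by move=> /PB'; apply: leq_ltn_trans; rewrite -addnA leq_addr.
have sB : mean (fun x => s x * B x) = 0 by exact: lowfreq_orth lf1 PB1.
have s3B : mean (fun x => s x ^+ 3 * B x) = 0.
  have := lowfreq_orth (index_iota 1 X) b om lf3 PB'.
  by move=> <-; congr mean; apply/funext => x; rewrite -/(s x) -/(B x); ring.
have B0 : mean B = 0.
  have := lowfreq_orth (index_iota 1 X) b om (lowfreq_cst1 R) (fun k h => leq_ltn_trans (leq0n D) (PB1 k h)).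
  by under eq_fun do rewrite mul1r.
have BL : b N ^+ 2 / 2 <= mean (fun x => B x ^+ 2).
  apply: (mean_sqr_waves_ge (P := fun k => den al k == N)) => //; first exact: iota_uniq.
    by rewrite mem_index_iota N0.
  by case/andP: pN.
have BU : mean (fun x => B x ^+ 2) <= zN ^+ 2.
  by rewrite -[leRHS]mean_cst; apply: le_mean => //; [exact: bmeasX|exact: bmeas_cst].
have s2E : mean (fun x => s' x ^+ 2) = mean (fun x => s x ^+ 2) + mean (fun x => B x ^+ 2).
  have -> : (fun x => s' x ^+ 2) = (fun x => (s x ^+ 2 + B x ^+ 2) + 2 * (s x * B x)).
    by apply/funext => x; rewrite s'E; ring.
  rewrite meanD; [|by apply: bmeasD; exact: bmeasX|by apply: bmeasZ; exact: bmeasM].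
  rewrite meanD; [|exact: bmeasX|exact: bmeasX].
  by rewrite meanZ ?sB ?mulr0 ?addr0//; exact: bmeasM.
split.
- have -> : s' = (fun x => s x + B x) by apply/funext.
  by rewrite meanD// s0 B0 addr0.
- by rewrite s2E lerD.
- by rewrite s2E lerD.
- have b2 := bmeasX 2 bs; have b4 := bmeasX 4 bs.
  (* In (s + B)^4 the term 4 s^3 B has mean 0, 4 s B^3 is at most 2 s^2 B^2 + 2 B^4, and |B| <= zN.
     The increment 8 zN^2 V + 3 zN^4 is at most that of 4 V^2 when V grows by zN^2. *)
  apply: (@le_trans _ _ (mean (fun x => (s x ^+ 4 + 4 * (s x ^+ 3 * B x)) +
      (8 * zN ^+ 2 * s x ^+ 2 + 3 * (zN ^+ 2) ^+ 2)))).
    apply: le_mean.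
    + apply: bmeasX; have -> : s' = (fun x => s x + B x) by apply/funext.
      exact: bmeasD.
    + apply: bmeasD; first by apply: bmeasD => //; apply: bmeasZ; apply: bmeasM => //; exact: bmeasX.
      by apply: bmeasD; [exact: bmeasZ|exact: bmeas_cst].
    + move=> x; rewrite s'E; have := B2 x; set u := s x; set v := B x; set w := zN ^+ 2 => vw.
      have v0 : 0 <= v ^+ 2 by exact: sqr_ge0.
      have u0 : 0 <= u ^+ 2 by exact: sqr_ge0.
      have h1 : 2 * (u * v ^+ 3) <= u ^+ 2 * v ^+ 2 + v ^+ 4.
        have : 0 <= (v * (u - v)) ^+ 2 by exact: sqr_ge0.
        by rewrite (_ : _ ^+ 2 = u ^+ 2 * v ^+ 2 + v ^+ 4 - 2 * (u * v ^+ 3)); [clear; lra|ring].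
      have h2 : u ^+ 2 * v ^+ 2 <= u ^+ 2 * w by rewrite ler_wpM2l.
      have h3 : v ^+ 4 <= w ^+ 2.
        by rewrite -[4%N]/(2 * 2)%N exprM lerXn2r ?nnegrE// (le_trans v0).
      have -> : (u + v) ^+ 4 = u ^+ 4 + 4 * (u ^+ 3 * v) + (6 * (u ^+ 2 * v ^+ 2) + 2 * (2 * (u * v ^+ 3)) + v ^+ 4).
        by ring.
      move: h1 h2 h3; clear; lra.
  rewrite meanD; last 2 first.
  - by apply: bmeasD => //; apply: bmeasZ; apply: bmeasM => //; exact: bmeasX.
  - by apply: bmeasD; [exact: bmeasZ|exact: bmeas_cst].
  rewrite meanD//; last by apply: bmeasZ; apply: bmeasM => //; exact: bmeasX.
  rewrite meanZ; last by apply: bmeasM => //; exact: bmeasX.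
  rewrite s3B mulr0 addr0 meanD ?mean_cst; [|exact: bmeasZ|exact: bmeas_cst].
  rewrite meanZ//.
  have z2 : 0 <= zN ^+ 2 by exact: sqr_ge0.
  have : zN ^+ 2 * mean (fun x => s x ^+ 2) <= zN ^+ 2 * V by rewrite ler_wpM2l.
  set m2 := mean _; set m4 := mean _ in s4 *; set y := zN ^+ 2 in z2 * => h1.
  have := mulr_ge0 z2 V0; have := sqr_ge0 y.
  move: s4 h1; clear; nra.
Qed.

Lemma exists_prim_above R (al : R) (a : nat -> R) :
  (forall M B, exists N, B <= \sum_(M <= q < N | prim al q) a q ^+ 2) ->
  forall M, exists2 q, prim al q & (M <= q)%N.
Proof.
move=> h M; have [N hN] := h M 1; apply: contrapT => nq.
move: hN; rewrite big_nat_cond big1 ?ler10// => q /andP[/andP[Mq _] pq].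
by exfalso; apply: nq; exists q.
Qed.

(** The gap e is an absolute constant because kappa = m / mu scales with mu: the part of mu S_t kept
    in the window always has variance between m^2 / 32 and 288 m^2. *)
Lemma birkhoff_not_nearly_constant R (f : R -> R) (r om : nat -> R) (c C al mu : R) (m0 : nat) :
  irrational al -> 0 < mu -> continuous f -> periodic1 f ->
  (forall k, 0 <= r k) -> (forall k, (0 < k)%N -> r k <= C / k%:R ^+ 3) ->
  (forall n x, (0 < n)%N -> `|f x - c - \sum_(1 <= k < n) r k * wave k (om k) x| <= C / n%:R) ->
  (forall q, (m0 <= q)%N -> 0 < r q) ->
  (forall q n, (m0 <= q)%N -> \sum_(2 <= l < n) r (l * q)%N <= r q / 4) ->
  (forall M B, exists N, B <= \sum_(M <= q < N | prim al q) (r q / `|sin (pi * (q%:R * al))|) ^+ 2) ->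
  exists2 e, 0 < e & forall d, 0 < d -> exists t : nat, exists j : int,
    `|t%:R * al - j%:~R| <= d /\ mean (fun x => cos (mu * birkhoff_sum al f (Posz t) x)) <= 1 - e.
Proof.
move=> ial mu0 cf pf r0 rC hf rpos hr bad.
have C0 : 0 <= C by have := le_trans (r0 1%N) (rC 1%N isT); rewrite expr1n divr1.
(* In the window the z_q^2 sum to at most 2 ka^2 and each block to at most 12 z_q, so the variance
   of mu s is at most 2 * 144 * m^2. This m turns that into m / 15, and the fourth moment is at most
   4 (m / 15)^2. *)
have [m m_gt0 [m1 mE]] : exists2 m : R, 0 < m & m <= 1 /\ 2 * (12 * 12) * m = 15^-1.
  have c0 : 0 < 2 * (12 * 12) :> R by rewrite mulr_gt0// mulr_gt0.
  exists (15^-1 / (2 * (12 * 12))); first by rewrite divr_gt0// invr_gt0.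
  split; last by rewrite mulrC divfK// gt_eqF.
  by rewrite ler_pdivrMr// mul1r; lra.
pose ka := m / mu.
have ka0 : 0 < ka by rewrite divr_gt0.
(* The gain 5/12 * m^2 / 32 exceeds m^2 / 450 + 2 m^2 / 210: one e pays for the waves left out, the
   other is the gap. *)
have [e e_gt0 em] : exists2 e : R, 0 < e & 15 * (14 * e) <= m ^+ 2.
  exists (m ^+ 2 / 15 / 14); first by rewrite !divr_gt0// exprn_gt0.
  by rewrite -mulrA !(mulrC _ (_ / _)); lra.
exists e => //.
move=> d d0.
have er0 : 0 < e / mu by rewrite divr_gt0.
have [d1 d10 herr] := error_small ial er0 r0 rC.
pose a q := r q / `|sin (pi * (q%:R * al))|.
(* The intended position of q t alpha modulo 1, up to a factor 2, so that z q = min(a q / 2, ka). *)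
pose y q := Num.min 2^-1 (ka / a q).
pose z q := a q * y q.
(* n1 makes 3 / M at most the permitted distance of t alpha to an integer; n2 makes M >= 13 C / ka,
   for the condition [gap] of the nested intervals. *)
have [n1 n1_1 n1K] := exists_div_lt (3 / Num.min d d1) 1 ltr01.
have dd0 : 0 < Num.min d d1 by rewrite lt_min d0.
have [n2 n2_0 n2K] := exists_div_lt (13 * C / ka) 0 ltr01.
have [M pM hM] := exists_prim_above bad (maxn m0 (maxn n1 n2)).
have Mm0 : (m0 <= M)%N by apply: leq_trans hM; rewrite leq_max leqnn.
have M0 : (0 < M)%N by case/andP: pM.
have MR : 0 < M%:R :> R by rewrite ltr0n.
have M3 : 3 / M%:R <= Num.min d d1.
  move: n1K; rewrite ltr_pdivrMr ?ltr0n ?(leq_ltn_trans _ n1_1)// mul1r ltr_pdivrMr// => n1K.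
  rewrite ler_pdivrMr// mulrC (le_trans (ltW n1K))// ler_wpM2r ?(ltW dd0)// ler_nat.
  by apply: leq_trans hM; rewrite !leq_max leqnn orbT.
have MC : 13 * C / ka <= M%:R.
  move: n2K; rewrite ltr_pdivrMr ?ltr0n// mul1r => /ltW/le_trans; apply.
  by rewrite ler_nat; apply: leq_trans hM; rewrite !leq_max leqnn !orbT.
have apos q : (m0 <= q)%N -> (0 < q)%N -> 0 < a q.
  by move=> mq q0; rewrite divr_gt0 ?rpos// normr_gt0 sin_int_neq0.
have y2 q : y q <= 2^-1 by rewrite ge_min lexx.
have ypos q : (m0 <= q)%N -> (0 < q)%N -> 0 < y q.
  by move=> mq q0; rewrite lt_min invr_gt0 ltr0n/= divr_gt0// apos.
have zka q : (m0 <= q)%N -> (0 < q)%N -> z q <= ka.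
  move=> mq q0; have a0 := apos q mq q0.
  rewrite /z -[leRHS](@divfK _ (a q)) ?gt_eqF// [leRHS]mulrC ler_pM2l// ge_min lexx orbT//.
have zcase q : (m0 <= q)%N -> (0 < q)%N -> z q = ka \/ z q = a q / 2.
  move=> mq q0; have a0 := apos q mq q0.
  rewrite /z /y minEle; case: ifP => _; [by right|left].
  by rewrite mulrC divfK// gt_eqF.
(* Either one z q already equals ka, or all of them are a q / 2 and the divergent series applies. *)
have [N0 hN0] : exists N, ka ^+ 2 <= \sum_(M <= q < N | prim al q) z q ^+ 2.
  case: (pselect (exists q, [/\ prim al q, (M <= q)%N & z q = ka])) => [[q [pq Mq zq]]|nz].
    exists q.+1; rewrite big_mkcond big_nat_recr//= pq zq lerDr sumr_ge0// => i _.
    by case: ifP => // _; exact: sqr_ge0.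
  have [N hN] := bad M (4 * ka ^+ 2); exists N.
  rewrite -(ler_pM2l (_ : 0 < 4))// (le_trans hN)// mulr_sumr.
  rewrite big_nat_cond [leRHS]big_nat_cond; apply: ler_sum => q /andP[/andP[Mq _] pq].
  have q0 : (0 < q)%N by case/andP: pq.
  case: (zcase q (leq_trans Mm0 Mq) q0) => zq; first by exfalso; apply: nz; exists q.
  by rewrite zq -/(a q) le_eqVlt; apply/orP; left; apply/eqP; field.
have exN : exists N, ka ^+ 2 <= \sum_(M <= q < N | prim al q) z q ^+ 2 by exists N0.
have [N hN minN] := ex_minnP exN.
have MN : (M < N)%N.
  rewrite ltnNge; apply/negP => NM; move: hN; rewrite big_geq// leNgt => /negP; apply.
  by rewrite exprn_gt0.
(* Since N is minimal, the last index adds at most ka^2 to a sum below ka^2. *)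
have Nub : \sum_(M <= q < N | prim al q) z q ^+ 2 <= 2 * ka ^+ 2.
  move: minN MN; case: N hN => // n hn minn; rewrite ltnS => Mn.
  have : \sum_(M <= q < n | prim al q) z q ^+ 2 < ka ^+ 2.
    by rewrite ltNge; apply/negP => /minn; rewrite ltnn.
  move=> h; rewrite big_mkcond big_nat_recr//= -big_mkcond/=.
  have -> : 2 * ka ^+ 2 = ka ^+ 2 + ka ^+ 2 by ring.
  apply: lerD; first exact: ltW.
  case: ifP => [pn|_]; last by rewrite exprn_ge0// ltW.
  have n_0 : (0 < n)%N by exact: leq_trans Mn.
  have mn := leq_trans Mm0 Mn.
  by rewrite lerXn2r ?nnegrE ?zka//; [rewrite /z mulr_ge0// ltW// ?apos ?ypos|rewrite ltW].
have {}MN := ltnW MN.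
(* The first primitive q' from N on bounds the time t. By its minimality, any denominator [den] k >=
   N is at least q'. *)
have exq' : exists q', prim al q' && (N <= q')%N.
  by have [q' pq' Nq'] := exists_prim_above bad N; exists q'; rewrite pq'.
have [q' /andP[pq' Nq'] minq'] := ex_minnP exq'.
(* If y q = 1/2, the ratio 15 suffices. Otherwise y q = ka / a q with a q ||q alpha|| <= 2 C / q^3,
   and M >= 13 C / ka gives 12 C / q^2 <= 12/13 ka, below the 15/16 ka supplied by [prim_gap]. *)
have gap q p : prim al q -> prim al p -> (M <= q)%N -> (q < p)%N -> 6 * q%:R <= y q * p%:R.
  move=> pq pp Mq qp; have q0 : (0 < q)%N by case/andP: pq.
  have mq := leq_trans Mm0 Mq; have a_0 := apos q mq q0.
  rewrite /y minEle; case: ifP => _.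
    have := prim_lacunary pq pp qp; rewrite -(ler_nat R) natrM.
    by have : 0 <= q%:R :> R by []; clear; lra.
  have g1 := prim_gap pq pp qp; have e_0 := dist_int_gt0 ial q0.
  have sk := abs_sin_ge_dist (q%:R * al).
  set D := dist_int _ in g1 e_0 sk.
  have qR : 1 <= q%:R :> R by rewrite ler1n.
  have qR0 : 0 < q%:R :> R by rewrite ltr0n.
  have ae : a q * D <= 2 * (C / q%:R ^+ 3).
    apply: (@le_trans _ _ (2 * r q)); last by rewrite ler_pM2l// rC.
    have s0 : 0 < `|sin (pi * (q%:R * al))| by rewrite normr_gt0 sin_int_neq0.
    rewrite /a mulrAC ler_pdivrMr// -mulrA mulrCA ler_wpM2l ?r0//; move: sk; clear; lra.
  have Cq : 13 * C <= ka * q%:R.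
    rewrite -ler_pdivrMl// mulrC (le_trans MC)// ler_nat//.
  have C3 : 12 * (C / q%:R ^+ 3) * q%:R <= 12 / 13 * ka.
    have -> : 12 * (C / q%:R ^+ 3) * q%:R = 12 * C / q%:R ^+ 2 by field; rewrite gt_eqF.
    rewrite ler_pdivrMr ?exprn_gt0//.
    have : ka * q%:R <= ka * q%:R ^+ 2 by rewrite ler_pM2l// expr2 ler_peMr// ltW.
    move: Cq; clear; lra.
  rewrite mulrAC ler_pdivlMr// -(ler_pM2r e_0).
  have : 15 / 16 * ka <= p%:R * D * ka by rewrite ler_wpM2r// ltW.
  have : a q * D * (6 * q%:R) <= 2 * (C / q%:R ^+ 3) * (6 * q%:R) by rewrite ler_wpM2r// mulr_ge0.
  move: C3 ka0; clear; lra.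
have ybd q : prim al q -> (M <= q)%N -> 0 < y q <= 2^-1.
  by move=> pq Mq; rewrite y2 andbT ypos//; [exact: leq_trans Mq|case/andP: pq].
have [a0 [l [a00 l0 al3 hin hlen]]] := nested_intervals M0 ybd gap (N - M).
rewrite subnKC// in hin hlen.
have l3 : a0 + 3 / q'%:R <= a0 + l.
  by rewrite lerD2l ler_pdivrMr ?hlen// ltr0n; case/andP: pq'.
have [t tq' [j /andP[th1 th2]]] := orbit_dense pq' l3.
(* Now y q / 2 <= q t al <= y q modulo 1 for every primitive q of the window. *)
exists t, j.
set th := _ - _ in th1 th2 *.
have thM : `|th| <= 3 / M%:R by rewrite ger0_norm; [exact: le_trans al3|exact: le_trans th1].
have thd : `|th| <= Num.min d d1 by exact: le_trans M3.
move: thd; rewrite le_min => /andP[thd thd1].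
split => //.
pose W k := (M <= den al k < N)%N.
pose b := amp r al t; pose s x := \sum_(1 <= k < q' | W k) b k * wave k (phase om al t k) x.
(* The value 0 of [den] marks non-resonant frequencies; M > 0 keeps them out of the window. *)
have den0 k : (M <= den al k)%N -> (0 < den al k)%N by exact: leq_trans.
have WX k : W k -> (k < q')%N.
  move=> /andP[Mk kN].
  have := den_lt_prim (den0 _ Mk) pq' (leq_trans kN Nq').
  apply: leq_trans; rewrite -[X in (X < _)%N]mul1n ltn_mul2r andbT.
  by rewrite lt0n; apply/negP => /eqP k00; move: (den0 _ Mk); rewrite k00 /den /resonant.
have hW k : ~~ W k -> (den al k < M)%N \/ (q' <= den al k)%N.
  rewrite negb_and -leqNgt -ltnNge => /orP[|Nk]; first by left.
  right; apply: minq'; rewrite Nk andbT; apply: (den_spec _).1.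
  by rewrite (leq_trans _ Nk)// (leq_trans M0).
have err x : `|birkhoff_sum al f (Posz t) x - t%:R * c - s x| <= e / mu.
  apply: birkhoff_error ial hf WX _ x => n.
  exact: herr pM thM thd1 tq' hW.
(* For u = q th - i between y q / 2 and y q, one has u / 2 <= |sin(pi u)| <= 4 u. *)
have ampb q : prim al q -> (M <= q < N)%N -> z q / 4 <= `|b q| <= 4 * z q.
  move=> pq Mq; have q0 : (0 < q)%N by case/andP: pq.
  have mq : (m0 <= q)%N by case/andP: Mq => Mq _; exact: leq_trans Mq.
  have [i /andP[i1 i2]] := hin q th pq Mq (introT andP (conj th1 th2)).
  have y0 := ypos q mq q0; have a_0 := apos q mq q0; have y_2 := y2 q.
  have bE : `|b q| = a q * `|sin (pi * (q%:R * th - i%:~R))|.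
    rewrite /b /amp normrM (ger0_norm (r0 q)) normf_div (abs_sin_theta al t q j) -/th /a.
    by rewrite -mulrNz abs_sinD_int; ring.
  have u0 : 0 <= q%:R * th - i%:~R by apply: le_trans i1; rewrite divr_ge0// ltW.
  have := @abs_sin_pi_ge R (q%:R * th - i%:~R); have := abs_sin_pi_le (q%:R * th - i%:~R).
  rewrite (ger0_norm u0) => h1 h2.
  have {}h2 := h2 (le_trans i2 y_2).
  rewrite bE /z; apply/andP; split.
    by rewrite -mulrA ler_pM2l//; move: i1 h2; clear; lra.
  by rewrite mulrCA ler_pM2l//; move: i2 h1; clear; lra.
have blk q : prim al q -> (M <= q < N)%N -> \sum_(1 <= k < q' | den al k == q) `|b k| <= 12 * z q.
  move=> pq Mq; have mq : (m0 <= q)%N by case/andP: Mq => Mq _; exact: leq_trans Mq.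
  apply: (le_trans (block_bound t q' ial r0 pq (fun n => hr q n mq))).
  by have /andP[_] := ampb q pq Mq; rewrite -/b; clear; lra.
have blk' q : prim al q -> (M <= q < q')%N -> \sum_(1 <= k < q' | den al k == q) `|b k| <= 12 * z q.
  move=> pq /andP[Mq qq']; apply: blk => //; rewrite Mq ltnNge; apply/negP => Nq.
  by have := minq' q; rewrite pq Nq => /(_ isT); rewrite leqNgt qq'.
have wm := window_moments (z := fun q => 12 * z q) (phase om al t) M0 blk' (n := N - M).
rewrite subnKC// in wm.
pose V := \sum_(M <= q < N | prim al q) z q ^+ 2; rewrite -/V in hN Nub.
pose V' := \sum_(M <= q < N | prim al q) (12 * z q) ^+ 2.
have [s_0 sL sU s4] : [/\ mean s = 0, \sum_(M <= q < N | prim al q) b q ^+ 2 / 2 <= mean (fun x => s x ^+ 2),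
  mean (fun x => s x ^+ 2) <= V' & mean (fun x => s x ^+ 4) <= 4 * V' ^+ 2] := wm Nq'.
have bw i u : bmeas (@wave R i u) by exact: bmeas_wave.
have bs : bmeas s by apply: bmeas_sum => k; exact: bmeasZ.
have {}sL : ka ^+ 2 / 32 <= mean (fun x => s x ^+ 2).
  apply: le_trans sL; apply: (@le_trans _ _ (V / 32)); first by rewrite ler_pM2r.
  rewrite /V mulr_suml [leLHS]big_nat_cond [leRHS]big_nat_cond; apply: ler_sum => q /andP[Mq pq].
  have /andP[h1 _] := ampb q pq Mq.
  have : (z q / 4) ^+ 2 <= `|b q| ^+ 2.
    rewrite lerXn2r ?nnegrE// divr_ge0//.
    have q0 : (0 < q)%N by case/andP: pq.
    have mq : (m0 <= q)%N by case/andP: Mq => Mq _; exact: leq_trans Mq.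
    by rewrite /z mulr_ge0// ltW// ?apos ?ypos.
  by rewrite -normrX ger0_norm ?sqr_ge0//; clear; lra.
have mka : mu * ka = m by rewrite /ka mulrC divfK// gt_eqF.
have m2E : mu ^+ 2 * ka ^+ 2 = m ^+ 2 by rewrite -exprMn mka.
have mu2 : 0 < mu ^+ 2 by rewrite exprn_gt0.
have msq p : (fun x => (mu * s x) ^+ p) = (fun x => mu ^+ p * s x ^+ p).
  by apply/funext => x; rewrite exprMn.
have V'0 : 0 <= mu ^+ 2 * V' by rewrite mulr_ge0 ?(ltW mu2)// sumr_ge0// => q _; exact: sqr_ge0.
have hV : mu ^+ 2 * V' <= m / 15.
  have -> : V' = 12 * 12 * V by rewrite /V' /V mulr_sumr; apply: eq_bigr => q _; rewrite exprMn.
  rewrite -mE (_ : m * _ = 12 * 12 * (2 * m ^+ 2)); last by ring.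
  by rewrite mulrCA ler_pM2l ?mulr_gt0// -m2E mulrCA ler_pM2l.
have hcos : mean (fun x => cos (mu * (t%:R * c) + mu * s x)) <=
    1 - 5 / 12 * (m ^+ 2 / 32) + 4 * (m / 15) ^+ 2 / 8.
  apply: (mean_cos_le (s := fun x => mu * s x)); rewrite ?msq ?meanZ//; try exact: bmeasX.
  - exact: bmeasZ.
  - by rewrite s_0 mulr0.
  - by rewrite -m2E -mulrA ler_pM2l.
  - apply: (le_trans (ler_wpM2l (ltW mu2) sU)); move: hV m1; clear; lra.
  - apply: (@le_trans _ _ (4 * (mu ^+ 2 * V') ^+ 2)); last by rewrite ler_pM2l// lerXn2r ?nnegrE// (le_trans V'0).
    by rewrite (_ : 4 * _ = mu ^+ 4 * (4 * V' ^+ 2)) ?ler_pM2l ?exprn_gt0//; ring.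
have bcos (g : R -> R) : measurable_fun setT g -> bmeas (fun x => cos (g x)).
  by move=> mg; apply: (@bmeas_comp R _ _ 1) => //; [exact: continuous_cos|exact: cos_max].
have bf := periodic_bmeas cf pf.
have bS : bmeas (birkhoff_sum al f (Posz t)).
  by apply: bmeas_sum => j0; exact: bmeas_shift.
have le1 : mean (fun x => cos (mu * birkhoff_sum al f (Posz t) x)) <=
    mean (fun x => cos (mu * (t%:R * c) + mu * s x) + e).
  have b1 : bmeas (fun x => cos (mu * (t%:R * c) + mu * s x)).
    apply: bcos; have [] // : bmeas (fun x => mu * (t%:R * c) + mu * s x).
    by apply: bmeasD; [exact: bmeas_cst|exact: bmeasZ].
  apply: le_mean => //; first by apply: bcos; have [] := bmeasZ mu bS.
    by apply: bmeasD => //; exact: bmeas_cst.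
  move=> x; rewrite -lerBlDl (le_trans (ler_norm _))// (le_trans (cos_lipschitz _ _))//.
  have -> : mu * birkhoff_sum al f t x - (mu * (t%:R * c) + mu * s x) =
    mu * (birkhoff_sum al f t x - t%:R * c - s x) by ring.
  rewrite normrM (gtr0_norm mu0).
  have -> : e = mu * (e / mu) by field; rewrite gt_eqF.
  by rewrite ler_pM2l.
apply: (le_trans le1); rewrite meanD ?mean_cst; [| |exact: bmeas_cst]; last first.
  apply: bcos; have [] // : bmeas (fun x => mu * (t%:R * c) + mu * s x).
  by apply: bmeasD; [exact: bmeas_cst|exact: bmeasZ].
have m2 : (m / 15) ^+ 2 = m ^+ 2 / (15 * 15) by rewrite expr_div_n expr2.
move: em hcos; rewrite m2; have := sqr_ge0 m; clear; lra.
Qed.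

(** * Ergodicity of irrational rotations *)

Lemma null_prod_sections d1 d2 (T1 : measurableType d1) (T2 : measurableType d2) (R : realType)
  (m1 : {sigma_finite_measure set T1 -> \bar R}) (m2 : {sigma_finite_measure set T2 -> \bar R})
  (B : set (T1 * T2)) : measurable B -> (m1 \x m2)%E B = 0%E ->
  {ae m1, forall x, m2 (xsection B x) = 0%E}.
Proof.
move=> mB B0.
have mf : measurable_fun setT (m2 \o xsection B) by exact: measurable_fun_xsection.
have : (\int[m1]_x `|(m2 \o xsection B) x| = 0)%E.
  rewrite -[RHS]B0; apply: eq_integral => x _.
  by rewrite gee0_abs//= measure_ge0.
move=> /(ae_eq_integral_abs m1 measurableT mf).
by apply: filterS => x /(_ Logic.I).
Qed.

(** Null horizontal sections make the set null by Tonelli, hence almost every vertical section null.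
    This exchanges a quantifier over all y with one over almost all x. *)
Lemma null_sections d1 d2 (T1 : measurableType d1) (T2 : measurableType d2) (R : realType)
  (m1 : {sigma_finite_measure set T1 -> \bar R}) (m2 : {sigma_finite_measure set T2 -> \bar R})
  (B : set (T1 * T2)) : measurable B -> (forall y, m1 (ysection B y) = 0%E) ->
  {ae m1, forall x, m2 (xsection B x) = 0%E}.
Proof.
move=> mB B0; apply: null_prod_sections => //.
transitivity (\int[m2]_y (m1 \o ysection B) y)%E; last first.
  by rewrite -[RHS](integral0 m2 setT); apply: eq_integral => y _ /=; rewrite B0.
have := indic_fubini_tonelli m1 m2 mB.
by rewrite indic_fubini_tonelli_FE// indic_fubini_tonelli_GE.
Qed.

Lemma measurable_neq d (T : measurableType d) (R : realType) (f g : T -> R) :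
  measurable_fun setT f -> measurable_fun setT g -> measurable [set x | f x <> g x].
Proof.
move=> mf mg.
have -> : [set x | f x <> g x] = (fun x => f x - g x) @^-1` (~` [set 0]).
  by apply/seteqP; split => x /=; [move=> h /eqP; rewrite subr_eq0 => /eqP|move=> h e; apply: h; rewrite e subrr].
rewrite -[X in measurable X]setTI.
by apply: (measurable_funB mf mg) => //; apply: measurableC; exact: measurable_set1.
Qed.

Lemma lebesgue_circle_null R (P : R -> Prop) :
  (leb R).-negligible [set x : R | 0 <= x < 1 /\ ~ P x] <->
  {ae circle_measure R, forall x, P x}.
Proof.
split=> -[A [mA A0 PA]].
  exists (A `|` ~` (`[0, 1[%classic : set R)); split.
  - by apply: measurableU => //; exact: measurableC.
  - rewrite /circle_measure/= /mrestr/= setIUl setICl setU0.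
    apply/eqP; rewrite eq_le measure_ge0 andbT -A0; apply: le_measure; rewrite ?inE//.
    exact: measurableI.
  - move=> x /= nPx; case: (boolP (0 <= x < 1)) => x01; first by left; exact: PA.
    by right; rewrite in_itv/=; exact/negP.
exists (A `&` `[0, 1[%classic); split => //; first exact: measurableI.
by move=> x [x01 nPx]; split; [exact: PA|rewrite /= in_itv].
Qed.

(** Invariance for every t and almost every x becomes, by exchange of the variables, invariance for
    some x0 and almost every t; r x0 is the constant. *)
Lemma translation_invariant_ae_const R (r : R -> R) : measurable_fun setT r -> periodic1 r ->
  (forall t, {ae circle_measure R, forall x, r (x + t) = r x}) ->
  exists c, {ae circle_measure R, forall x, r x = c}.
Proof.
move=> mr pr hr.
pose B : set (R * R) := [set z | r (z.1 + z.2) <> r z.1] `&` [set z | 0 <= z.1 < 1].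
have mB : measurable B.
  apply: measurableI.
    apply: measurable_neq; apply: measurableT_comp => //.
    exact: measurable_funD.
  have -> : [set z : R * R | 0 <= z.1 < 1] = (`[0, 1[%classic : set R) `*` setT.
    by apply/seteqP; split => -[x y] /=; rewrite in_itv/=; [|case].
  by apply: measurableX.
have sec y : leb R (ysection B y) = 0%E.
  have /lebesgue_circle_null := hr y => -[A [mA A0 BA]].
  apply/eqP; rewrite eq_le measure_ge0 andbT -A0; apply: le_measure; rewrite ?inE//.
    exact: measurable_ysection.
  by move=> x /=; rewrite /ysection/= inE => -[/= h1 h2]; apply: BA.
have := @null_sections _ _ _ _ R (leb R) (leb R) B mB sec.
move=> ae1.
have : {ae circle_measure R, forall x, leb R (xsection B x) = 0%E /\ 0 <= x < 1}.
  apply: circle_ae_and; last by apply: circle_ae_interval.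
  apply/lebesgue_circle_null; case: ae1 => A [mA A0 BA]; exists A; split => //.
  by move=> x [_ h]; apply: BA.
move=> /circle_ae_ex[x0 [x00 x01]].
exists (r x0).
have : {ae circle_measure R, forall y, r (x0 + y) = r x0}.
  apply/lebesgue_circle_null; exists (xsection B x0); split => //.
    exact: measurable_xsection.
  by move=> y [_ h]; rewrite /= /xsection/= inE; split.
move=> /(circle_ae_shift (- x0)); rewrite /periodic1 => h.
have : {ae circle_measure R, forall x, r (x0 + (x + - x0)) = r x0}.
  by apply: h => y; rewrite addrA pr.
by apply: circle_aeS => x; rewrite addrC subrK.
Qed.

(** The autocorrelation C t, the mean of g(x + t) g(x), is continuous although g is only measurable,
    and invariant under t -> t + alpha. Its coefficients of positive frequency vanish, so C is
    constant and the mean of (g(x + t) - g(x))^2, which is 2 C 0 - 2 C t, is 0 for every t. *)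
Lemma ergodic_rotation R (al : R) (g : R -> R) : irrational al -> bmeas g -> periodic1 g ->
  {ae circle_measure R, forall x, g (x + al) = g x} ->
  exists c, {ae circle_measure R, forall x, g x = c}.
Proof.
move=> ial bg pg inv; have [mg [M gM]] := bg.
apply: translation_invariant_ae_const => //.
pose C (t : R) := mean (fun x => g (x + t) * g x).
have bC t : bmeas (fun x => g (x + t) * g x) by apply: bmeasM => //; exact: bmeas_shift.
have pC : periodic1 C.
  by move=> t; congr mean; apply/funext => x; rewrite addrA pg.
have pgt t : periodic1 (fun x => `|g (x + t) - g x|).
  by move=> x; rewrite addrAC !pg.
have M0 : 0 <= M by apply: le_trans (gM 0).
have cC : continuous C.
  move=> t; apply/cvgrPdist_lt => e e0.
  have e1 : 0 < e / (M + 1) by rewrite divr_gt0// ltr_wpDl.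
  have [d d0 hd] := mean_translate_cont bg pg e1.
  apply/nbhs_ballP; exists d => //= u; rewrite /ball/= => tu.
  have -> : C t - C u = mean (fun x => (g (x + t) - g (x + u)) * g x).
    by rewrite /C -meanB//; congr mean; apply/funext => x; rewrite mulrBl.
  have bd : bmeas (fun x => g (x + t) - g (x + u)) by apply: bmeasB; exact: bmeas_shift.
  apply: (le_lt_trans (le_norm_mean (bmeasM bd bg))).
  apply: (@le_lt_trans _ _ (mean (fun x => M * `|g (x + t) - g (x + u)|))).
    apply: le_mean; [exact/bmeas_norm/bmeasM|exact/bmeasZ/bmeas_norm|move=> x].
    by rewrite normrM mulrC ler_wpM2r.
  rewrite meanZ; last exact: bmeas_norm.
  have -> : mean (fun x => `|g (x + t) - g (x + u)|) = mean (fun x => `|g (x + (t - u)) - g x|).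
    rewrite -[RHS](@mean_shift R u); [|by apply: bmeas_norm; apply: bmeasB => //; exact: bmeas_shift|exact: pgt].
    by congr mean; apply/funext => x; congr (`|g _ - _|); ring.
  have := hd (t - u) tu; rewrite ltr_pdivlMr ?ltr_wpDl// mulrC.
  set m := mean _ => hm; apply: le_lt_trans hm; rewrite ler_wpM2r ?lerDl//.
  by apply: mean_ge0.
have invC t : C (t + al) = C t.
  apply: mean_ae_eq.
  - by have [] := bC (t + al).
  - by have [] := bC t.
  - have : {ae circle_measure R, forall x, g (x + t + al) = g (x + t)}.
      by apply: (@circle_ae_shift R t (fun x => g (x + al) = g x)) => // x; rewrite addrAC !pg.
    by apply: circle_aeS => x h; rewrite addrA h.
have bCC := periodic_bmeas cC pC.
have bw i u : bmeas (@wave R i u) by exact: bmeas_wave.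
pose F k w := mean (fun t => C t * wave k w t).
have F0 k : (0 < k)%N -> forall w, F k w = 0.
  move=> k0.
  have Flin w : F k w = cos w * F k 0 + sin w * F k (pi / 2).
    rewrite /F -!meanZ; [|exact: bmeasM|exact: bmeasM].
    rewrite -meanD; [|by apply: bmeasZ; exact: bmeasM|by apply: bmeasZ; exact: bmeasM].
    congr mean; apply/funext => t; rewrite /wave addr0 cosDpihalf cosD; ring.
  pose be := pi * (k%:R * al).
  (* Invariance under alpha, written symmetrically in the phase. As F k is a combination of cos w
     and sin w and sin be is nonzero, both coefficients vanish. *)
  have Finv w : F k (w + be) = F k (w - be).
    rewrite {2}/F -(@mean_shift R al); [|exact: bmeasM|by move=> t; rewrite pC wave_periodic].
    congr mean; apply/funext => t; rewrite invC wave_shift; congr (_ * wave _ _ _).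
    by rewrite /be; ring.
  have sb := sin_int_neq0 ial k0; rewrite -/be in sb.
  have eq w : sin be * (- F k 0 * sin w + F k (pi / 2) * cos w) = 0.
    have := Finv w; rewrite (Flin (w + be)) (Flin (w - be)) cosB sinB cosD sinD; lra.
  have /eqP := eq 0; rewrite sin0 cos0 mulr0 add0r mulr1 mulf_eq0 (negbTE sb)/= => /eqP F1.
  have /eqP := eq (pi / 2); rewrite sin_pihalf cos_pihalf mulr0 addr0 mulr1 mulf_eq0 (negbTE sb)/= oppr_eq0 => /eqP F2.
  by move=> w; rewrite Flin F1 F2 !mulr0 addr0.
have Cc t : C t = mean C.
  apply/eqP; rewrite -subr_eq0; apply/eqP.
  apply: (@orth_continuous_eq0 R (fun t => C t - mean C)).
  - by move=> x; apply: cvgB; [exact: cC|exact: cvg_cst].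
  - by move=> x; rewrite pC.
  - move=> k w.
    have -> : (fun x => (C x - mean C) * wave k w x) = (fun x => C x * wave k w x - mean C * wave k w x).
      by apply/funext => x; rewrite mulrBl.
    rewrite meanB ?meanZ//; [|exact: bmeasM|exact: bmeasZ].
    case: (posnP k) => [->|k0]; last by rewrite mean_wave// mulr0 subr0 -/(F k w) F0.
    have w0 : wave 0 w = fun=> cos w by apply/funext => x; rewrite wave0.
    by rewrite w0 mean_cst; under eq_fun do rewrite mulrC; rewrite meanZ// mulrC subrr.
move=> t.
have bgt := bmeas_shift t bg.
have : mean (fun x => (g (x + t) - g x) ^+ 2) = 0.
  have -> : (fun x => (g (x + t) - g x) ^+ 2) = (fun x => (g (x + t) ^+ 2 + g x ^+ 2) - 2 * (g (x + t) * g x)).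
    by apply/funext => x; ring.
  rewrite meanB; [|by apply: bmeasD; exact: bmeasX|exact: bmeasZ].
  rewrite meanD; [|exact: bmeasX|exact: bmeasX].
  rewrite meanZ// -/(C t) (@mean_shift R t (fun x => g x ^+ 2)); [|exact: bmeasX|by move=> x; rewrite pg].
  have -> : mean (fun x => g x ^+ 2) = C 0.
    by congr mean; apply/funext => x; rewrite addr0 expr2.
  by rewrite (Cc t) (Cc 0); ring.
move=> /mean_eq0_ae.
have b2 : bmeas (fun x => (g (x + t) - g x) ^+ 2) by apply: bmeasX; exact: bmeasB.
move=> /(_ b2 (fun x => sqr_ge0 _)).
by apply: circle_aeS => x /eqP; rewrite sqrf_eq0 subr_eq0 => /eqP.
Qed.

(* cos(la S_t) is the scalar product of g and g(. + t al), and translation is continuous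
   in mean. *)
Lemma unit_cocycle_mean_cos R (al la : R) (f g1 g2 : R -> R) :
  continuous f -> periodic1 f ->
  bmeas g1 -> bmeas g2 -> periodic1 g1 -> periodic1 g2 ->
  (forall x, `|g1 x| <= 1) -> (forall x, `|g2 x| <= 1) ->
  {ae circle_measure R, forall x, g1 x ^+ 2 + g2 x ^+ 2 = 1} ->
  {ae circle_measure R, forall x,
     g1 (x + al) = cos (la * f x) * g1 x - sin (la * f x) * g2 x /\
     g2 (x + al) = sin (la * f x) * g1 x + cos (la * f x) * g2 x} ->
  forall e, 0 < e -> exists2 d, 0 < d & forall (t : nat) (j : int), `|t%:R * al - j%:~R| <= d ->
    1 - e < mean (fun x => cos (la * birkhoff_sum al f (Posz t) x)).
Proof.
move=> cf pf b1 b2 p1 p2 n1 n2 unit coc e e0.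
have [mf _] := periodic_bmeas cf pf.
have iter t : {ae circle_measure R, forall x,
     g1 (x + t%:R * al) = cos (la * birkhoff_sum al f (Posz t) x) * g1 x - sin (la * birkhoff_sum al f (Posz t) x) * g2 x /\
     g2 (x + t%:R * al) = sin (la * birkhoff_sum al f (Posz t) x) * g1 x + cos (la * birkhoff_sum al f (Posz t) x) * g2 x}.
  elim: t => [|t ih].
    apply: circle_ae_interval => x _.
    by rewrite mul0r addr0 /= big_geq// mulr0 sin0 cos0 !mul1r !mul0r subr0 add0r.
  have := circle_ae_shift (t%:R * al) _ coc => /(_ _)/circle_ae_and -/(_ _ _ ih).
  move=> h; apply: circle_aeS (h _) => [x [[h1 h2] [h3 h4]]|x]; last by rewrite addrAC !p1 !p2 !pf.
  have SE : la * birkhoff_sum al f (Posz t.+1) x = la * birkhoff_sum al f (Posz t) x + la * f (x + t%:R * al).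
    by rewrite /= big_nat_recr//= mulrDr.
  rewrite SE -natr1 (mulrDl t%:R) mul1r addrA h1 h2 h3 h4 cosD sinD.
  by split; ring.
have e2 : 0 < e / 2 by rewrite divr_gt0.
have [d1 d10 hd1] := mean_translate_cont b1 p1 e2.
have [d2 d20 hd2] := mean_translate_cont b2 p2 e2.
exists (Num.min d1 d2 / 2); first by rewrite divr_gt0// lt_min d10.
move=> t j tj.
have md : 0 < Num.min d1 d2 by rewrite lt_min d10.
have : `|t%:R * al - j%:~R| < Num.min d1 d2 by apply: (le_lt_trans tj); lra.
rewrite lt_min => /andP[/hd1 m1 /hd2 m2].
set th := _ - _ in m1 m2.
have bS : bmeas (birkhoff_sum al f (Posz t)).
  by apply: bmeas_sum => i; apply: bmeas_shift; exact: periodic_bmeas.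
have bc : bmeas (fun x => cos (la * birkhoff_sum al f (Posz t) x)).
  apply: (@bmeas_comp R (fun x => la * birkhoff_sum al f (Posz t) x) _ 1); [exact: continuous_cos|exact: cos_max|].
  by have [] := bmeasZ la bS.
have bt1 : bmeas (fun x => `|g1 (x + th) - g1 x|) by apply: bmeas_norm; apply: bmeasB => //; exact: bmeas_shift.
have bt2 : bmeas (fun x => `|g2 (x + th) - g2 x|) by apply: bmeas_norm; apply: bmeasB => //; exact: bmeas_shift.
have bgg : bmeas (fun x => (g1 (x + th) - g1 x) * g1 x + (g2 (x + th) - g2 x) * g2 x).
  by apply: bmeasD; apply: bmeasM => //; apply: bmeasB => //; exact: bmeas_shift.
have -> : mean (fun x => cos (la * birkhoff_sum al f (Posz t) x)) =
    mean (fun x => 1 + ((g1 (x + th) - g1 x) * g1 x + (g2 (x + th) - g2 x) * g2 x)).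
  apply: mean_ae_eq; first by case: bc.
    by have [] := bmeasD (bmeas_cst 1) bgg.
  apply: circle_aeS (circle_ae_and unit (iter t)) => x [u [h1 h2]].
  have pth (g : R -> R) : periodic1 g -> g (x + th) = g (x + t%:R * al).
    by move=> pg; rewrite /th addrA -mulrNz periodic1_int.
  rewrite !pth// h1 h2.
  set c := cos _; set s := sin _.
  rewrite (_ : 1 + _ = 1 + c * (g1 x ^+ 2 + g2 x ^+ 2) - (g1 x ^+ 2 + g2 x ^+ 2)); last by ring.
  by rewrite u; ring.
rewrite meanD ?mean_cst//; last exact: bmeas_cst.
suff : `|mean (fun x => (g1 (x + th) - g1 x) * g1 x + (g2 (x + th) - g2 x) * g2 x)| < e.
  by rewrite ltr_norml => /andP[]; lra.
apply: (le_lt_trans (le_norm_mean bgg)).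
apply: (@le_lt_trans _ _ (mean (fun x => `|g1 (x + th) - g1 x| + `|g2 (x + th) - g2 x|))).
  apply: le_mean; [exact: bmeas_norm|exact: bmeasD|move=> x].
  by rewrite (le_trans (ler_normD _ _))// !normrM lerD// ler_piMr.
by rewrite meanD//; lra.
Qed.

(** * Coboundaries with square-summable coefficients *)

Lemma nneseries_le R (u : nat -> \bar R) (B : \bar R) : (forall n, 0 <= u n)%E ->
  (forall n, \sum_(0 <= j < n) u j <= B)%E -> (\sum_(0 <= j <oo) u j <= B)%E.
Proof.
move=> u0 uB; apply: lime_le; first by apply: is_cvg_nneseries.
exact: nearW.
Qed.

Lemma sum_half R n : \sum_(0 <= j < n) (2^-1 ^+ j : R) <= 2.
Proof.
suff -> : \sum_(0 <= j < n) (2^-1 ^+ j : R) = 2 - 2 * 2^-1 ^+ n.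
  by rewrite gerBl mulr_ge0// exprn_ge0// invr_ge0.
elim: n => [|n ih]; first by rewrite big_geq// expr0; lra.
by rewrite big_nat_recr//= ih exprS; lra.
Qed.

(* |p| <= (a h + p^2 / (a h)) / 2 with h = 2^-j, summed over j; then take
   a = |y| / 2 for y the sum of the p j. *)
Lemma sqr_sum_le R (p : nat -> R) n :
  (\sum_(0 <= j < n) p j) ^+ 2 <= 2 * \sum_(0 <= j < n) 2 ^+ j * p j ^+ 2.
Proof.
set y := \sum_(_ <= _ < _) _; set T := \sum_(_ <= _ < _) _.
have [->|y0] := eqVneq y 0.
  by rewrite expr0n/= mulr_ge0// sumr_ge0// => j _; rewrite mulr_ge0// ?sqr_ge0// exprn_ge0.
have ny : 0 < `|y| by rewrite normr_gt0.
have step : 4 * `|y| * `|y| <= `|y| ^+ 2 * 2 + 4 * T.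
  apply: (@le_trans _ _ (\sum_(0 <= j < n) (`|y| ^+ 2 * 2^-1 ^+ j + 4 * (2 ^+ j * p j ^+ 2)))).
    rewrite {2}/y (le_trans (ler_wpM2l _ (ler_norm_sum _ _ _)))// ?mulr_ge0//.
    rewrite mulr_sumr ler_sum// => j _.
    have h0 : 0 < 2 ^+ j :> R by rewrite exprn_gt0.
    rewrite exprVn -(real_normK (num_real (p j))) -subr_ge0.
    suff -> : `|y| ^+ 2 / 2 ^+ j + 4 * (2 ^+ j * `|p j| ^+ 2) - 4 * `|y| * `|p j| =
        (`|y| - 2 * 2 ^+ j * `|p j|) ^+ 2 / 2 ^+ j by rewrite divr_ge0 ?sqr_ge0// ltW.
    by field; rewrite gt_eqF.
  rewrite big_split/= -!mulr_sumr lerD2r ler_wpM2l// ?sqr_ge0//; exact: sum_half.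
rewrite -(real_normK (num_real y)); move: step; rewrite expr2; lra.
Qed.

(** The same splitting |p| <= (h + p^2 / h) / 2 with h = 2^-j, now used for absolute convergence. *)
Lemma sum_norm_le R (p : nat -> R) n :
  \sum_(0 <= j < n) `|p j| <= 1 + (\sum_(0 <= j < n) 2 ^+ j * p j ^+ 2) / 2.
Proof.
apply: (@le_trans _ _ (\sum_(0 <= j < n) (2^-1 * 2^-1 ^+ j + 2^-1 * (2 ^+ j * p j ^+ 2)))).
  rewrite ler_sum// => j _.
  have h0 : 0 < 2 ^+ j :> R by rewrite exprn_gt0.
  rewrite exprVn -(real_normK (num_real (p j))) -subr_ge0.
  suff -> : 2^-1 * (2 ^+ j)^-1 + 2^-1 * (2 ^+ j * `|p j| ^+ 2) - `|p j| =
      (1 - 2 ^+ j * `|p j|) ^+ 2 / (2 * 2 ^+ j) by rewrite divr_ge0 ?sqr_ge0// mulr_ge0// ltW.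
  by field; rewrite gt_eqF.
rewrite big_split/= -!mulr_sumr; have := @sum_half R n; lra.
Qed.

(** The weighted sum S of the 2^j P_j^2 has integral at most the sum of the 2^-j, hence at most 2.
    Where S is finite the series converges absolutely and the square of its sum is at most 2 S. *)
Lemma fast_L2_series R (P : nat -> R -> R) : (forall j, bmeas (P j)) ->
  (forall j, periodic1 (P j)) -> (forall j, mean (fun x => P j x ^+ 2) <= 4^-1 ^+ j) ->
  exists psi : R -> R, [/\ measurable_fun setT psi, periodic1 psi,
    (\int[circle_measure R]_x (psi x ^+ 2)%:E < +oo)%E &
    {ae circle_measure R, forall x, series (fun j => P j x) @ \oo --> psi x}].
Proof.
move=> bP pP mP.
pose q j (x : R) := 2 ^+ j * P j x ^+ 2.
have q0 j x : 0 <= q j x by rewrite /q mulr_ge0 ?sqr_ge0// exprn_ge0.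
have bq j : bmeas (q j) by apply: bmeasZ; exact: bmeasX.
pose S (x : R) : \bar R := (\sum_(0 <= j <oo) (q j x)%:E)%E.
have mq j : measurable_fun setT (fun x : R => (q j x)%:E) by apply/measurable_EFinP; case: (bq j).
have mS : measurable_fun setT S.
  by apply: ge0_emeasurable_sum => // j x _ _; rewrite lee_fin.
have S0 x : (0 <= S x)%E by apply: nneseries_ge0 => j _ _; rewrite lee_fin.
have SB : (\int[circle_measure R]_x S x <= 2%:E)%E.
  rewrite /S integral_nneseries//; last by move=> j x _; rewrite lee_fin.
  apply: nneseries_le => [j|n]; first by apply: integral_ge0 => x _; rewrite lee_fin.
  apply: (@le_trans _ _ (\sum_(0 <= j < n) (2^-1 ^+ j)%:E)%E); last first.
    by rewrite sumEFin lee_fin sum_half.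
  apply: lee_sum => j _.
  rewrite -(@fineK _ (\int[circle_measure R]_x (q j x)%:E)%E); last first.
    exact: integrable_fin_num (bmeas_integrable measurableT (bq j)).
  have -> : fine (\int[circle_measure R]_x (q j x)%:E)%E = 2 ^+ j * mean (fun x => P j x ^+ 2).
    by rewrite -meanZ//; exact: bmeasX.
  rewrite lee_fin.
  rewrite (le_trans (ler_wpM2l _ (mP j)))// ?exprn_ge0//.
  rewrite -exprMn_comm; last by rewrite /GRing.comm mulrC.
  by rewrite (_ : 2 * 4^-1 = 2^-1)//; lra.
have Sfin : {ae circle_measure R, forall x, S x \is a fin_num}.
  have /integrable_ae : (circle_measure R).-integrable setT S.
    apply/integrableP; split=> //.
    under eq_integral do rewrite gee0_abs//.
    by rewrite (le_lt_trans SB)// ltry.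
  by move=> /(_ measurableT); apply: circle_aeS => x; apply.
(* Cutting P j off where S is infinite makes the series converge everywhere, so that psi is
   measurable and periodic without exceptional points. *)
pose Q j (x : R) := P j x * \1_[set x | S x \is a fin_num] x.
have mD : measurable [set x : R | S x \is a fin_num].
  by rewrite -[X in measurable X]setTI; exact: emeasurable_fin_num.
have mQ j : measurable_fun setT (Q j).
  by apply: measurable_funM; [case: (bP j)|exact: measurable_indic].
have qS n x : S x \is a fin_num -> \sum_(0 <= j < n) q j x <= fine (S x).
  move=> fx; rewrite -lee_fin fineK// -sumEFin.
  by apply: nneseries_lim_ge => j _ _; rewrite lee_fin.
have cQ x : cvgn (series (fun j => Q j x)).
  rewrite /Q indicE; have [xD|xD] := boolP (x \in _); last first.
    rewrite (_ : (fun j => _) = cst 0); last by apply/funext => j; rewrite mulr0.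
    apply: (@is_cvg_series_cond_0 R) || (rewrite (_ : series _ = cst 0); first exact: is_cvg_cst).
    by apply/funext => n; rewrite /series/= big1.
  move: xD; rewrite inE/= => fx.
  under [X in series X]eq_fun do rewrite mulr1.
  apply: normed_cvg.
  have -> : [normed series (fun j => P j x)] = (fun n => \sum_(0 <= j < n) `|P j x|) by [].
  apply: nondecreasing_is_cvgn.
    by apply/nondecreasing_seqP => n; rewrite big_nat_recr//= lerDl.
  exists (1 + fine (S x) / 2) => _ [n _ <-].
  by rewrite (le_trans (sum_norm_le _ _))// lerD2l ler_pM2r// qS.
pose psi (x : R) := limn (series (fun j => Q j x)).
have Qpsi x : series (fun j => Q j x) @ \oo --> psi x by exact: cQ.
have pS x : S (x + 1) = S x by rewrite /S/q; under eq_eseriesr do rewrite pP.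
have psiS x : ((psi x ^+ 2)%:E <= 2%:E * S x)%E.
  have [xD|xD] := boolP (x \in [set x | S x \is a fin_num]); last first.
    rewrite (_ : psi x = 0) ?expr0n/= ?mule_ge0//.
    rewrite /psi /Q indicE (negbTE xD) (_ : series _ = cst 0) ?lim_cst//.
    by apply/funext => n; rewrite /series/= big1// => j _; rewrite mulr0.
  move: (xD); rewrite inE/= => fx.
  rewrite -(fineK fx) -EFinM lee_fin.
  have : (fun n => (series (fun j => Q j x) n) ^+ 2) @ \oo --> psi x ^+ 2.
    rewrite expr2; under eq_fun do rewrite expr2; exact: cvgM.
  move=> /cvg_lim <-//; apply: limr_le.
    by apply: cvgP; under eq_fun do rewrite expr2; apply: cvgM; exact: Qpsi.
  apply: nearW => n; rewrite /series/= (le_trans (sqr_sum_le _ _))// ler_pM2l//.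
  rewrite (le_trans _ (qS n x fx))// ler_sum// => j _.
  by rewrite /Q indicE xD mulr1.
exists psi; split.
- apply: (@measurable_fun_cvg _ _ _ _ (fun n x => series (fun j => Q j x) n)) => [n|x _]; last exact: Qpsi.
  by rewrite /series/=; apply: measurable_sum => j; exact: mQ.
- move=> x; rewrite /psi; congr (limn (series _)); apply/funext => j.
  by rewrite /Q pP !indicE; congr (_ * (nat_of_bool _)%:R); apply/idP/idP; rewrite !inE/= pS.
- apply: (@le_lt_trans _ _ (\int[circle_measure R]_x (2%:E * S x))%E).
    apply: ge0_le_integral => //.
    + by move=> x _; rewrite lee_fin sqr_ge0.
    + apply/measurable_EFinP; apply: measurable_funX.
      apply: (@measurable_fun_cvg _ _ _ _ (fun n x => series (fun j => Q j x) n)) => [n|x _]; last exact: Qpsi.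
      by rewrite /series/=; apply: measurable_sum => j; exact: mQ.
    + exact: measurable_funeM.
  rewrite ge0_integralZl//.
  by rewrite (le_lt_trans (lee_wpmul2l _ SB))// -EFinM ltry.
- apply: circle_aeS Sfin => x fx.
  rewrite (_ : (fun j => P j x) = (fun j => Q j x)); first exact: Qpsi.
  by apply/funext => j; rewrite /Q indicE mem_set// mulr1.
Qed.

Lemma mean_sqr_waves R (d w : nat -> R) n m : (0 < n)%N ->
  mean (fun x => (\sum_(n <= k < m) d k * wave k (w k) x) ^+ 2) = (\sum_(n <= k < m) d k ^+ 2) / 2.
Proof.
move=> n0; elim: m => [|m ih].
  rewrite big_geq// mul0r -[RHS](@mean_cst R); congr mean; apply/funext => x.
  by rewrite big_geq// expr0n.
have [nm|mn] := leqP n m; last first.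
  rewrite big_geq// mul0r -[RHS](@mean_cst R); congr mean; apply/funext => x.
  by rewrite big_geq// expr0n.
have m0 : (0 < m)%N by exact: leq_trans nm.
have bw k v : bmeas (@wave R k v) by exact: bmeas_wave.
pose s (x : R) := \sum_(n <= k < m) d k * wave k (w k) x.
have bs : bmeas s by apply: bmeas_sum => k; exact: bmeasZ.
have cross : mean (fun x => s x * wave m (w m) x) = 0.
  rewrite (_ : (fun x => _) =
      fun x => \sum_(n <= k < m) d k * (wave k (w k) x * wave m (w m) x)); last first.
    by apply/funext => x; rewrite /s mulr_suml; apply: eq_bigr => k _; rewrite mulrA.
  rewrite mean_sum; last by move=> k; apply: bmeasZ; exact: bmeasM.
  rewrite big_nat big1// => k /andP[nk km].
  rewrite meanZ; last exact: bmeasM.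
  by rewrite mean_waveM ?(leq_trans n0)// gtn_eqF// mulr0.
rewrite big_nat_recr//= mulrDl -ih.
rewrite (_ : (fun x => (\sum_(n <= k < m.+1) _) ^+ 2) = fun x => s x ^+ 2 +
    ((2 * d m) * (s x * wave m (w m) x) + d m ^+ 2 * (wave m (w m) x * wave m (w m) x))); last first.
  by apply/funext => x; rewrite big_nat_recr//= -/(s x); ring.
rewrite meanD; [|exact: bmeasX|by apply: bmeasD; apply: bmeasZ; exact: bmeasM].
rewrite meanD; [|by apply: bmeasZ; exact: bmeasM..].
rewrite !meanZ; [|exact: bmeasM..].
by rewrite cross mean_waveM// eqxx subrr cos0; congr (_ + _); field.
Qed.

(** N is a running maximum of the indices given by convergence, which makes it monotone; j < N j
    makes it tend to infinity. *)
Lemma bounded_sums_fast_subsequence R (s : nat -> R) (B : R) :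
  nondecreasing_seq s -> (forall n, s n <= B) ->
  exists N : nat -> nat, [/\ forall j, (j < N j)%N, forall j, (N j <= N j.+1)%N &
    forall j, s (N j.+1) - s (N j) <= 4^-1 ^+ j].
Proof.
move=> ns sB.
have cs : cvgn s by apply: nondecreasing_is_cvgn => //; exists B => _ [n _ <-].
have sL n : s n <= limn s by exact: nondecreasing_cvgn_le.
have ex j : exists n, (j < n)%N /\ limn s - s n <= 4^-1 ^+ j.
  have p4 : 0 < 4^-1 ^+ j :> R by rewrite exprn_gt0// invr_gt0.
  have /cvgrPdist_le/(_ _ p4)[n _ nP] := cs.
  exists (maxn n j.+1); split; first by rewrite leq_max ltnSn orbT.
  by have := nP (maxn n j.+1) (leq_maxl _ _); exact: (le_trans (ler_norm _)).
have [n nP] := choice ex.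
pose N j := \max_(i < j.+1) n i.
have nN j : (n j <= N j)%N by exact: (leq_bigmax (@ord_max j)).
have NN j : (N j <= N j.+1)%N by rewrite [leqRHS]/N big_ord_recr/= leq_maxl.
exists N; split => // j; first exact: leq_trans (nP j).1 (nN j).
rewrite (le_trans _ (nP j).2)// lerB//; exact: ns.
Qed.

(** The shift by pi / 2 turns the cosines into sines, and sin(th + b) - sin(th - b) = 2 sin b cos
    th. *)
Lemma wave_coboundary R k (w al x : R) : let v := w - pi * (k%:R * al) - pi / 2 in
  wave k v (x + al) - wave k v x = 2 * sin (pi * (k%:R * al)) * wave k w x.
Proof.
move=> v; rewrite /wave.
set th := 2 * pi * k%:R * x + w; set b := pi * (k%:R * al).
have -> : 2 * pi * k%:R * (x + al) + v = th + b - pi / 2 by rewrite /v/th/b; ring.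
have -> : 2 * pi * k%:R * x + v = th - b - pi / 2 by rewrite /v/th/b; ring.
have cosp y : cos (y - pi / 2) = sin y :> R.
  by rewrite cosB cos_pihalf sin_pihalf mulr0 add0r mulr1.
by rewrite !cosp sinB sinD; ring.
Qed.

(** Along a subsequence whose increments have mean square at most 4^-j, the partial sums u of the
    formal transfer function converge almost everywhere, and u n (x + alpha) - u n x, a partial
    Fourier sum of f - mean f, passes to the limit. *)
Lemma suspension_of_bounded_transfer R (f : R -> R) (r om : nat -> R) (C al B : R) :
  irrational al -> periodic1 f -> 0 < mean f -> 0 <= C ->
  (forall n x, (0 < n)%N ->
    `|f x - mean f - \sum_(1 <= k < n) r k * wave k (om k) x| <= C / n%:R) ->
  (forall n, \sum_(1 <= k < n) (r k / (2 * sin (pi * (k%:R * al)))) ^+ 2 <= B) ->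
  L2_conjugate_to_suspension al f.
Proof.
move=> ial pf f0 C0 fs sB.
pose d k := r k / (2 * sin (pi * (k%:R * al))).
pose v k := om k - pi * (k%:R * al) - pi / 2.
pose u n (x : R) := \sum_(1 <= k < n) d k * wave k (v k) x.
have bw k w : bmeas (@wave R k w) by exact: bmeas_wave.
have bu n : bmeas (u n) by apply: bmeas_sum => k; exact: bmeasZ.
have pu n : periodic1 (u n).
  by move=> x; rewrite /u; apply: eq_bigr => k _; rewrite wave_periodic.
have uE n x : u n (x + al) - u n x = \sum_(1 <= k < n) r k * wave k (om k) x.
  rewrite /u -sumrB big_nat [RHS]big_nat; apply: eq_bigr => k /andP[k0 _].
  rewrite -mulrBr wave_coboundary [LHS]mulrA; congr (_ * _).
  by rewrite /d mulfVK// mulf_neq0// sin_int_neq0.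
have [|N [jN NN sN]] := bounded_sums_fast_subsequence _ sB.
  apply/nondecreasing_seqP => -[|n]; first by rewrite !big_geq.
  by rewrite [leRHS]big_nat_recr//= lerDl sqr_ge0.
have N0 j : (0 < N j)%N by exact: leq_ltn_trans (jN j).
pose P j (x : R) := u (N j.+1) x - u (N j) x.
have [j|j x|j|psi [mpsi ppsi ipsi cpsi]] := @fast_L2_series R P.
- exact: bmeasB.
- by rewrite /P !pu.
- rewrite (_ : (fun x => _) = fun x => (\sum_(N j <= k < N j.+1) d k * wave k (v k) x) ^+ 2); last first.
    apply/funext => x; congr (_ ^+ 2); rewrite /P/u.
    rewrite (big_cat_nat (N0 j) (NN j))/=.
    by rewrite [X in X - _]addrC addrK.
  rewrite mean_sqr_waves//; have := sN j.
  rewrite (big_cat_nat (N0 j) (NN j))/= [X in X - _]addrC addrK.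
  rewrite -/d => h; rewrite (le_trans _ h)// ler_pdivrMr// ler_peMr ?ler1n//.
  by apply: sumr_ge0 => k _; exact: sqr_ge0.
have cu : {ae circle_measure R, forall x, (fun n => u (N n) x) @ \oo --> u (N 0) x + psi x}.
  apply: circle_aeS cpsi => x cx.
  rewrite (_ : (fun n => _) = (fun n => u (N 0) x + series (fun j => P j x) n)).
    by apply: cvgD => //; exact: cvg_cst.
  by apply/funext => n; rewrite /series/= telescope_sumr// addrC subrK.
pose psi' (x : R) := u (N 0) x + psi x.
(* Convergence is needed at x and at x + alpha simultaneously; periodicity allows the set of good
   points to be translated. *)
have pcu : periodic1 (fun x => (fun n => u (N n) x) @ \oo --> psi' x).
  move=> x; rewrite /psi' pu ppsi.
  by rewrite (_ : (fun n => u (N n) (x + 1)) = fun n => u (N n) x)//; apply/funext => n; rewrite pu.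
exists (mean f), psi'; split=> //.
- by move=> x; rewrite /psi' pu ppsi.
- have mpsi' : measurable_fun setT psi' by apply: measurable_funD => //; case: (bu (N 0)).
  rewrite inE; apply/andP; split; rewrite inE//=.
  rewrite /finite_norm unlock poweR_lty//.
  under eq_integral do rewrite /= powR_mulrn// real_normK ?num_real//.
  apply: (@le_lt_trans _ _ (\int[circle_measure R]_x ((2 * u (N 0) x ^+ 2)%:E + 2%:E * (psi x ^+ 2)%:E))%E).
    apply: ge0_le_integral => //.
    + by move=> x _; rewrite lee_fin sqr_ge0.
    + by apply/measurable_EFinP; exact: measurable_funX.
    + apply: emeasurable_funD; first by apply/measurable_EFinP; case: (bmeasZ 2 (bmeasX 2 (bu (N 0)))).
      by apply: measurable_funeM; apply/measurable_EFinP; exact: measurable_funX.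
    + move=> x _; rewrite /= -EFinM -EFinD lee_fin /psi'.
      have := sqr_ge0 (u (N 0) x - psi x); nra.
  rewrite ge0_integralD//; first last.
  + by apply: measurable_funeM; apply/measurable_EFinP; exact: measurable_funX.
  + by move=> x _; rewrite mule_ge0// lee_fin sqr_ge0.
  + by apply/measurable_EFinP; case: (bmeasZ 2 (bmeasX 2 (bu (N 0)))).
  + by move=> x _; rewrite lee_fin mulr_ge0// sqr_ge0.
  rewrite ge0_integralZl//; last 2 first.
  + by apply/measurable_EFinP; exact: measurable_funX.
  + by move=> x _; rewrite lee_fin sqr_ge0.
  apply: lte_add_pinfty; last by rewrite lte_mul_pinfty.
  have bi := bmeasZ 2 (bmeasX 2 (bu (N 0))).
  exact: integrable_lty (bmeas_integrable measurableT bi).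
- have := circle_ae_and cu (circle_ae_shift al pcu cu).
  apply: circle_aeS => x [c1 c2].
  have c3 : (fun n => u (N n) (x + al) - u (N n) x) @ \oo --> psi' (x + al) - psi' x by exact: cvgB.
  have c4 : (fun n => u (N n) (x + al) - u (N n) x) @ \oo --> f x - mean f.
    apply/cvgrPdist_le => e e0.
    have [n n0 nP] := exists_div_lt C 0 e0.
    exists n => // m /= nm; rewrite uE (le_trans (fs _ _ (N0 m)))//.
    rewrite (le_trans _ (ltW nP))// ler_wpM2l// lef_pV2 ?posrE ?ltr0n// ler_nat.
    by rewrite ltnW// (leq_ltn_trans nm).
  by rewrite -(cvg_lim _ c3)// (cvg_lim _ c4).
Qed.

(** * From the special flow to a cocycle over the rotation *)

Lemma periodic_min_gt0 R (f : R -> R) : continuous f -> periodic1 f ->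
  (forall x, 0 < f x) -> exists2 k, 0 < k & forall x, k <= f x.
Proof.
move=> cf pf f0.
have [c _ cP] := @EVT_min R f 0 1 ler01 (continuous_subspaceT cf).
exists (f c) => // x; rewrite -(circle_projE x pf); apply: cP.
by have /andP[a b] := circle_proj_itv x; rewrite in_itv/= a ltW.
Qed.

Lemma birkhoff_sumS R (al : R) (f : R -> R) (n : int) x :
  birkhoff_sum al f (n + 1) x = birkhoff_sum al f n x + f (x + n%:~R * al).
Proof.
case: n => [k|k].
  rewrite (_ : Posz k + 1 = Posz k.+1); last by rewrite -addn1 PoszD.
  by rewrite /birkhoff_sum big_nat_recr.
have -> : Negz k + 1 = - Posz k by rewrite NegzE -addn1 PoszD opprD subrK.
rewrite /birkhoff_sum [X in - X + _](big_nat_recr k.+1)//= opprD.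
rewrite NegzE mulrNz mulNr.
rewrite (_ : (k.+1%:Z)%:~R = k.+1%:R :> R)// subrK.
by case: k => [|k] //=; rewrite !big_geq// oppr0.
Qed.

Lemma birkhoff_sum_lt R (al : R) (f : R -> R) (n m : int) x : (forall x, 0 < f x) ->
  n < m -> birkhoff_sum al f n x < birkhoff_sum al f m x.
Proof.
move=> f0 nm.
have -> : m = n + (absz (m - n)).-1%:Z + 1.
  have h : 0 < m - n by rewrite subr_gt0.
  rewrite -addrA -PoszD addn1 prednK ?absz_gt0 ?gt_eqF//.
  by rewrite gez0_abs ?ltW// addrC subrK.
elim: (absz (m - n)).-1 => [|k ih]; first by rewrite addr0 birkhoff_sumS ltrDl.
by rewrite (lt_trans ih)// -addn1 PoszD addrA [ltRHS]birkhoff_sumS ltrDl.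
Qed.

(** Birkhoff sums increase strictly in n since f > 0, so at most one n qualifies and the choice
    operator must return it. *)
Lemma special_flowE R (al : R) (f : R -> R) (n : int) t (z : R * R) :
  (forall x, 0 < f x) ->
  birkhoff_sum al f n z.1 <= z.2 + t < birkhoff_sum al f (n + 1) z.1 ->
  special_flow al f t z = (circle_proj (z.1 + n%:~R * al), z.2 + t - birkhoff_sum al f n z.1).
Proof.
move=> f0 hn; rewrite /special_flow (xget_subset1 _ (x := n))// => a b /= /andP[a1 a2] /andP[b1 b2].
have mono (i j : int) : i < j -> birkhoff_sum al f (i + 1) z.1 <= birkhoff_sum al f j z.1.
  rewrite -lezD1 le_eqVlt => /predU1P[->//|ij]; exact/ltW/birkhoff_sum_lt.
have [ab|ba|//] := ltgtP a b.
  by have := lt_le_trans (le_lt_trans b1 a2) (mono _ _ ab); rewrite ltxx.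
by have := lt_le_trans (le_lt_trans a1 b2) (mono _ _ ba); rewrite ltxx.
Qed.

Lemma circle_proj_id R (x : R) : 0 <= x < 1 -> circle_proj x = x.
Proof.
move=> x01; rewrite /circle_proj (_ : Num.floor x = 0) ?subr0//.
exact: floor_def.
Qed.

Lemma birkhoff_sum0 R (al : R) (f : R -> R) x : birkhoff_sum al f 0 x = 0.
Proof. by rewrite /birkhoff_sum/= big_geq. Qed.

Lemma birkhoff_sum1 R (al : R) (f : R -> R) x : birkhoff_sum al f 1 x = f x.
Proof. by rewrite (birkhoff_sumS al f 0) birkhoff_sum0 add0r mul0r addr0. Qed.

Lemma special_flow_below R (al : R) (f : R -> R) t x s : (forall x, 0 < f x) ->
  0 <= x < 1 -> 0 <= s + t < f x -> special_flow al f t (x, s) = (x, s + t).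
Proof.
move=> f0 x01 st; rewrite (@special_flowE _ _ _ 0) ?birkhoff_sum0 ?add0r ?birkhoff_sum1//.
by rewrite mul0r addr0 circle_proj_id// subr0.
Qed.

Lemma special_flow_above R (al : R) (f : R -> R) t x s : (forall x, 0 < f x) ->
  f x <= s + t < f x + f (x + al) ->
  special_flow al f t (x, s) = (circle_proj (x + al), s + t - f x).
Proof.
move=> f0 st.
by rewrite (@special_flowE _ _ _ 1) ?birkhoff_sumS ?birkhoff_sum1 ?mul1r.
Qed.

(** * Measurability and null sets of the phase space *)

Lemma measurable_true d (T : measurableType d) (b : T -> bool) :
  measurable_fun setT b -> measurable [set z | b z].
Proof. by move=> mb; rewrite -[X in measurable X]setTI; exact: mb. Qed.

Lemma measurable_special_space R (f : R -> R) : measurable_fun setT f ->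
  measurable (special_space f : set (measurableTypeR R * measurableTypeR R)).
Proof.
move=> mf; apply: measurable_true.
apply: measurable_and; apply: measurable_and.
- by apply: measurable_fun_ler.
- by apply: measurable_fun_ltr.
- by apply: measurable_fun_ler.
- by apply: measurable_fun_ltr => //; exact: measurableT_comp.
Qed.

Lemma special_space_fin R (f : R -> R) (k M : R) : measurable_fun setT f -> 0 < k ->
  (forall x, k <= f x) -> (forall x, f x <= M) ->
  (0 < (leb R \x leb R) (special_space f) < +oo)%E.
Proof.
move=> mf k0 kf fM.
have mS := measurable_special_space mf.
apply/andP; split.
  apply: (@lt_le_trans _ _ ((leb R \x leb R) (`[0%R, 1%R[ `*` `[0%R, k[))%E).
    rewrite product_measure1E//= !lebesgue_measure_itv/= !lte_fin ltr01 k0 !oppr0 !addr0 -EFinM.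
    by rewrite mul1r lte_fin.
  apply: le_measure; rewrite ?inE//; first exact: measurableX.
  move=> [x s] /=; rewrite !in_itv/= /special_space/= => -[-> /andP[-> sk]].
  by rewrite (lt_le_trans sk).
apply: (@le_lt_trans _ _ ((leb R \x leb R) (`[0%R, 1%R[ `*` `[0%R, M[))%E).
  apply: le_measure; rewrite ?inE//; first exact: measurableX.
  move=> [x s] /=; rewrite !in_itv/= /special_space/= => /andP[-> /andP[-> sk]].
  by rewrite (lt_le_trans sk).
have M0 : 0 < M by rewrite (lt_le_trans k0)// (le_trans (kf 0)).
rewrite product_measure1E//= !lebesgue_measure_itv/= !lte_fin ltr01 M0 !oppr0 !addr0 -EFinM.
by rewrite ltry.
Qed.

Lemma special_measure_null R (f : R -> R) (k M : R) (A : set (R * R)) :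
  measurable_fun setT f -> 0 < k ->
  (forall x, k <= f x) -> (forall x, f x <= M) ->
  special_measure f A = 0%E <->
  (leb R \x leb R)%E (A `&` special_space f) = 0%E.
Proof.
move=> mf k0 kf fM; have /andP[a b] := special_space_fin mf k0 kf fM.
rewrite /special_measure; split => [/eqP|->]; last by rewrite mule0.
rewrite mule_eq0 => /orP[|/eqP//].
by rewrite eqe invr_eq0 gt_eqF// fine_gt0// a b.
Qed.

(** [special_measure] is a bare set function; this brings its almost everywhere statements back to
    negligible sets of the plane, where Tonelli applies. The bounds k and M keep the total mass
    positive and finite, so normalization does not alter null sets. *)
Lemma special_aeP R (f : R -> R) (k M : R) (P : R * R -> Prop) :
  measurable_fun setT f -> 0 < k ->
  (forall x, k <= f x) -> (forall x, f x <= M) ->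
  {ae special_measure f, forall z, P z} <->
  (leb R \x leb R)%E.-negligible (special_space f `&` ~` [set z | P z]).
Proof.
move=> mf k0 kf fM; have mS := measurable_special_space mf.
split => -[A [mA A0 PA]].
  exists (A `&` special_space f); split; first exact: measurableI.
    exact/(special_measure_null _ mf k0 kf fM).
  by move=> z [zS nP]; split => //; exact: PA.
exists (A `|` ~` special_space f); split.
- by apply: measurableU => //; exact: measurableC.
- apply/(special_measure_null _ mf k0 kf fM).
  rewrite setIUl setICl setU0; apply/eqP; rewrite eq_le measure_ge0 andbT -A0.
  by apply: le_measure; rewrite ?inE//; exact: measurableI.
- move=> z nP; case: (pselect (special_space f z)) => zS; [left|by right].
  by apply: PA; split.
Qed.

(* The library's sigma-finite instance on product measures is shadowed by the one
   for subprobabilities, so Lebesgue measure on the plane is packaged by hand. *)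
Definition plane_measure R :
  set (measurableTypeR R * measurableTypeR R)%type -> \bar R :=
  (leb R \x leb R)%E.

HB.instance Definition _ (R : realType) := Measure.on (@plane_measure R).

Lemma plane_measure_sigma_finite R : sigma_finite setT (@plane_measure R).
Proof.
exists (fun n : nat => `[- n%:R, n%:R]%classic `*` `[- n%:R, n%:R]%classic : set (R * R)).
  apply/seteqP; split => // -[x y] _; exists (Num.bound (`|x| + `|y|)) => //=.
  have := archi_boundP (addr_ge0 (normr_ge0 x) (normr_ge0 y)); set n := _%:R => h.
  rewrite !in_itv/= -!ler_norml; split; apply/ltW; apply: le_lt_trans h.
    by rewrite lerDl.
  by rewrite lerDr.
move=> n; split; first exact: measurableX.
rewrite /plane_measure product_measure1E//= !lebesgue_measure_itv/=.
by case: ifP => _; rewrite ?mule0 ?ltry// -EFinM ltry.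
Qed.

HB.instance Definition _ (R : realType) :=
  Measure_isSigmaFinite.Build _ _ _ (@plane_measure R) (@plane_measure_sigma_finite R).

(** Tonelli on phase space times time: if the slice at every time is null, then on almost every
    fibre almost every starting height has a null set of bad times. *)
Lemma triple_sections R
  (E : set (measurableTypeR R * measurableTypeR R * measurableTypeR R)) : measurable E ->
  (forall t, plane_measure (ysection E t) = 0%E) ->
  {ae leb R, forall x, {ae leb R, forall s,
    leb R (xsection E (x, s)) = 0%E}}.
Proof.
move=> mE E0.
have [N [mN N0 EN]] := @null_sections _ _ _ _ _ (@plane_measure R) (leb R) E mE E0.
have := null_prod_sections mN N0.
apply: filterS => x xN.
exists (xsection N x); split => //; first exact: measurable_xsection.
by move=> s /= sE; rewrite /xsection/= inE; exact: EN.
Qed.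

(** Multiplication by exp(i a) on pairs of real and imaginary part. *)
Definition rot R (a : R) (p : R * R) : R * R :=
  (cos a * p.1 - sin a * p.2, sin a * p.1 + cos a * p.2).

Lemma rotD R (a b : R) (p : R * R) : rot a (rot b p) = rot (a + b) p.
Proof. by rewrite /rot cosD sinD/=; congr (_, _); ring. Qed.

Lemma rot0 R (p : R * R) : rot 0 p = p.
Proof. by case: p => a b; rewrite /rot cos0 sin0/=; congr (_, _); ring. Qed.

Lemma rot_sqr R (a : R) (p : R * R) :
  (rot a p).1 ^+ 2 + (rot a p).2 ^+ 2 = p.1 ^+ 2 + p.2 ^+ 2.
Proof. by have := cos2Dsin2 a => h; rewrite /rot/= -[RHS]mul1r -h; ring. Qed.

Lemma measurable_rot R d (T : measurableType d) (a : T -> R) (p : T -> R * R) :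
  measurable_fun setT a -> measurable_fun setT p -> measurable_fun setT (fun z => rot (a z) (p z)).
Proof.
move=> ma mp.
have m1 : measurable_fun setT (fun z => (p z).1) by apply: measurableT_comp.
have m2 : measurable_fun setT (fun z => (p z).2) by apply: measurableT_comp.
have mc : measurable_fun setT (fun z => cos (a z)).
  by apply: measurableT_comp => //; apply: continuous_measurable_fun; exact: continuous_cos.
have ms : measurable_fun setT (fun z => sin (a z)).
  by apply: measurableT_comp => //; apply: continuous_measurable_fun; exact: continuous_sin.
apply: measurable_fun_pair.
  by apply: measurable_funB; apply: measurable_funM.
by apply: measurable_funD; apply: measurable_funM.
Qed.

Lemma measurable_eq_pair R d (T : measurableType d) (p q : T -> R * R) :
  measurable_fun setT p -> measurable_fun setT q -> measurable [set z | p z <> q z].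
Proof.
move=> mp mq.
have -> : [set z | p z <> q z] = [set z | (p z).1 <> (q z).1] `|` [set z | (p z).2 <> (q z).2].
  apply/seteqP; split => z /=.
    case: (p z) (q z) => a b [c e]/= h.
    by case: (pselect (a = c)) => [ac|]; [right => be; apply: h; rewrite ac be|left].
  by case=> h e; apply: h; rewrite e.
by apply: measurableU; apply: measurable_neq; apply: measurableT_comp.
Qed.

(** G x is the mean of U (x, s) over 0 <= s < k. It is measurable and bounded in any case, and
    equals the fibre constant wherever there is one, so no measurable choice of s has to be made.
    Adding M gives access to Tonelli for nonnegative functions. *)
Lemma section_average R (U : R * R -> R) (k M : R) : measurable_fun setT U ->
  (forall z, `|U z| <= M) -> 0 < k ->
  exists G : R -> R, [/\ measurable_fun setT G, forall x, `|G x| <= M &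
    forall x w, (leb R).-negligible [set s | 0 <= s < k /\ U (x, s) <> w] -> G x = w].
Proof.
move=> mU UM k0.
pose F (z : R * R) := (U z + M) * \1_(`[0, k[%classic : set R) z.2.
have mF : measurable_fun setT F.
  apply: measurable_funM; first exact: measurable_funD.
  by apply: measurableT_comp => //; exact: measurable_indic.
have F0 z : 0 <= F z by rewrite mulr_ge0// -lerBlDr sub0r; have := UM z; rewrite ler_norml => /andP[].
pose I x : \bar R := (\int[leb R]_s (F (x, s))%:E)%E.
have mI : measurable_fun setT I.
  apply: (@measurable_fun_fubini_tonelli_F _ _ _ _ _ (leb R) (EFin \o F)) => //.
  exact/measurable_EFinP.
have mFx x : measurable_fun setT (fun s : R => F (x, s)).
  by apply: measurableT_comp => //; exact: measurable_pair1.
have cst w : (\int[leb R]_s (w * \1_(`[0%R, k[%classic : set R) s)%:E)%E = (w * k)%:E.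
  under eq_integral do rewrite EFinM.
  rewrite integralZl//; last first.
    exact: (integrable_indic_itv 0 k true true).
  rewrite integral_indic// setIT.
  transitivity (w%:E * leb R `[0%R, k[)%E => //.
  by rewrite lebesgue_measure_itv/= lte_fin k0 oppr0 addr0 -EFinM.
have M0 : 0 <= M by exact: le_trans (normr_ge0 _) (UM (0, 0)).
have IM x : (0 <= I x <= (M * 2 * k)%:E)%E.
  apply/andP; split; first by apply: integral_ge0 => s _; rewrite lee_fin.
  rewrite -cst.
  apply: ge0_le_integral => //.
  - by move=> s _; rewrite lee_fin.
  - by apply/measurable_EFinP; exact: mFx.
  - by apply/measurable_EFinP; apply: measurable_funM => //; exact: measurable_indic.
  - move=> s _; rewrite lee_fin ler_wpM2r//.
    by have := UM (x, s); rewrite ler_norml => /andP[]; lra.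
exists (fun x => fine (I x) / k - M); split.
- apply: measurable_funB => //; apply: measurable_funM => //.
  exact: measurableT_comp.
- move=> x; have /andP[a b] := IM x.
  have fI : I x \is a fin_num by rewrite ge0_fin_numE// (le_lt_trans b)// ltry.
  move: a b; rewrite -(fineK fI) !lee_fin => a b.
  have h1 : 0 <= fine (I x) / k by rewrite divr_ge0// ltW.
  have h2 : fine (I x) / k <= M * 2 by rewrite ler_pdivrMr.
  by rewrite ler_norml; apply/andP; split; lra.
- move=> x w [A [mA A0 wA]].
  suff -> : I x = ((w + M) * k)%:E by rewrite /= mulfK ?gt_eqF// addrK.
  rewrite -cst; apply: ae_eq_integral => //.
  + by apply/measurable_EFinP; exact: mFx.
  + by apply/measurable_EFinP; apply: measurable_funM => //; exact: measurable_indic.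
  + exists A; split => // s /= h; apply: wA => /=.
    apply: contrapT => h'; apply: h => _; rewrite /F/= indicE.
    have [|_] := boolP (s \in _); last by rewrite !mulr0.
    rewrite inE/= in_itv/= => sk; rewrite !mulr1; congr (_ + _)%:E.
    by apply: contrapT => Uw; apply: h'.
Qed.

Lemma periodic_circle_proj R : periodic1 (@circle_proj R).
Proof.
move=> x; rewrite /circle_proj (@floor_def _ (x + 1) (Num.floor x + 1)); first by rewrite intrD; ring.
by rewrite intrD [in ltRHS]intrD lerD2r ltrD2r floor_itv.
Qed.

Lemma negligible_shift R (a : R) (A : set R) : measurable A ->
  leb R A = 0%E -> (leb R).-negligible [set y | A (y - a)].
Proof.
move=> mA A0; exists (translate (- a) @^-1` A); split => //.
  by rewrite -[X in measurable X]setTI; apply: measurable_translate.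
exact: etrans (esym (lebesgue_measure_translate _ mA)) A0.
Qed.

Lemma lebesgue_ae_pick R (P : R -> Prop) (k : R) : 0 < k ->
  {ae leb R, forall s, P s} -> exists2 s, 0 <= s < k & P s.
Proof.
move=> k0 [A [mA A0 PA]]; apply: contrapT => h.
have : (leb R `[0%R, k[ <= leb R A)%E.
  apply: le_measure; rewrite ?inE// => s /=; rewrite in_itv/= => sk.
  by apply: PA => /= Ps; apply: h; exists s.
by rewrite A0 lebesgue_measure_itv/= lte_fin k0 oppr0 addr0 lee_fin leNgt k0.
Qed.

Lemma lebesgue_ae_circle R (P : R -> Prop) :
  {ae leb R, forall x, 0 <= x < 1 -> P x} <-> {ae circle_measure R, forall x, P x}.
Proof.
rewrite -lebesgue_circle_null.
suff -> : [set x : R | 0 <= x < 1 /\ ~ P x] = ~` [set x : R | 0 <= x < 1 -> P x] by [].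
by apply/seteqP; split => x /= => [[x01 nP] h|/not_implyP//]; exact: nP (h x01).
Qed.

Lemma plane_null_of_sections R (B : set (measurableTypeR R * measurableTypeR R)) :
  measurable B -> {ae leb R, forall x, leb R (xsection B x) = 0%E} ->
  plane_measure B = 0%E.
Proof.
move=> mB B0; rewrite /plane_measure /product_measure1.
rewrite -(integral0 (leb R) setT); apply: ae_eq_integral => //.
  exact: measurable_fun_xsection.
by apply: filterS B0 => x + _.
Qed.

(* Moving along the flow, the derotated eigenfunction is constant on almost every fibre, and
   crossing the roof multiplies that constant by the rotation of angle c f(x). *)
Lemma flow_cocycle R (f : R -> R) (al c M : R) (w : R * R -> R * R) :
  continuous f -> periodic1 f -> (forall x, 0 < f x) -> 0 <= M ->
  measurable_fun setT w -> (forall z, (w z).1 ^+ 2 + (w z).2 ^+ 2 <= M ^+ 2) ->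
  (forall t, {ae special_measure f, forall z, w (special_flow al f t z) = rot (c * t) (w z)}) ->
  exists g : R -> R * R, [/\ measurable_fun setT g /\ periodic1 g,
    forall x, `|(g x).1| <= M /\ `|(g x).2| <= M,
    {ae circle_measure R, forall x, g (x + al) = rot (c * f x) (g x)},
    {ae circle_measure R, forall x, exists z a, g x = rot a (w z)} &
    {ae special_measure f, forall z, w z = rot (c * z.2) (g z.1)}].
Proof.
move=> cf pf f0 M0 mw wM wT.
have [k k0 kf] := periodic_min_gt0 cf pf f0.
have [L fL'] := periodic_bounded cf pf.
have fL x : f x <= L by rewrite (le_trans (ler_norm _)).
have mf : measurable_fun setT f by case: (periodic_bmeas cf pf).
have mOm := measurable_special_space mf.
(* W undoes the rotation acquired while climbing to height s. *)
pose W (z : R * R) := rot (- (c * z.2)) (w z).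
have mW : measurable_fun setT W.
  by apply: measurable_rot => //; apply: measurableT_comp => //; apply: measurable_funM.
have W1 z : `|(W z).1| <= M.
  rewrite -ler_sqr ?nnegrE// real_normK ?num_real// (le_trans _ (wM z))// -(rot_sqr (- (c * z.2)) (w z)).
  by rewrite lerDl sqr_ge0.
have W2 z : `|(W z).2| <= M.
  rewrite -ler_sqr ?nnegrE// real_normK ?num_real// (le_trans _ (wM z))// -(rot_sqr (- (c * z.2)) (w z)).
  by rewrite lerDr sqr_ge0.
have below t x s : 0 <= x < 1 -> 0 <= s + t < f x ->
    w (special_flow al f t (x, s)) = rot (c * t) (w (x, s)) -> W (x, s + t) = W (x, s).
  move=> x01 st; rewrite special_flow_below// /W/= => ->.
  by rewrite rotD; congr rot; ring.
have above t x s : f x <= s + t < f x + k ->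
    w (special_flow al f t (x, s)) = rot (c * t) (w (x, s)) ->
    W (circle_proj (x + al), s + t - f x) = rot (c * f x) (W (x, s)).
  move=> /andP[st1 st2]; rewrite special_flow_above//; last first.
    by rewrite st1 (lt_le_trans st2)// lerD2l.
  by rewrite /W/= => ->; rewrite !rotD; congr rot; ring.
pose X := (measurableTypeR R * measurableTypeR R * measurableTypeR R)%type.
have m1 : measurable_fun setT (fun e : X => e.1.1) by apply: measurableT_comp.
have m2 : measurable_fun setT (fun e : X => e.1.2) by apply: measurableT_comp.
have m3 : measurable_fun setT (fun e : X => e.1.2 + e.2) by apply: measurable_funD.
have mf1 : measurable_fun setT (fun e : X => f e.1.1) by apply: measurableT_comp.
have mfib : measurable_fun setT (fun e : X => (0 <= e.1.1 < 1) && (0 <= e.1.2 < f e.1.1)).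
  apply: measurable_and; apply: measurable_and.
  - exact: measurable_fun_ler.
  - exact: measurable_fun_ltr.
  - exact: measurable_fun_ler.
  - exact: measurable_fun_ltr.
have null (E : set X) : measurable E ->
    (forall e, E e -> special_space f e.1 /\ w (special_flow al f e.2 e.1) <> rot (c * e.2) (w e.1)) ->
    forall t, plane_measure (ysection E t) = 0%E.
  move=> mE hE t; apply/negligibleP; first exact: measurable_ysection.
  have /(special_aeP _ mf k0 kf fL) := wT t.
  apply: negligibleS => z; rewrite /ysection/= inE => /hE[].
  by [].
(* E0 collects the (x, s, t) that stay in one fibre without preserving W; E1 below collects those
   that cross the roof once, land below the lower bound k of the roof and violate the rotation
   rule. *)
pose E0 : set X := [set e : X | (0 <= e.1.1 < 1) && (0 <= e.1.2 < f e.1.1) && (0 <= e.1.2 + e.2 < f e.1.1)]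
  `&` [set e : X | W (e.1.1, e.1.2 + e.2) <> W e.1].
have mE0 : measurable E0.
  apply: measurableI.
    apply: measurable_true; apply: measurable_and => //; apply: measurable_and.
    - exact: measurable_fun_ler.
    - exact: measurable_fun_ltr.
  apply: measurable_eq_pair; apply: measurableT_comp => //.
  exact: measurable_fun_pair.
have E0null : {ae leb R, forall x, {ae leb R, forall s,
    leb R (xsection E0 (x, s)) = 0%E}}.
  apply: triple_sections => //; apply: null => // -[[x s] t] [/= /andP[/andP[x01 sf] st] nW].
  by split; [rewrite /special_space/= x01|move=> h; exact: nW (below _ _ _ x01 st h)].
pose E1 : set X := [set e : X | (0 <= e.1.1 < 1) && (0 <= e.1.2 < f e.1.1) && (f e.1.1 <= e.1.2 + e.2 < f e.1.1 + k)]
  `&` [set e : X | W (circle_proj (e.1.1 + al), e.1.2 + e.2 - f e.1.1) <> rot (c * f e.1.1) (W e.1)].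
have mE1 : measurable E1.
  apply: measurableI.
    apply: measurable_true; apply: measurable_and => //; apply: measurable_and.
    - exact: measurable_fun_ler.
    - by apply: measurable_fun_ltr => //; exact: measurable_funD.
  apply: measurable_eq_pair.
    apply: measurableT_comp => //; apply: measurable_fun_pair.
      by apply: measurableT_comp; [exact: measurable_circle_proj|exact: measurable_funD].
    exact: measurable_funB.
  apply: measurable_rot; first exact: measurable_funM.
  exact: measurableT_comp.
have E1null : {ae leb R, forall x, {ae leb R, forall s,
    leb R (xsection E1 (x, s)) = 0%E}}.
  apply: triple_sections => //; apply: null => // -[[x s] t] [/= /andP[/andP[x01 sf] st] nW].
  by split; [rewrite /special_space/= x01|move=> h; exact: nW (above _ _ _ st h)].
have [G1 [mG1 G1M G1P]] := section_average (measurableT_comp measurable_fst mW) W1 k0.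
have [G2 [mG2 G2M G2P]] := section_average (measurableT_comp measurable_snd mW) W2 k0.
pose g (x : R) := (G1 (circle_proj x), G2 (circle_proj x)).
have GP x p : (leb R).-negligible [set s | 0 <= s < k /\ W (x, s) <> p] ->
    (G1 x, G2 x) = p.
  move=> h; rewrite (G1P x p.1) ?(G2P x p.2); [by case: (p)|..];
  by apply: negligibleS h => s [sk hW]; split => // e; apply: hW; rewrite -e.
pose Q x := (exists s, g x = W (circle_proj x, s)) /\
  {ae leb R, forall s, 0 <= s < f x -> W (circle_proj x, s) = g x}.
have aeQ : {ae circle_measure R, forall x, Q x}.
  apply/lebesgue_ae_circle; apply: filterS E0null => x xs x01.
  (* One good height s0 suffices: for almost every t the value at s0 + t agrees with that at s0, so
     the fibre is constant up to a null set. *)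
  have [s0 s0k s0E] := lebesgue_ae_pick k0 xs.
  have /andP[s00 s0k'] := s0k.
  have nW : (leb R).-negligible [set s | 0 <= s < f x /\ W (x, s) <> W (x, s0)].
    apply: negligibleS (negligible_shift s0 (measurable_xsection (x, s0) mE0) s0E).
    move=> s [sf ws]; rewrite /xsection/= inE /E0/=; split => /=.
      by rewrite x01 s00 (lt_le_trans s0k' (kf x)) addrC subrK.
    by rewrite addrC subrK.
  have gE : g x = W (x, s0).
    rewrite /g circle_proj_id//; apply: GP; apply: negligibleS nW => s [/andP[a b] ws]; split => //.
    by rewrite a (lt_le_trans b (kf x)).
  split; rewrite circle_proj_id//; first by exists s0.
  by apply: negligibleS nW => s /= /not_implyP; rewrite gE.
exists g; split.
- split; first by apply: measurable_fun_pair; apply: measurableT_comp => //; exact: measurable_circle_proj.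
  by move=> x; rewrite /g periodic_circle_proj.
- by move=> x; split; [exact: G1M|exact: G2M].
- have aeE1 : {ae circle_measure R, forall x, 0 <= x < 1 /\ {ae leb R, forall s,
      leb R (xsection E1 (x, s)) = 0%E}}.
    by apply/lebesgue_ae_circle; apply: filterS E1null => x.
  apply: circle_aeS (circle_ae_and aeQ aeE1) => x [[_ Qx] [x01 xs]].
  (* From a height s0 that carries the value g x and is good for E1, the height s in [0, k[ above x
     + alpha is reached at time s - s0 + f x, a good time for almost every s. *)
  have [s0 /andP[s00 s0k] [s0E s0W]] := lebesgue_ae_pick k0 (filterI xs Qx).
  have s0f : s0 < f x by exact: lt_le_trans (kf x).
  have {}s0W : W (x, s0) = g x by rewrite -s0W ?s00// circle_proj_id.
  apply: GP.
  apply: negligibleS (negligible_shift (s0 - f x) (measurable_xsection (x, s0) mE1) s0E).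
  move=> s [/andP[s1 s2] ws]; rewrite /xsection/= inE /E1/=.
  have -> : s0 + (s - (s0 - f x)) = f x + s by ring.
  split => /=; first by rewrite x01 s00 s0f lerDl s1 ltrD2l.
  by rewrite addrAC subrr add0r s0W.
(* This link with actual values of w lets a pointwise property of the modulus of w, such as being 0
   or 1, pass to g. *)
- by apply: circle_aeS aeQ => x [[s ->] _]; exists (circle_proj x, s), (- (c * s)).
- apply/(special_aeP _ mf k0 kf fL).
  pose B : set (measurableTypeR R * measurableTypeR R) := special_space f `&` [set z | W z <> g z.1].
  have mB : measurable B.
    apply: measurableI => //; apply: measurable_eq_pair => //; apply: measurableT_comp => //.
    by apply: measurable_fun_pair; apply: measurableT_comp => //; exact: measurable_circle_proj.
  exists B; split => //; last first.
    move=> z [zS wz]; split => // e; apply: wz.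
    have /= <- := congr1 (rot (c * z.2)) e.
    by rewrite rotD subrr rot0.
  apply: plane_null_of_sections => //.
  have lQ := (lebesgue_ae_circle Q).2 aeQ; apply: negligibleS lQ => x h xQ; apply: h => /=.
  apply/negligibleP; first exact: measurable_xsection.
  case: (boolP (0 <= x < 1)) => x01.
    have [_] := xQ x01; apply: negligibleS => s; rewrite /xsection/= inE /B /special_space/= x01/=.
    by move=> -[sf ws]; rewrite circle_proj_id// => h; exact: ws (h sf).
  rewrite (_ : xsection B x = set0); first exact: negligible_set0.
  by apply/seteqP; split => // s; rewrite /xsection/= inE /B /special_space/= (negbTE x01) => -[].
Qed.

(** * The dichotomy *)

Lemma circle_ae_special R (f : R -> R) (k L : R) (P : R -> Prop) :
  measurable_fun setT f -> 0 < k -> (forall x, k <= f x) -> (forall x, f x <= L) ->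
  {ae circle_measure R, forall x, P x} -> {ae special_measure f, forall z, P z.1}.
Proof.
move=> mf k0 kf fL aeP; apply/(special_aeP _ mf k0 kf fL).
have [A [mA A0 PA]] := (lebesgue_circle_null P).2 aeP.
pose B : set (measurableTypeR R * measurableTypeR R) := fst @^-1` A.
have mB : measurable B by rewrite -[X in measurable X]setTI; exact: measurable_fst.
exists B; split => //; last first.
  by move=> z [/andP[z01 _] nP]; apply: PA.
apply: plane_null_of_sections => //.
exists A; split => // x /=; apply: contra_notP => xA.
rewrite (_ : xsection B x = set0) ?measure0//.
by apply/seteqP; split => // s; rewrite /xsection/= inE.
Qed.

Lemma special_aeS R (f : R -> R) (P Q : R * R -> Prop) : (forall z, P z -> Q z) ->
  {ae special_measure f, forall z, P z} -> {ae special_measure f, forall z, Q z}.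
Proof.
move=> PQ [A [mA A0 PA]]; exists A; split => // z nQ.
by apply: PA => Pz; apply: nQ; exact: PQ.
Qed.

Lemma special_ae_and R (f : R -> R) (k L : R) (P Q : R * R -> Prop) :
  measurable_fun setT f -> 0 < k -> (forall x, k <= f x) -> (forall x, f x <= L) ->
  {ae special_measure f, forall z, P z} -> {ae special_measure f, forall z, Q z} ->
  {ae special_measure f, forall z, P z /\ Q z}.
Proof.
move=> mf k0 kf fL /(special_aeP _ mf k0 kf fL) hP /(special_aeP _ mf k0 kf fL) hQ.
apply/(special_aeP _ mf k0 kf fL); apply: negligibleS (negligibleU hP hQ) => z [zS /= h].
by case: (pselect (P z)) => Pz; [right|left]; split => //= Qz; apply: h.
Qed.

Lemma expi_rot R (a : R) (u : R[i]) :
  (complex.Re (expi a * u), complex.Im (expi a * u)) = rot a (complex.Re u, complex.Im u).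
Proof. by case: u => p q; rewrite /rot /expi/=; congr (_, _); rewrite addrC. Qed.

(** Eigenfunctions need not be bounded. For eigenvalue 0 the arctangent of both parts keeps
    invariance and loses no information; for the others, division by the modulus keeps equivariance
    and leaves values of modulus 0 or 1. *)
Lemma weak_mixing_of_birkhoff R (f : R -> R) (al : R) :
  irrational al -> continuous f -> periodic1 f -> (forall x, 0 < f x) ->
  (forall mu : R, 0 < mu -> exists2 e, 0 < e & forall d, 0 < d -> exists (t : nat) (j : int),
    `|t%:R * al - j%:~R| <= d /\
    mean (fun x => cos (mu * birkhoff_sum al f (Posz t) x)) <= 1 - e) ->
  special_flow_weak_mixing al f.
Proof.
move=> ial cf pf f0 hB.
have [k k0 kf] := periodic_min_gt0 cf pf f0.
have [L fL'] := periodic_bounded cf pf.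
have fL x : f x <= L by rewrite (le_trans (ler_norm _)).
have mf : measurable_fun setT f by case: (periodic_bmeas cf pf).
split=> [la|h [mp mq _ hT]]; last first.
  pose w (z : R * R) := (atan (complex.Re (h z)), atan (complex.Im (h z))).
  have matan : measurable_fun setT (@atan R).
    by apply: continuous_measurable_fun; exact: continuous_atan.
  have mw : measurable_fun setT w by apply: measurable_fun_pair; exact: measurableT_comp.
  have at2 (x : R) : atan x ^+ 2 <= 4.
    have := atan_gtNpi2 x; have := atan_ltpi2 x; have := pi_le4 R => h1 h2 h3.
    have : `|atan x| <= 2 by rewrite ler_norml; apply/andP; split; lra.
    by rewrite -(@ler_pXn2r _ 2) ?nnegrE// real_normK ?num_real// => /le_trans; apply; lra.
  (* Each squared arctangent is at most 4, and 8 <= 3^2. *)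
  have [||t|g [[mg pg] gM gT _ hg]] := @flow_cocycle R f al 0 3 w cf pf f0 _ mw.
  - by [].
  - by move=> z; rewrite /w/=; have := at2 (complex.Re (h z)); have := at2 (complex.Im (h z)); lra.
  - apply: special_aeS (hT t) => z; rewrite mulr0 mul0r => e.
    by rewrite rot0 /w e /expi cos0 sin0 mul1r.
  have gT' : {ae circle_measure R, forall x, g (x + al) = g x}.
    by apply: circle_aeS gT => x; rewrite mul0r rot0.
  have b1 : bmeas (fun x => (g x).1).
    by split; [exact: measurableT_comp|exists 3 => x; case: (gM x)].
  have b2 : bmeas (fun x => (g x).2).
    by split; [exact: measurableT_comp|exists 3 => x; case: (gM x)].
  have [a1 ga1] := @ergodic_rotation R al _ ial b1 (fun x => congr1 fst (pg x))
    (circle_aeS (fun x e => congr1 fst e) gT').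
  have [a2 ga2] := @ergodic_rotation R al _ ial b2 (fun x => congr1 snd (pg x))
    (circle_aeS (fun x e => congr1 snd e) gT').
  exists (Complex (tan a1) (tan a2)).
  have hg1 := circle_ae_special mf k0 kf fL ga1.
  have hg2 := circle_ae_special mf k0 kf fL ga2.
  have := special_ae_and mf k0 kf fL (special_ae_and mf k0 kf fL hg1 hg2) hg.
  apply: special_aeS => z [[e1 e2]]; rewrite mul0r rot0 /w => e3.
  by rewrite -e1 -e2 -e3/= !atanK; case: (h z).
split=> [[h [mp mq hn0 hT]]|->]; last first.
  exists (fun=> 1); split.
  - exact: measurable_cst.
  - exact: measurable_cst.
  - move=> /(special_aeP _ mf k0 kf fL) [A [mA A0 SA]].
    have /andP[] := special_space_fin mf k0 kf fL.
    rewrite ltNge => /negP + _; apply; rewrite -A0; apply: le_measure; rewrite ?inE//.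
      exact: measurable_special_space.
    by move=> z zS; apply: SA; split => //= /eqP; rewrite oner_eq0.
  - move=> t; apply/(special_aeP _ mf k0 kf fL).
    rewrite (_ : _ `&` _ = set0); first exact: negligible_set0.
    apply/seteqP; split => // z [_] /=; apply.
    by rewrite mulr0 mul0r /expi cos0 sin0 mulr1.
apply: contrapT => /eqP la0.
pose p z := complex.Re (h z); pose q z := complex.Im (h z).
(* The inverse modulus of h. Its value where h = 0 does not matter, since it is multiplied by p = q
   = 0 there. *)
pose n (z : R * R) := (p z ^+ 2 + q z ^+ 2) `^ (- 2^-1).
have mn : measurable_fun setT n.
  apply: (@measurableT_comp _ _ _ _ _ _ (fun x : R => x `^ (- 2^-1))); first exact: measurable_powR.
  by apply: measurable_funD; apply: measurable_funX.
pose w (z : R * R) := (n z * p z, n z * q z).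
have mw : measurable_fun setT w by apply: measurable_fun_pair; apply: measurable_funM.
have w01 z : (w z).1 ^+ 2 + (w z).2 ^+ 2 = if (p z == 0) && (q z == 0) then 0 else 1.
  rewrite /w/= !exprMn -mulrDr.
  case: ifPn => [/andP[/eqP-> /eqP->]|pq]; first by rewrite expr0n/= addr0 mulr0.
  have s0 : 0 < p z ^+ 2 + q z ^+ 2.
    by rewrite lt_def addr_ge0 ?sqr_ge0// andbT paddr_eq0 ?sqr_ge0// !sqrf_eq0.
  rewrite /n -(powR_mulrn 2 (powR_ge0 _ (- 2^-1))) -powRrM mulNr mulVf// powR_inv1 ?mulVf ?ltW//.
  by rewrite gt_eqF.
have [|t|g [[mg pg] gM gT gw hg]] := @flow_cocycle R f al (2 * pi * la) 1 w cf pf f0 ler01 mw.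
- by move=> z; rewrite w01 expr1n; case: ifP.
- apply: special_aeS (hT t) => z e.
  have := expi_rot (2 * pi * la * t) (h z); rewrite -e => -[e1 e2].
  have en : n (special_flow al f t z) = n z.
    rewrite /n; congr (_ `^ _); rewrite /p/q e1 e2.
    exact: (rot_sqr _ (complex.Re (h z), complex.Im (h z))).
  by rewrite /w en /p /q e1 e2 /rot/=; congr (_, _); ring.
pose N (x : R) := (g x).1 ^+ 2 + (g x).2 ^+ 2.
have b1 : bmeas (fun x => (g x).1).
  by split; [exact: measurableT_comp|exists 1 => x; case: (gM x)].
have b2 : bmeas (fun x => (g x).2).
  by split; [exact: measurableT_comp|exists 1 => x; case: (gM x)].
(* The squared modulus of g is constant by ergodicity and takes the value 0 or 1; the value 0 would
   make h vanish almost everywhere. *)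
have [a Na] : exists a, {ae circle_measure R, forall x, N x = a}.
  apply: (@ergodic_rotation R al) => //; first by apply: bmeasD; exact: bmeasX.
    by move=> x; rewrite /N pg.
  by apply: circle_aeS gT => x e; rewrite /N e rot_sqr.
have N01 : {ae circle_measure R, forall x, N x = 0 \/ N x = 1}.
  apply: circle_aeS gw => x [z [b e]]; rewrite /N e rot_sqr w01.
  by case: ifP; [left|right].
have [x0 [Nx0 Nx01]] := circle_ae_ex (circle_ae_and Na N01).
have a01 : a = 0 \/ a = 1 by rewrite -Nx0.
case: a01 => a01.
  apply: hn0.
  have g0 : {ae circle_measure R, forall x, g x = (0, 0)}.
    apply: circle_aeS Na => x; rewrite /N a01 => /eqP.
    rewrite paddr_eq0 ?sqr_ge0// !sqrf_eq0 => /andP[/eqP g1 /eqP g2].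
    by case: (g x) g1 g2 => ? ? /= -> ->.
  have := special_ae_and mf k0 kf fL (circle_ae_special mf k0 kf fL g0) hg.
  apply: special_aeS => z [e1 e2]; have := w01 z; rewrite e2 rot_sqr e1/= expr0n/= addr0.
  case: ifP => [/andP[/eqP p0 /eqP q0] _|_ /esym/eqP]; last by rewrite oner_eq0.
  by move: p0 q0; rewrite /p /q; case: (h z) => ? ? /= -> ->.
have mu0 : 0 < `|2 * pi * la| by rewrite normr_gt0 !mulf_neq0// gt_eqF// pi_gt0.
have [e e0 he] := hB _ mu0.
have [||||d d0 hd] := @unit_cocycle_mean_cos R al (2 * pi * la) f _ _ cf pf b1 b2 _ _
   (fun x => (gM x).1) (fun x => (gM x).2) _ _ e e0.
- by move=> x; rewrite pg.
- by move=> x; rewrite pg.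
- by rewrite -a01.
- by apply: circle_aeS gT => x ->.
have [t [j [tj ht]]] := he _ d0.
have hlt := hd t j tj.
have e1 : (fun x => cos (2 * pi * la * birkhoff_sum al f (Posz t) x)) =
    fun x => cos (`|2 * pi * la| * birkhoff_sum al f (Posz t) x).
  by apply/funext => x; case: (ger0P (2 * pi * la)) => // _; rewrite mulNr cosN.
by rewrite e1 in hlt; have := lt_le_trans hlt ht; rewrite ltxx.
Qed.

(** Write a_k = r_k / |sin(pi k alpha)|. For k = l q with l >= 2, |sin(pi k alpha)| >= ||q alpha||,
    so the proper multiples add at most r_q / (4 ||q alpha||) <= a_q. The block sum is at most 2
    a_q, and a sum of squares is at most the square of the sum. *)
Lemma block_sqr_bound R (r : nat -> R) (al : R) (q X : nat) : irrational al ->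
  (forall k, 0 <= r k) -> prim al q ->
  (forall n, \sum_(2 <= l < n) r (l * q)%N <= r q / 4) ->
  \sum_(1 <= k < X | den al k == q) (r k / `|sin (pi * (k%:R * al))|) ^+ 2 <=
  4 * (r q / `|sin (pi * (q%:R * al))|) ^+ 2.
Proof.
move=> ial r0 pq hr; pose a k := r k / `|sin (pi * (k%:R * al))|.
have a0 k : 0 <= a k by rewrite divr_ge0.
have q0 : (0 < q)%N by case/andP: pq.
have e0 := dist_int_gt0 ial q0; have sq := abs_sin_le_dist (q%:R * al); set e := dist_int _ in e0 sq.
have sq0 : 0 < `|sin (pi * (q%:R * al))| by rewrite normr_gt0 sin_int_neq0.
have aq : r q / 4 * e^-1 <= a q by rewrite -mulrA -invfM ler_wpM2l// lef_pV2 ?posrE// mulr_gt0.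
have sum_all : \sum_(1 <= k < X | den al k == q) a k <= 2 * a q.
  apply: le_trans (@block_sum_le R r a al e^-1 q X _ _ _ _ _ _) _ => //; last by lra.
    by rewrite invr_ge0 ltW.
  move=> k l l2 kE dE.
  have k0 : (0 < k)%N by rewrite kE muln_gt0 q0 (leq_trans _ l2).
  have s0 : 0 < `|sin (pi * (k%:R * al))| by rewrite normr_gt0 sin_int_neq0.
  rewrite ler_wpM2l// lef_pV2 ?posrE//.
  apply: le_trans (abs_sin_ge_dist _); rewrite dE -/e.
  have : 2 <= l%:R :> R by rewrite ler_nat.
  by rewrite ler_pdivlMr// mulrC => h; rewrite ler_wpM2r// ltW.
have sqr_sum (s : seq nat) (P : pred nat) : \sum_(k <- s | P k) a k ^+ 2 <= (\sum_(k <- s | P k) a k) ^+ 2.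
  elim: s => [|k s ih]; first by rewrite !big_nil expr0n.
  rewrite !big_cons; case: ifP => // _.
  have : 0 <= \sum_(k <- s | P k) a k by apply: sumr_ge0.
  by have := a0 k; move: ih; set S := \sum_(_ <- _ | _) a _; nra.
apply: le_trans (sqr_sum _ _) _.
have -> : 4 * (r q / `|sin (pi * (q%:R * al))|) ^+ 2 = (2 * a q) ^+ 2 by rewrite /a; ring.
by rewrite ler_sqr ?nnegrE ?mulr_ge0// sumr_ge0.
Qed.

(** With q = [den] k, 16 k^2 ||q alpha|| <= q; irrationality bounds ||q alpha|| away from 0 for the
    finitely many positive q < M. *)
Lemma den_lt_bounded R (al : R) M : irrational al ->
  exists K, forall k, (0 < den al k < M)%N -> (k < K)%N.
Proof.
move=> ial; pose s := \sum_(1 <= q < M) (dist_int (q%:R * al))^-1.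
exists (Num.bound (M%:R * s)) => k /andP[d0 dM].
have i0 q : 0 <= (dist_int (q%:R * al))^-1 by rewrite invr_ge0 /dist_int.
have s0 : 0 <= s by apply: sumr_ge0.
have e0 := dist_int_gt0 ial d0; have h := den_sqr_le d0; set e := dist_int _ in e0 h.
have es : e^-1 <= s.
  by rewrite /s (bigD1_seq (den al k))/= ?mem_index_iota ?d0 ?iota_uniq// lerDl sumr_ge0.
have k0 : (0 < k)%N by have [_ [l [l0 -> _]]] := den_spec d0; rewrite muln_gt0 l0.
have k1 : 1 <= k%:R :> R by rewrite ler1n.
have dM' : (den al k)%:R <= M%:R :> R by rewrite ler_nat ltnW.
rewrite -(ltr_nat R); apply: le_lt_trans (archi_boundP _); last by rewrite mulr_ge0.
apply: (@le_trans _ _ (M%:R * e^-1)); last by rewrite ler_wpM2l.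
rewrite ler_pdivlMr//; apply: le_trans dM'; apply: le_trans h.
by rewrite mulrA ler_wpM2r ?(ltW e0)//; nra.
Qed.

(** By contraposition: a non-resonant k contributes at most (32 C)^2 / k^2, the resonant k with
    small denominator are finitely many, and every other block costs at most 4 a_q^2. A bound B on
    the primitive sums thus bounds the whole sum by 2 D + 4 B. *)
Lemma prim_sums_unbounded R (r : nat -> R) (al C : R) (m0 : nat) : irrational al ->
  (forall k, 0 <= r k) -> (forall k, (0 < k)%N -> r k <= C / k%:R ^+ 3) ->
  (forall q n, (m0 <= q)%N -> \sum_(2 <= l < n) r (l * q)%N <= r q / 4) ->
  (forall B, exists n, B < \sum_(1 <= k < n) (r k / (2 * sin (pi * (k%:R * al)))) ^+ 2) ->
  forall M B, exists N, B <= \sum_(M <= q < N | prim al q) (r q / `|sin (pi * (q%:R * al))|) ^+ 2.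
Proof.
move=> ial r0 rC hr unb M B; apply: contrapT => /forallNP hB.
have C0 : 0 <= C by have := le_trans (r0 1%N) (rC 1%N isT); rewrite expr1n divr1.
pose a k := r k / `|sin (pi * (k%:R * al))|.
have a0 k : 0 <= a k by rewrite divr_ge0.
pose M1 := maxn M m0.
have [K KP] := den_lt_bounded M1 ial.
(* The factor K^2 lets the finitely many exceptional k < K be majorized by A / k^2 as well. *)
pose A := \sum_(1 <= k < K) a k ^+ 2 * K%:R ^+ 2.
have A0 : 0 <= A by apply: sumr_ge0 => k _; rewrite mulr_ge0// exprn_ge0.
pose D := (32 * C) ^+ 2 + A.
have D0 : 0 <= D by rewrite addr_ge0// sqr_ge0.
(* At most the term q = [den] k is nonzero; writing it as a sum over q prepares the exchange of
   summations. *)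
pose blk n k := \sum_(M1 <= q < n | prim al q) (if den al k == q then a k ^+ 2 else 0).
have blk0 n k : 0 <= blk n k by apply: sumr_ge0 => q _; case: ifP => // _; exact: sqr_ge0.
have pt n k : (0 < k < n)%N -> a k ^+ 2 <= D * (k%:R ^+ 2)^-1 + blk n k.
  move=> /andP[k0 kn]; have kR : 0 < k%:R :> R by rewrite ltr0n.
  have k1 : 1 <= k%:R :> R by rewrite ler1n.
  have Dk : 0 <= D * (k%:R ^+ 2)^-1 by rewrite divr_ge0// sqr_ge0.
  case: (posnP (den al k)) => [dk|d0].
    apply: ler_wpDr => //; apply: (@le_trans _ _ ((32 * C) ^+ 2 * (k%:R ^+ 2)^-1)); last first.
      by rewrite ler_wpM2r ?invr_ge0 ?sqr_ge0// lerDl.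
    have nres : 1 <= dist_int (k%:R * al) * (16 * k%:R).
      rewrite leNgt; apply/negP => h.
      have rk : resonant al k by rewrite /resonant k0.
      move: dk; rewrite /den rk => /eqP; rewrite eqn0Ngt divn_gt0 ?gcdn_gt0 ?k0//.
      by rewrite dvdn_leq// dvdn_gcdl.
    have s0 : 0 < `|sin (pi * (k%:R * al))| by rewrite normr_gt0 sin_int_neq0.
    have ak : a k <= 32 * C / k%:R.
      rewrite /a ler_pdivrMr//.
      have h1 := abs_sin_ge_dist (k%:R * al).
      have h2 : (32 * k%:R)^-1 <= `|sin (pi * (k%:R * al))|.
        apply: le_trans h1; rewrite ler_pdivlMr// (_ : _ * 2 = 1 / (16 * k%:R)).
          by rewrite ler_pdivrMr// mulr_gt0.
        by field; rewrite gt_eqF.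
      apply: (le_trans (rC k k0)).
      apply: (@le_trans _ _ (32 * C / k%:R * (32 * k%:R)^-1)); last first.
        by rewrite ler_wpM2l// divr_ge0// mulr_ge0.
      rewrite (_ : 32 * C / k%:R * (32 * k%:R)^-1 = C / k%:R ^+ 2); last by field; rewrite gt_eqF.
      by rewrite ler_wpM2l// lef_pV2 ?posrE ?exprn_gt0// ler_weXn2l.
    by rewrite -exprVn -exprMn ler_sqr ?nnegrE// mulr_ge0 ?mulr_ge0 ?invr_ge0.
  case: (ltnP (den al k) M1) => dM.
    have kK : (k < K)%N by apply: KP; rewrite d0.
    apply: ler_wpDr => //; rewrite ler_pdivlMr ?exprn_gt0//.
    apply: (@le_trans _ _ A); last by rewrite lerDr sqr_ge0.
    rewrite /A (bigD1_seq k)/= ?mem_index_iota ?k0 ?iota_uniq//.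
    rewrite ler_wpDr//; first by apply: sumr_ge0 => i _; rewrite mulr_ge0// exprn_ge0.
    by rewrite ler_wpM2l ?sqr_ge0// ler_sqr ?nnegrE// ler_nat ltnW.
  apply: ler_wpDl => //.
  have [pd [l [l0 kE _]]] := den_spec d0.
  rewrite /blk -big_filter (bigD1_seq (den al k))/= ?filter_uniq ?iota_uniq//; last first.
    rewrite mem_filter pd mem_index_iota dM/= (leq_ltn_trans _ kn)//.
    by rewrite [leqRHS]kE leq_pmull.
  rewrite eqxx lerDl; apply: sumr_ge0 => q _; case: ifP => // _; exact: sqr_ge0.
have [n] := unb (D * 2 + 4 * B).
apply/negP; rewrite -leNgt.
apply: (@le_trans _ _ (\sum_(1 <= k < n) (D * (k%:R ^+ 2)^-1 + blk n k))).
  rewrite big_nat_cond [leRHS]big_nat_cond; apply: ler_sum => k /andP[kn _].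
  apply: le_trans (pt n k kn).
  rewrite /a !expr_div_n real_normK ?num_real// ler_wpM2l ?sqr_ge0//.
  have k0 : (0 < k)%N by case/andP: kn.
  have s0 : 0 < sin (pi * (k%:R * al)) ^+ 2 by rewrite exprn_even_gt0//= sin_int_neq0.
  have s4 : sin (pi * (k%:R * al)) ^+ 2 <= (2 * sin (pi * (k%:R * al))) ^+ 2.
    by rewrite exprMn ler_peMl ?(ltW s0)//; lra.
  by rewrite lef_pV2 ?posrE ?(lt_le_trans s0 s4).
rewrite big_split/= -mulr_sumr lerD//.
  by rewrite ler_wpM2l//; have := @sum_inv_sqr R 1 n isT; rewrite divr1.
rewrite /blk exchange_big/=.
apply: (@le_trans _ _ (\sum_(M1 <= q < n | prim al q) 4 * a q ^+ 2)).
  rewrite big_nat_cond [leRHS]big_nat_cond; apply: ler_sum => q /andP[/andP[Mq _] pq].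
  have mq : (m0 <= q)%N by apply: leq_trans Mq; rewrite leq_maxr.
  by rewrite -big_mkcond/=; apply: block_sqr_bound => // j; exact: hr.
rewrite -mulr_sumr ler_wpM2l//.
have /negP := hB n; rewrite -ltNge => /ltW; apply: le_trans.
have [nM|Mn] := leqP n M1; first by rewrite big_geq//; apply: sumr_ge0 => q _; exact: sqr_ge0.
rewrite [leRHS](big_cat_nat (n := M1))/= ?leq_maxl ?(ltnW Mn)//.
by rewrite lerDr; apply: sumr_ge0 => q _; exact: sqr_ge0.
Qed.

Lemma of_class_C_continuous R (f : R -> R) n : of_class_C n.+1 f -> continuous f.
Proof.
by move=> [df _] x; apply: differentiable_continuous; apply/derivable1_diffP; exact: (df 0%N x).
Qed.

(** The strict inequality against the empty partial sum already forces a nonzero coefficient at q;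
    the other partial sums are dominated by the series. *)
Lemma multiples_bound R (f : R -> R) (K1 : R) (q : nat) : K1 < 4^-1 ->
  (\sum_(2 <= l <oo) (Normc.normc (fourier_coef f (l * q)%N))%:E
     < (K1 * Normc.normc (fourier_coef f q))%:E)%E ->
  0 < rho f q /\ forall n, \sum_(2 <= l < n) rho f (l * q)%N <= rho f q / 4.
Proof.
move=> K14 h.
have c0 (k : nat) : 0 <= Normc.normc (fourier_coef f k).
  by have := rho_ge0 f k; rewrite /rho pmulr_rge0.
have part n : \sum_(2 <= l < n) Normc.normc (fourier_coef f (l * q)%N) <
    K1 * Normc.normc (fourier_coef f q).
  rewrite -lte_fin -sumEFin; apply: le_lt_trans h.
  by apply: nneseries_lim_ge => l _ _; rewrite lee_fin.
have cq := c0 q.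
have := part 2%N; rewrite big_geq// => p0.
have cq0 : 0 < Normc.normc (fourier_coef f q).
  by rewrite lt_neqAle cq andbT eq_sym; apply/eqP => e; rewrite e mulr0 ltxx in p0.
split; first by rewrite /rho mulr_gt0.
move=> n; rewrite /rho -mulr_sumr -mulrA ler_wpM2l//.
by rewrite (le_trans (ltW (part n)))// mulrC ler_wpM2l// ltW.
Qed.

Theorem theorem1 (R : realType) (phi : R -> R)
  (phi_per : periodic1 phi)
  (phi_C3 : of_class_C 3 phi)
  (phi_pos : forall x, 0 < phi x)
  (H1 : exists C : nat -> R,
      (forall m : nat, (1 <= m)%N ->
         0 <= C m /\
         (\sum_(2 <= l <oo) (Normc.normc (fourier_coef phi (l * m)%N) ^+ 2)%:E
            <= (C m * Normc.normc (fourier_coef phi m) ^+ 2)%:E)%E) /\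
      (\sum_(1 <= m <oo) (C m)%:E < +oo)%E)
  (H2 : exists K1 : R, 0 < K1 < 4^-1 /\
      \forall m \near \oo,
        (\sum_(2 <= l <oo) (Normc.normc (fourier_coef phi (l * m)%N))%:E
           < (K1 * Normc.normc (fourier_coef phi m))%:E)%E)
  (H3 : exists K2 : R, 0 < K2 /\
      \forall m \near \oo,
        (\sum_(2 <= l <oo) (Normc.normc (l%:R * fourier_coef phi (l * m)%N))%:E
           < (K2 * Normc.normc (fourier_coef phi m))%:E)%E) :
  forall alpha : R, irrational alpha ->
    special_flow_weak_mixing alpha phi \/ L2_conjugate_to_suspension alpha phi.
Proof.
move=> al ial; have cphi := of_class_C_continuous phi_C3.
have [K1 [/andP[_ K14] [m0 _ hm0]]] := H2.
have rpos q : (m0 <= q)%N -> 0 < rho phi q by move=> /hm0/(multiples_bound K14)[].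
have hr q n : (m0 <= q)%N -> \sum_(2 <= l < n) rho phi (l * q)%N <= rho phi q / 4.
  by move=> /hm0/(multiples_bound K14)[_]; apply.
have [om [C [C0 rC fs]]] := fourier_series phi_per phi_C3.
pose s n := \sum_(1 <= k < n) (rho phi k / (2 * sin (pi * (k%:R * al)))) ^+ 2.
case: (pselect (exists B, forall n, s n <= B)) => [[B sB]|unb].
  right; apply: suspension_of_bounded_transfer fs sB => //.
  (* The constant roof has to be positive: the mean is at least the minimum of phi. *)
  have [k k0 kphi] := periodic_min_gt0 cphi phi_per phi_pos.
  apply: lt_le_trans k0 _; rewrite -(mean_cst k).
  by apply: le_mean => //; [exact: bmeas_cst|exact: periodic_bmeas].
left; apply: weak_mixing_of_birkhoff => // mu mu0.
apply: (@birkhoff_not_nearly_constant R phi (rho phi) om (mean phi) C al mu m0) => //.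
  exact: rho_ge0.
apply: (@prim_sums_unbounded R (rho phi) al C m0) => //; first exact: rho_ge0.
move=> B; apply: contrapT => /forallNP h; apply: unb; exists B => n.
by have /negP := h n; rewrite -leNgt.
Qed.
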